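(* Let $p$ be a prime, $n\ge 1$, $s>0$ and $f\in\mathcal{S}(\mathbb{Q}_p^n)$. Equip the tree $\mathcal{T}_{p^n}$ with the edge weights $w_{v_{k-1}v_k}=p^{k(s-n)}$ on the edge joining $v_{k-1}=(\boldsymbol{x},k-1)$ and $v_k=(\boldsymbol{x},k)$, and consider the problem for a function $\varphi$ on the vertices of $\mathcal{T}_{p^n}$: \[ \begin{cases}\Delta_w\varphi(v)=0,& v\in\mathcal{T}_{p^n};\\ \lim_{k\to+\infty}\varphi_k(\boldsymbol{x})=f(\boldsymbol{x}),&\boldsymbol{x}\in\mathbb{Q}_p^n;\\ \lim_{k\to-\infty}\varphi_k=0,&\end{cases} \] where the last condition means that $\varphi(v)\to0$ along every sequence of vertices $v\to\infty$ (convergence to the end $\infty$). Then: 1. This problem has a unique bounded weighted-harmonic solution $\varphi$ that is continuous on the end compactification of $\mathcal{T}_{p^n}$. 2. $\varphi_k\to f$ uniformly and in $L^2(\mathbb{Q}_p^n)$ as $k\to+\infty$. 3. The limit \[\partial_{n,s}^{(p)}\varphi(\boldsymbol{x})=\lim_{k\to+\infty}p^{(k+1)s}\bigl(f(\boldsymbol{x})-\varphi_k(\boldsymbol{x})\bigr)\] (the deformed boundary normal derivative) exists pointwise and in $L^2(\mathbb{Q}_p^n)$, and $\partial_{n,s}^{(p)}\varphi(\boldsymbol{x})=D^sf(\boldsymbol{x})$. 4. The solution satisfies the energy identity \[\mathcal{E}[\varphi]=\sum_{k\in\mathbb{Z}}p^{ks}\int_{\mathbb{Q}_p^n}|\varphi_k(\boldsymbol{x})-\varphi_{k-1}(\boldsymbol{x})|^2d\boldsymbol{x}=\frac12\sum_{u\in\mathcal{T}_{p^n}}\sum_{v\sim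 u}w_{uv}|\varphi(u)-\varphi(v)|^2=(1-p^{-s})\int_{\mathbb{Q}_p^n}\overline{f(\boldsymbol{x})}\,D^sf(\boldsymbol{x})\,d\boldsymbol{x}.\]
   Context: Norm and measure: for $\boldsymbol{x}\in\mathbb{Q}_p^n$, $\|\boldsymbol{x}\|_p=\max_i|x_i|_p$; $d\boldsymbol{x}$ is Haar measure with $|\mathbb{Z}_p^n|=1$. $\mathcal{S}(\mathbb{Q}_p^n)$ is the Bruhat--Schwartz space of locally constant, compactly supported complex-valued functions. Fourier transform: $\hat f(\boldsymbol{\xi})=\int_{\mathbb{Q}_p^n}f(\boldsymbol{x})\chi_p(\boldsymbol{x}\cdot\boldsymbol{\xi})\,d\boldsymbol{x}$, with $\chi_p(x)=e^{2\pi i\{x\}_p}$ ($\{\cdot\}_p$ the $p$-adic fractional part) and $\boldsymbol{x}\cdot\boldsymbol{\xi}=\sum_i x_i\xi_i$. The Vladimirov--Taibleson operator $D^s$ ($s>0$) is defined by $\widehat{D^sf}(\boldsymbol{\xi})=\|\boldsymbol{\xi}\|_p^s\hat f(\boldsymbol{\xi})$; equivalently, for $f\in\mathcal{S}(\mathbb{Q}_p^n)$, $D^sf(\boldsymbol{x})=\frac{1-p^s}{1-p^{-s-n}}\int_{\mathbb{Q}_p^n}\frac{f(\boldsymbol{y})-f(\boldsymbol{x})}{\|\boldsymbol{y}-\boldsymbol{x}\|_p^{s+n}}d\boldsymbol{y}$. Tree: the vertices of $\mathcal{T}_{p^n}$ are the pairs $(\boldsymbol{x},k)$ with $k\in\mathbb{Z}$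 and $\boldsymbol{x}\in\mathbb{Q}_p^n/p^k\mathbb{Z}_p^n$ (equivalently, the balls $\boldsymbol{x}+p^k\mathbb{Z}_p^n$). Each vertex $(\boldsymbol{x},k)$ is adjacent to its unique upper neighbor $(\boldsymbol{x},k-1)$ and to its $p^n$ lower neighbors $(\boldsymbol{x}+\boldsymbol{a}p^k,k+1)$, $\boldsymbol{a}\in\mathbb{F}_p^n$ (identified with $\{0,\dots,p-1\}^n$), and to no other vertex; $u\sim v$ denotes adjacency. This is the $(p^n+1)$-regular tree; its set of ends is $\partial\mathcal{T}_{p^n}=\mathbb{Q}_p^n\cup\{\infty\}$, where $\boldsymbol{x}\in\mathbb{Q}_p^n$ is the end of the ray $((\boldsymbol{x},k))_{k\to+\infty}$ and $\infty$ is the common end of the upward rays $k\to-\infty$. The end compactification is $\mathcal{T}_{p^n}\cup\partial\mathcal{T}_{p^n}$ with its usual topology, the boundary values being $f$ on $\mathbb{Q}_p^n$ and $0$ at $\infty$. For a function $\varphi$ on vertices write $\varphi_k(\boldsymbol{x})=\varphi(\boldsymbol{x},k)$, regarded as a function on $\mathbb{Q}_p^n$ constant on cosets of $p^k\mathbb{Z}_p^n$. Laplacian: $\Delta_w\varphi(v)=\sum_{u\sim v}w_{uv}(\varphi(u)-\varphi(v))$; ''weighted-harmonic'' means $\Delta_w\varphi=0$ at every vertex. $\mathcal{E}[\varphi]$ denotes the weighted Dirichlet energy of $\varphi$, given by either of the first two expressions in the energy identity. *)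

(* Defs.v *)
From HB Require Import structures.
From mathcomp Require Import all_boot all_order all_algebra.
From mathcomp Require Import complex.
From mathcomp Require Import all_classical all_reals all_analysis.

Set Implicit Arguments.
Unset Strict Implicit.
Unset Printing Implicit Defensive.

Import Order.TTheory GRing.Theory Num.Theory numFieldNormedType.Exports.

Local Open Scope classical_set_scope.
Local Open Scope ring_scope.

(* Z_p is the inverse limit of the rings Z/p^k: a p-adic integer is the sequence
   of its residues, the k-th one being represented in [0, p^k[.  Both the
   compatibility and the range of the representatives follow from the single
   equation below. *)
Record padic_int (p : nat) (p_pr : prime p) : Type := PadicInt {
  residue : nat -> int;
  residueP : forall k, residue k = (residue k.+1 %% (p ^ k)%N%:Z)%Z }.

Section PadicInt.
Variables (p : nat) (p_pr : prime p).
Local Notation Zp := (padic_int p_pr).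
Local Notation q k := ((p ^ k)%N%:Z).
Implicit Types x y z : Zp.

HB.instance Definition _ := gen_eqMixin Zp.
HB.instance Definition _ := gen_choiceMixin Zp.

Lemma padic_int_eq x y : residue x =1 residue y -> x = y.
Proof.
case: x y => [x xP] [y yP] /= /funext xy; subst y.
by congr PadicInt; exact: Prop_irrelevance.
Qed.

Lemma residue_mod x k : (residue x k %% q k)%Z = residue x k.
Proof. by rewrite {1}residueP modz_mod -residueP. Qed.

Lemma modz_modXS (m : int) k : ((m %% q k.+1)%Z %% q k)%Z = (m %% q k)%Z.
Proof.
have -> : q k.+1 = p%:Z * q k by rewrite -PoszM expnS.
by rewrite [in RHS](divz_eq m (p%:Z * q k)) mulrA modzMDl.
Qed.

Lemma residue_subproof (u : nat -> int) :
  (forall k, u k.+1 = u k %[mod q k])%Z ->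
  forall k, (u k %% q k)%Z = ((u k.+1 %% q k.+1)%Z %% q k)%Z.
Proof. by move=> uP k; rewrite modz_modXS uP. Qed.

Lemma residueSE x k : (residue x k.+1 = residue x k %[mod q k])%Z.
Proof. by rewrite -residueP residue_mod. Qed.

Lemma add_subproof x y k :
  (residue x k.+1 + residue y k.+1 = residue x k + residue y k %[mod q k])%Z.
Proof. by rewrite -modzDm !residueSE modzDm. Qed.

Lemma opp_subproof x k : (- residue x k.+1 = - residue x k %[mod q k])%Z.
Proof. by rewrite -modzNm residueSE modzNm. Qed.

Lemma mul_subproof x y k :
  (residue x k.+1 * residue y k.+1 = residue x k * residue y k %[mod q k])%Z.
Proof. by rewrite -modzMm !residueSE modzMm. Qed.

Lemma cst_subproof (m : int) k : (m = m %[mod q k])%Z. Proof. by []. Qed.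

Definition padic_int_of_int m : Zp :=
  PadicInt p_pr (residue_subproof (cst_subproof m)).
Definition padic_int_add x y : Zp :=
  PadicInt p_pr (residue_subproof (add_subproof x y)).
Definition padic_int_opp x : Zp :=
  PadicInt p_pr (residue_subproof (opp_subproof x)).
Definition padic_int_mul x y : Zp :=
  PadicInt p_pr (residue_subproof (mul_subproof x y)).

Lemma padic_int_addA : associative padic_int_add.
Proof.
by move=> x y z; apply: padic_int_eq => k /=; rewrite modzDmr modzDml addrA.
Qed.

Lemma padic_int_addC : commutative padic_int_add.
Proof. by move=> x y; apply: padic_int_eq => k /=; rewrite addrC. Qed.

Lemma padic_int_add0 : left_id (padic_int_of_int 0) padic_int_add.
Proof.
by move=> x; apply: padic_int_eq => k /=; rewrite modzDml add0r residue_mod.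
Qed.

Lemma padic_int_addN :
  left_inverse (padic_int_of_int 0) padic_int_opp padic_int_add.
Proof. by move=> x; apply: padic_int_eq => k /=; rewrite modzDml addNr. Qed.

HB.instance Definition _ := GRing.isZmodule.Build Zp
  padic_int_addA padic_int_addC padic_int_add0 padic_int_addN.

Lemma padic_int_mulA : associative padic_int_mul.
Proof.
by move=> x y z; apply: padic_int_eq => k /=; rewrite modzMmr modzMml mulrA.
Qed.

Lemma padic_int_mulC : commutative padic_int_mul.
Proof. by move=> x y; apply: padic_int_eq => k /=; rewrite mulrC. Qed.

Lemma padic_int_mul1 : left_id (padic_int_of_int 1) padic_int_mul.
Proof.
by move=> x; apply: padic_int_eq => k /=; rewrite modzMml mul1r residue_mod.
Qed.

Lemma padic_int_mulDl : left_distributive padic_int_mul padic_int_add.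
Proof.
move=> x y z; apply: padic_int_eq => k /=.
by rewrite modzMml modzDm mulrDl.
Qed.

Lemma padic_int_1neq0 : padic_int_of_int 1 != 0.
Proof.
apply/eqP => /(congr1 (fun x => residue x 1%N)) /=.
by rewrite expn1 mod0z modz_small // ltz_nat prime_gt1.
Qed.

HB.instance Definition _ := GRing.Zmodule_isComNzRing.Build Zp
  padic_int_mulA padic_int_mulC padic_int_mul1 padic_int_mulDl padic_int_1neq0.

Definition padic_int_unit : pred Zp := fun x => `[< exists y, y * x = 1 >].
Definition padic_int_inv x : Zp :=
  if x \in padic_int_unit then xget x [set y | y * x = 1] else x.

Lemma padic_int_mulVx : {in padic_int_unit, left_inverse 1 padic_int_inv *%R}.
Proof.
move=> x xU; rewrite /padic_int_inv xU.
by have /asboolP := xU; exact: xgetPex.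
Qed.

Lemma padic_int_unitPl x y : y * x = 1 -> padic_int_unit x.
Proof. by move=> yx; apply/asboolP; exists y. Qed.

Lemma padic_int_invx_out : {in [predC padic_int_unit], padic_int_inv =1 id}.
Proof. by move=> x /negbTE xU; rewrite /padic_int_inv xU. Qed.

HB.instance Definition _ := GRing.ComNzRing_hasMulInverse.Build Zp
  padic_int_mulVx padic_int_unitPl padic_int_invx_out.

Lemma residue_modX x j i : (j <= i)%N -> (residue x i %% q j)%Z = residue x j.
Proof.
elim: i => [|i IHi]; first by rewrite leqn0 => /eqP ->; exact: residue_mod.
rewrite leq_eqVlt => /orP[/eqP ->|]; first exact: residue_mod.
rewrite ltnS => ji; rewrite -(IHi ji) (residueP x i).
have -> : q i = q (i - j) * q j by rewrite -PoszM -expnD subnK.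
rewrite [in LHS](divz_eq (residue x i.+1) (q (i - j) * q j)).
by rewrite mulrA modzMDl.
Qed.

Lemma residue_dvd x k i : residue x k != 0 -> (k <= i)%N ->
  ~~ (q k %| residue x i)%Z.
Proof.
by move=> xk ki; apply: contra xk => /dvdz_mod0P; rewrite residue_modX // => ->.
Qed.

Lemma padic_int_neq0 x : x != 0 -> exists k, residue x k != 0.
Proof.
move=> x0; apply: contrapT => /forallNP xP; case/negP: x0; apply/eqP.
apply: padic_int_eq => k /=; rewrite mod0z; apply/eqP/negPn/negP.
exact: xP.
Qed.

Lemma padic_int_idomain : GRing.integral_domain_axiom Zp.
Proof.
move=> x y xy0; apply: contrapT => /negP; rewrite negb_or.
case/andP => /padic_int_neq0 [a xa] /padic_int_neq0 [b yb].
have := congr1 (fun z => residue z (a + b)) xy0; rewrite /= mod0z.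
move/dvdz_mod0P; rewrite dvdzE abszM /= => pab.
have := residue_dvd xa (leq_addr b a); rewrite dvdzE /= => xab.
have := residue_dvd yb (leq_addl a b); rewrite dvdzE /= => yab.
set X := `|residue x (a + b)|%N in pab xab.
set Y := `|residue y (a + b)|%N in pab yab.
have X0 : (0 < X)%N by case: (X) xab => //; rewrite dvdn0.
have Y0 : (0 < Y)%N by case: (Y) yab => //; rewrite dvdn0.
move: pab xab yab; rewrite !pfactor_dvdn ?muln_gt0 ?X0 // lognM //.
rewrite -!ltnNge => pab xab yab.
have := leq_add xab (ltnW yab); rewrite addSn => lt_ab.
by have := leq_trans lt_ab pab; rewrite ltnn.
Qed.

HB.instance Definition _ :=
  GRing.ComUnitRing_isIntegral.Build Zp padic_int_idomain.

End PadicInt.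

Section Padic.
Variables (p : nat) (p_pr : prime p).

Definition padic : Type := {fraction (padic_int p_pr)}.
HB.instance Definition _ := GRing.Field.on padic.
HB.instance Definition _ := isPointed.Build padic 0.

Definition padic_of_int (z : padic_int p_pr) : padic := FracField.tofrac z.
HB.instance Definition _ :=
  GRing.RMorphism.copy padic_of_int (@FracField.tofrac (padic_int p_pr)).

(* the fractional ideal p^k Z_p *)
Definition pideal (k : int) : set padic :=
  [set p%:R ^ k * padic_of_int z | z in [set: padic_int p_pr]].

Definition padic_open : set (set padic) :=
  [set U | forall x, U x -> exists k : int, forall h, pideal k h -> U (x + h)].

Lemma padic_openT : padic_open setT.
Proof. by move=> x _; exists 0. Qed.

Lemma pideal_le (j k : nat) : (j <= k)%N -> pideal k%:Z `<=` pideal j%:Z.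
Proof.
move=> jk _ [z _ <-]; exists (p%:R ^+ (k - j) * z) => //.
rewrite rmorphM rmorphXn rmorph_nat mulrA -!exprnP.
by rewrite -exprD subnKC.
Qed.

Lemma pideal_le_abs (k : int) : pideal `|k|%N%:Z `<=` pideal k.
Proof.
case: k => k; first exact: subset_refl.
move=> _ [z _ <-]; exists (p%:R ^+ (k.+1 + k.+1) * z) => //.
rewrite rmorphM rmorphXn rmorph_nat mulrA.
suff -> : p%:R ^ Negz k * p%:R ^+ (k.+1 + k.+1) = p%:R ^+ k.+1 :> padic by [].
rewrite NegzE -exprnN exprD mulrA.
have [p0|p0] := eqVneq (p%:R : padic) 0; first by rewrite p0 !expr0n !mulr0.
by rewrite mulVf ?mul1r ?expf_neq0.
Qed.

Lemma padic_openI : setI_closed padic_open.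
Proof.
move=> U V oU oV x [/oU[j Uj] /oV[k Vk]].
exists (maxn `|j| `|k|)%N => h hjk; split; [apply: Uj|apply: Vk];
  by apply: pideal_le_abs; apply: pideal_le hjk; rewrite ?leq_maxl ?leq_maxr.
Qed.

Lemma padic_open_bigcup (I : Type) (U : I -> set padic) :
  (forall i, padic_open (U i)) -> padic_open (\bigcup_i U i).
Proof.
move=> oU x [i _ Uix]; have [k Uk] := oU i _ Uix.
by exists k => h kh; exists i => //; exact: Uk.
Qed.

HB.instance Definition _ := isOpenTopological.Build padic
  padic_openT padic_openI padic_open_bigcup.

(* v(x) = k when x = p^k u with u a unit of Z_p; the value at 0 is irrelevant *)
Definition padic_val (x : padic) : int :=
  xget 0 [set k : int | exists2 u : padic_int p_pr,
            u \is a GRing.unit & x = p%:R ^ k * padic_of_int u].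

Definition padic_norm (R : realType) (x : padic) : R :=
  if x == 0 then 0 else p%:R ^ (- padic_val x).

(* {x}_p is the element of Z[1/p] in [0, 1[ that differs from x by an element
   of Z_p *)
Definition padic_frac (x : padic) : rat :=
  xget 0 [set r : rat | [/\ 0 <= r < 1,
                            exists m, r * p%:R ^+ m \is a Num.int
                          & pideal 0 (x - ratr r)]].

Definition padic_char (R : realType) (x : padic) : R[i] :=
  let t := 2 * pi * ratr (padic_frac x) in Complex (cos t) (sin t).

End Padic.

Section PadicSpace.
Variables (R : realType) (p : nat) (p_pr : prime p) (n : nat).
Local Notation Qp := (padic p_pr).
Local Notation Qpn := 'rV[Qp]_n.
Implicit Types (x y xi : Qpn) (f g : Qpn -> R[i]).

Definition vnorm x : R := \big[Num.max/0]_(i < n) padic_norm R (x 0 i).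

Definition dotp x y : Qp := \sum_(i < n) x 0 i * y 0 i.

(* the coset x + p^k Z_p^n *)
Definition pcoset x (k : int) : set Qpn :=
  [set y | forall i, pideal k (y 0 i - x 0 i)].

Definition borel_Qpn := g_sigma_algebraType (open : set (set Qpn)).

Definition normalized_haar (mu : {measure set borel_Qpn -> \bar R}) :=
  (forall x (A : set borel_Qpn), measurable A ->
     mu [set x + y | y in (A : set Qpn)] = mu A)
  /\ mu (pcoset 0 0) = 1%E.

Definition schwartz f :=
  (forall x, \forall y \near x, f y = f x) /\
  compact (closure [set x | f x != 0]).

Definition modulus (z : R[i]) : R := Normc.normc z.

Variable mu : {measure set borel_Qpn -> \bar R}.

Definition cmeasurable f :=
  measurable_fun [set: borel_Qpn] (fun x => complex.Re (f x)) /\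
  measurable_fun [set: borel_Qpn] (fun x => complex.Im (f x)).

Definition cintegrable f :=
  mu.-integrable [set: borel_Qpn] (fun x => (complex.Re (f x))%:E) /\
  mu.-integrable [set: borel_Qpn] (fun x => (complex.Im (f x))%:E).

Definition cintegral f : R[i] :=
  Complex (\int[mu]_x complex.Re (f x)) (\int[mu]_x complex.Im (f x)).

Definition sqnorm2 f : \bar R := \int[mu]_x ((modulus (f x)) ^+ 2)%:E.

Definition inL2 f := cmeasurable f /\ (sqnorm2 f < +oo)%E.

Definition cvgL2 (f_ : nat -> Qpn -> R[i]) f :=
  [/\ forall k, inL2 (f_ k), inL2 f
    & sqnorm2 (fun x => f_ k x - f x) @[k --> \oo] --> 0%E].

Definition fourier f xi : R[i] :=
  cintegral (fun x => f x * padic_char R (dotp x xi)).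

(* The Fourier transform determines D^s f only almost everywhere; continuity
   selects the pointwise representative. *)
Definition is_vladimirov (s : R) f g :=
  [/\ continuous (g : Qpn -> R[i]^o), cintegrable g
    & forall xi, fourier g xi = (vnorm xi `^ s)%:C%C * fourier f xi].

Definition vladimirov (s : R) f : Qpn -> R[i] :=
  xget (fun=> 0) (is_vladimirov s f).

End PadicSpace.

Section Tree.
Variables (R : realType) (p : nat) (p_pr : prime p) (n : nat).
Local Notation Qp := (padic p_pr).
Local Notation Qpn := 'rV[Qp]_n.

Record vertex : Type := Vertex {
  vlevel : int;
  vcoset : set Qpn;
  _ : exists x, vcoset = pcoset x vlevel }.

HB.instance Definition _ := gen_eqMixin vertex.
HB.instance Definition _ := gen_choiceMixin vertex.

Definition vtx (x : Qpn) (k : int) : vertex :=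
  @Vertex k (pcoset x k) (ex_intro _ x erefl).

Definition adj (u v : vertex) := exists x k,
  v = vtx x k /\
  (u = vtx x (k - 1) \/
   exists a : 'I_n -> 'I_p,
     u = vtx (x + p%:R ^ k *: \row_i (a i)%:R) (k + 1)).

(* on the edge joining (x, k-1) and (x, k), k is the larger of the two levels *)
Definition weight (s : R) (u v : vertex) : R :=
  p%:R `^ ((Num.max (vlevel u) (vlevel v))%:~R * (s - n%:R)).

Definition laplacian (s : R) (phi : vertex -> R[i]) (v : vertex) : R[i] :=
  \sum_(u \in [set u | adj u v]) (weight s u v)%:C%C * (phi u - phi v).

Inductive compactified :=
  | CVertex of vertex
  | CEnd of Qpn
  | CInfty.

HB.instance Definition _ := gen_eqMixin compactified.
HB.instance Definition _ := gen_choiceMixin compactified.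
HB.instance Definition _ := isPointed.Build compactified CInfty.

(* Deleting the edge between b and its upper neighbor splits the tree in two
   half-trees; this is the lower one, with its ends. *)
Definition lower_half (b : vertex) : set compactified :=
  [set c | match c with
           | CVertex v => vcoset v `<=` vcoset b
           | CEnd x => vcoset b x
           | CInfty => False
           end].

(* In the end compactification the half-trees, with their ends, and the single
   vertices form a subbase. *)
Definition compactified_subbase : set (set compactified) :=
  [set A | exists b, [\/ A = [set CVertex b], A = lower_half b
                       | A = ~` lower_half b]].

HB.instance Definition _ :=
  @isSubBaseTopological.Build compactified (set compactified)
    compactified_subbase id.

Definition with_boundary (f : Qpn -> R[i]) (phi : vertex -> R[i])
    (c : compactified) : R[i] :=
  match c with
  | CVertex v => phi v
  | CEnd x => f x
  | CInfty => 0
  end.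

Record dirichlet_solution (s : R) (f : Qpn -> R[i]) (phi : vertex -> R[i]) :
    Prop := {
  dirichlet_harmonic : forall v, laplacian s phi v = 0;
  dirichlet_end : forall x,
    (phi (vtx x k%:Z) : R[i]^o) @[k --> \oo] --> (f x : R[i]^o);
  dirichlet_infty : forall u : nat -> vertex,
    CVertex (u j) @[j --> \oo] --> CInfty ->
    (phi (u j) : R[i]^o) @[j --> \oo] --> (0 : R[i]^o) }.

Definition bounded_continuous_solution (s : R) (f : Qpn -> R[i])
    (phi : vertex -> R[i]) :=
  [/\ dirichlet_solution s f phi,
      exists M : R, forall v, modulus (phi v) <= M
    & continuous (with_boundary f phi : compactified -> R[i]^o)].

Definition energy_levels (mu : {measure set (borel_Qpn p_pr n) -> \bar R})
    (s : R) (phi : vertex -> R[i]) : \bar R :=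
  (\esum_(k in [set: int]) ((p%:R `^ (k%:~R * s))%:E *
     sqnorm2 mu (fun x => phi (vtx x k) - phi (vtx x (k - 1)%R))%R))%E.

Definition energy_edges (s : R) (phi : vertex -> R[i]) : \bar R :=
  ((2^-1)%:E * \esum_(u in [set: vertex])
     (\sum_(v \in [set v | adj v u])
        weight s u v * (modulus (phi u - phi v)) ^+ 2)%R%:E)%E.

End Tree.

(* Main.v *)
(* Put q = p^-s and let A_j f be the mean of f over cosets of p^j Z_p^n. The
   solution is phi_k = (1 - q) sum_(i >= 0) q^i A_(k-i) f, characterized by
   phi_k = (1 - q) A_k f + q phi_(k-1); together with A_k phi_(k+1) =
   (1 - q) A_k f + q phi_k this gives harmonicity, and uniqueness is a maximum
   principle. Once k exceeds the level l of f one has A_k f = f, so that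
   f - phi_k = q (f - phi_(k-1)): hence p^((k+1)s) (f - phi_k) is a function g
   independent of k >= l, which yields uniform and L^2 convergence and the normal
   derivative. Pairing the recursion with a character of conductor p^r shows that
   its integral against g is p^(rs) times the one against f, i.e. g has the Fourier
   transform of D^s f. Finally, with d_k = phi_k - phi_(k-1), the integral of
   p^(ks) d_k^2 is the increment of p^(ks) int phi_k d_k, which tends to 0 as
   k -> -oo and to (1 - q) int f g as k -> +oo. *)
Require Import Defs.
From mathcomp Require Import all_boot all_order all_algebra.
From mathcomp Require Import finmap complex.
From mathcomp Require Import all_classical all_reals all_analysis measurable_realfun.
From mathcomp Require Import ring lra zify.

Set Implicit Arguments.
Unset Strict Implicit.
Unset Printing Implicit Defensive.

Import Order.TTheory GRing.Theory Num.Theory numFieldNormedType.Exports.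

Local Open Scope classical_set_scope.
Local Open Scope ring_scope.

(** * p-adic arithmetic *)

(** Harmonicity at level k says that the mean over the children of [phi u (k + 1) - phi u k] is q
    times [phi u k - phi u (k - 1)], because the weights satisfy w_(k+1) p^n q = w_k; hence the
    ratio q of the series. Fixing a level l of f keeps the analysis finite: coarser averages are
    iterated finite means of translates, and the normal derivative is an explicit function. Its
    exponent k + 1 is forced by the Fourier side: paired with a character of conductor p^r, the
    error at level r - 1 is still the whole of f, so the powers of q combine to q^-r. Two obstacles
    shape the rest. [vladimirov] is defined by choice, so identifying it needs injectivity of the
    Fourier transform on continuous integrable functions, obtained from finite combinations of
    characters that tend to indicators of cosets. And the energy is real while the final integral is
    complex: the real and imaginary parts of f are treated separately, and the cross terms cancel by
    the symmetry of D^s, read off from an antisymmetric flux that is the same at every level. *)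

Section PadicIntArith.
Variables (p : nat) (p_pr : prime p).
Local Notation Zp := (padic_int p_pr).
Local Notation q k := ((p ^ k)%N%:Z).
Implicit Types x y z : Zp.

Let p_gt0 : (0 < p)%N. Proof. exact: prime_gt0. Qed.
Let pZ_neq0 : p%:Z != 0. Proof. by rewrite -absz_gt0. Qed.
Let p_gt1 : (1 < p)%N. Proof. exact: prime_gt1. Qed.

Lemma residue_nat (m k : nat) : residue (m%:R : Zp) k = (m%:Z %% q k)%Z.
Proof.
elim: m => [//|m IHm]; rewrite -addn1 natrD /= IHm modzDml modzDmr PoszD.
by [].
Qed.

Lemma residueMn (m : nat) x k :
  residue (m%:R * x) k = (m%:Z * residue x k %% q k)%Z.
Proof. by rewrite /= residue_nat modzMml. Qed.

Lemma padic_int_natr_eq0 (m : nat) : ((m%:R : Zp) == 0) = (m == 0)%N.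
Proof.
apply/eqP/eqP => [m0|->//].
have := residue_nat m m; rewrite m0 /= mod0z => /esym.
rewrite modz_small; last by rewrite ltz_nat ltn_expl.
by move/eqP; rewrite eqz_nat => /eqP.
Qed.

Lemma residue0 x : residue x 0 = 0.
Proof. by rewrite residueP expn0 modz1. Qed.

(** Dividing by p costs one place of precision: the k-th residue of the quotient comes from the
    residue of x at k + 1. *)
Lemma padic_int_divp x : residue x 1 = 0 -> exists z, x = p%:R * z.
Proof.
move=> x1.
have dvd i : (p %| residue x i.+1)%Z.
  by apply/dvdz_mod0P; have := residue_modX x (ltn0Sn i); rewrite expn1 x1.
have E i : ((residue x i.+1 %/ p)%Z * p = residue x i.+1)%Z by rewrite divzK.
have uP k : ((residue x k.+2 %/ p)%Z = (residue x k.+1 %/ p)%Z %[mod q k])%Z.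
  apply/eqP; rewrite eqz_mod_dvd.
  have /eqP := residueSE x k.+1; rewrite eqz_mod_dvd.
  have -> : residue x k.+2 - residue x k.+1 =
    ((residue x k.+2 %/ p)%Z - (residue x k.+1 %/ p)%Z) * p.
    by rewrite mulrBl !E.
  by rewrite expnSr PoszM dvdz_mul2r.
exists (PadicInt p_pr (residue_subproof uP)); apply: padic_int_eq => k.
rewrite residueMn /= modzMmr mulrC E; exact: residueP.
Qed.

(** Every residue of x is prime to p, so Bezout gives an inverse modulo each p^k; such inverses are
    unique, hence compatible, and define a p-adic integer. *)
Lemma padic_int_unit_residue x : residue x 1 != 0 -> x \is a GRing.unit.
Proof.
move=> x1.
have cop k : coprimez (residue x k) (q k).
  case: k => [|k]; first by rewrite expn0 /coprimez gcdz1.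
  rewrite coprimezE coprimeXr // coprime_sym prime_coprime //.
  apply: contra x1 => px.
  have := residue_modX x (ltn0Sn k); rewrite expn1 => <-.
  by apply/eqP/dvdz_mod0P; rewrite dvdzE.
pose u k := (egcdz (residue x k) (q k)).1.
have uE k : (u k * residue x k = 1 %[mod q k])%Z.
  rewrite /u; case: egcdzP => a b /= ab _.
  by move/eqP: (cop k) => e; rewrite e in ab; rewrite -ab addrC modzMDl.
have uP k : (u k.+1 = u k %[mod q k])%Z.
  have e1 : (u k.+1 * residue x k = 1 %[mod q k])%Z.
    rewrite -modzMmr -[in LHS](residueSE x k) modzMmr.
    by rewrite -modz_modXS uE modz_modXS.
  apply/eqP; rewrite eqz_mod_dvd.
  have : (q k %| (u k.+1 - u k) * residue x k)%Z.
    by rewrite mulrBl -eqz_mod_dvd e1 uE.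
  by rewrite Gauss_dvdzl // coprimez_sym.
apply/unitrPr; exists (PadicInt p_pr (residue_subproof uP)).
by apply: padic_int_eq => k /=; rewrite modzMmr mulrC uE.
Qed.

(** Induction on an index with nonzero residue: each division by p lowers this index, so the process
    stops at a unit. *)
Lemma padic_int_pX_unit x : x != 0 ->
  exists k u, u \is a GRing.unit /\ x = p%:R ^+ k * u.
Proof.
move=> /padic_int_neq0[k]; elim: k x => [|k IHk] x; first by rewrite residue0.
have [x1|x1 _] := eqVneq (residue x 1) 0; last first.
  by exists 0%N, x; split; [exact: padic_int_unit_residue|rewrite mul1r].
have [z ->] := padic_int_divp x1; rewrite residueMn expnS PoszM => h.
have /IHk[j [u [uU zE]]] : residue z k != 0.
  apply: contra h => /eqP; rewrite (residueP z k) => /dvdz_mod0P h.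
  have [->|k0] := posnP k.
    apply/eqP/dvdz_mod0P; rewrite expn0 mulr1; exact: dvdz_mulr.
  apply/eqP/dvdz_mod0P; apply: dvdz_mul => //.
by exists j.+1, u; split=> //; rewrite zE mulrA -exprS.
Qed.

Lemma padic_int_p_nunit : (p%:R : Zp) \isn't a GRing.unit.
Proof.
apply/negP => /unitrPr[y] /(congr1 (fun z : Zp => residue z 1)).
rewrite residueMn expn1 /= expn1 mulrC modzMl modz_small => //.
Qed.

Lemma padic_int_divpX k x : residue x k = 0 -> exists z, x = p%:R ^+ k * z.
Proof.
elim: k x => [|k IHk] x xk; first by exists x; rewrite mul1r.
have /padic_int_divp[z xE] : residue x 1 = 0.
  by rewrite -(residue_modX x (ltn0Sn k)) xk mod0z.
have zk : residue z k = 0.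
  rewrite residueP; apply/dvdz_mod0P; move: xk.
  by rewrite xE residueMn expnS PoszM => /dvdz_mod0P; rewrite dvdz_mul2l.
by have [w zE] := IHk _ zk; exists w; rewrite xE zE exprS -mulrA.
Qed.

(** Completeness of Z_p, in the form of convergent series: the k-th residue of the limit is that of
    the partial sum with k terms, since the later terms are divisible by p^k. *)
Lemma padic_int_limit (u : nat -> Zp) :
  exists z, forall k, exists w, z - \sum_(i < k) p%:R ^+ i * u i = p%:R ^+ k * w.
Proof.
pose S k := \sum_(i < k) p%:R ^+ i * u i.
have uP k : (residue (S k.+1) k.+1 = residue (S k) k %[mod q k])%Z.
  rewrite residueSE /S big_ord_recr /=.
  rewrite modz_mod -modzDmr.
  have -> : residue (p%:R ^+ k : Zp) k = 0 by rewrite -natrX residue_nat modzz.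
  rewrite mul0r !mod0z.
  by rewrite addr0.
exists (PadicInt p_pr (residue_subproof uP)) => k; apply: padic_int_divpX => /=.
by rewrite modzDml modzDmr -/(S k) subrr mod0z.
Qed.

End PadicIntArith.

Section PadicArith.
Variables (p : nat) (p_pr : prime p).
Local Notation Zp := (padic_int p_pr).
Local Notation Qp := (padic p_pr).
Implicit Types (x y z : Qp) (i j k : int).

Lemma padic_natr_eq0 (m : nat) : ((m%:R : Qp) == 0) = (m == 0)%N.
Proof.
by rewrite -(rmorph_nat (@padic_of_int p p_pr)) tofrac_eq0 padic_int_natr_eq0.
Qed.

Lemma padic_p_neq0 : (p%:R : Qp) != 0.
Proof. by rewrite padic_natr_eq0 -lt0n prime_gt0. Qed.

Lemma padic_pX_neq0 k : (p%:R : Qp) ^ k != 0.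
Proof. exact: expfz_neq0 padic_p_neq0. Qed.

Lemma padic_pXD i j : (p%:R : Qp) ^ (i + j) = p%:R ^ i * p%:R ^ j.
Proof. exact/expfzDr/padic_p_neq0. Qed.

Lemma pidealP k x :
  pideal k x <-> exists w : Zp, x = p%:R ^ k * padic_of_int w.
Proof. by split=> [[w _ <-]|[w ->]]; exists w. Qed.

Lemma pideal0 k : pideal k (0 : Qp).
Proof. by apply/pidealP; exists 0; rewrite rmorph0 mulr0. Qed.

Lemma pidealD k x y : pideal k x -> pideal k y -> pideal k (x + y).
Proof.
move=> /pidealP[v ->] /pidealP[w ->]; apply/pidealP.
by exists (v + w); rewrite rmorphD mulrDr.
Qed.

Lemma pidealN k x : pideal k x -> pideal k (- x).
Proof.
by move=> /pidealP[v ->]; apply/pidealP; exists (- v); rewrite rmorphN mulrN.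
Qed.

Lemma pidealB k x y : pideal k x -> pideal k y -> pideal k (x - y).
Proof. by move=> kx ky; apply/pidealD/pidealN. Qed.

Lemma pidealM j k x y : pideal j x -> pideal k y -> pideal (j + k) (x * y).
Proof.
move=> /pidealP[v ->] /pidealP[w ->]; apply/pidealP.
by exists (v * w); rewrite rmorphM padic_pXD; ring.
Qed.

Lemma pideal_pX k : pideal k (p%:R ^ k : Qp).
Proof. by apply/pidealP; exists 1; rewrite rmorph1 mulr1. Qed.

Lemma pideal_nat m : pideal 0 (m%:R : Qp).
Proof. by apply/pidealP; exists m%:R; rewrite rmorph_nat mul1r. Qed.

Lemma pideal_sub j k x : j <= k -> pideal k x -> pideal j x.
Proof.
move=> jk /pidealP[v ->]; have -> : k = j + `|k - j|%N by lia.
apply/pidealP; exists (p%:R ^+ `|k - j|%N * v).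
by rewrite padic_pXD rmorphM rmorphXn rmorph_nat mulrA.
Qed.

Lemma pidealMpX j k x : pideal (j + k) (p%:R ^ j * x) <-> pideal k x.
Proof.
split=> [/pidealP[v E]|]; last exact/pidealM/pideal_pX.
apply/pidealP; exists v; apply: (mulfI (padic_pX_neq0 j)).
by rewrite E padic_pXD mulrA.
Qed.

Lemma padic_pX_unit x : x != 0 ->
  exists k (u : Zp), u \is a GRing.unit /\ x = p%:R ^ k * padic_of_int u.
Proof.
have [a [b [b0 ->]]] : exists a b : Zp, b != 0 /\ x = padic_of_int a / padic_of_int b.
  (* The class of a ratio is the quotient of its two components, and the denominator of a ratio is
     nonzero by construction. *)
  elim/quotW: x => r; exists (frac r).1, (frac r).2.
  have b0 := denom_ratioP r; split=> //.
  have b1 : padic_of_int (frac r).2 != 0 by rewrite tofrac_eq0.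
  apply: (mulIf b1); rewrite mulfVK //.
  rewrite /padic_of_int !piE; apply/eqP; rewrite piE /= FracField.equivfE.
  by rewrite /FracField.mulf !numden_Ratio ?mulr1 ?oner_neq0 // mulrC.
rewrite mulf_eq0 invr_eq0 !tofrac_eq0 (negbTE b0) orbF => /padic_int_pX_unit.
move=> [i [u [uU ->]]].
have /padic_int_pX_unit[j [v [vU bE]]] := b0.
exists (i%:Z - j%:Z), (u / v); split; first by rewrite unitrM uU unitrV.
rewrite bE !rmorphM !rmorphXn !rmorph_nat padic_pXD rmorphV //.
by rewrite invfM -exprnP -exprnN; ring.
Qed.

Lemma pideal_ex x : exists k, pideal k x.
Proof.
have [->|/padic_pX_unit[k [u [_ ->]]]] := eqVneq x 0; first by exists 0; exact: pideal0.
by exists k; apply/pidealP; exists u.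
Qed.

(** Otherwise p would divide a unit. This makes the exponent in p^k u unique, which gives
    [padic_val] and the norm their meaning. *)
Lemma padic_unit_npideal k (u : Zp) : u \is a GRing.unit ->
  ~ pideal (k + 1) (p%:R ^ k * padic_of_int u : Qp).
Proof.
move=> uU /pidealMpX /pidealP[w]; rewrite expr1z -(rmorph_nat (@padic_of_int p p_pr)).
rewrite -rmorphM => /eqP; rewrite tofrac_eq => /eqP uE.
have := padic_int_p_nunit p_pr.
by move: uU; rewrite uE unitrM => /andP[->].
Qed.

Lemma padic_val_unit k (u : Zp) : u \is a GRing.unit ->
  padic_val (p%:R ^ k * padic_of_int u : Qp) = k.
Proof.
move=> uU; rewrite /padic_val; case: xgetP => [j _ [v vU E]|/(_ k)]; last first.
  by case; exists u.
have [jk|kj|//] := ltgtP j k.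
  case: (padic_unit_npideal (k := j) vU); rewrite -E.
  by apply: (@pideal_sub _ k); [lia|apply/pidealP; exists u].
case: (padic_unit_npideal (k := k) uU); rewrite E.
by apply: (@pideal_sub _ j); [lia|apply/pidealP; exists v].
Qed.

Lemma pideal_norm (R : realType) k x : pideal k x <-> padic_norm R x <= p%:R ^ (- k).
Proof.
have p1 : (1 : R) < p%:R by rewrite ltr1n prime_gt1.
rewrite /padic_norm; have [->|x0] := eqVneq x 0.
  by split=> [_|_]; [rewrite exprz_ge0|exact: pideal0].
have [j [u [uU ->]]] := padic_pX_unit x0; rewrite padic_val_unit //.
rewrite ler_eXz2l // lerN2; split=> [kx|kj].
  rewrite leNgt; apply/negP => jk; apply: (padic_unit_npideal (k := j) uU).
  by apply: pideal_sub kx; lia.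
by apply: (pideal_sub kj); apply/pidealP; exists u.
Qed.

Lemma pideal_pXN k : ~ pideal (k + 1) (p%:R ^ k : Qp).
Proof.
by have := padic_unit_npideal (k := k) (unitr1 Zp); rewrite rmorph1 mulr1.
Qed.

Lemma padic_residue (w : Zp) m :
  pideal m%:Z (padic_of_int w - (residue w m)%:~R).
Proof.
have [z zE] : exists z : Zp, w - (residue w m)%:~R = p%:R ^+ m * z.
  apply: padic_int_divpX => /=.
  have -> : residue ((residue w m)%:~R : Zp) m = residue w m.
    have : 0 <= residue w m by rewrite residueP modz_ge0 // eqz_nat -lt0n expn_gt0 prime_gt0.
    case E : (residue w m) => [r|//] _.
    by have := residue_mod w m; rewrite E => {2}<-; exact: residue_nat.
  by rewrite modzDmr subrr mod0z.
apply/pidealP; exists z.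
by rewrite -exprnP -(rmorph_nat (@padic_of_int p p_pr)) -rmorphXn -rmorphM -zE rmorphB rmorph_int.
Qed.

(** With [padic_digit_inj], the cosets of p^(k+1) Z_p inside p^k Z_p are labelled by the digits 0,
    ..., p - 1: the branching of the tree in one coordinate. *)
Lemma pideal_digit k x : pideal k x -> exists a : 'I_p, pideal (k + 1) (x - p%:R ^ k * a%:R).
Proof.
move=> /pidealP[w ->].
have := padic_residue w 1.
have : 0 <= residue w 1 < p by rewrite residueP expn1 modz_ge0 ?ltz_pmod ?ltz_nat ?prime_gt0 // eqz_nat -lt0n prime_gt0.
case: (residue w 1) => [a /= ap h|//].
by exists (Ordinal (ap : (a < p)%N)); rewrite -mulrBr; apply/pidealMpX.
Qed.

Lemma padic_digit_inj k (a b : 'I_p) : pideal (k + 1) (p%:R ^ k * a%:R - p%:R ^ k * b%:R : Qp) -> a = b.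
Proof.
wlog ba : a b / (b <= a)%N => [hw|].
  have [/hw//|/ltnW/hw h /pidealN] := leqP b a.
  by rewrite opprB => /h.
rewrite -mulrBr -natrB // => /pidealMpX /pidealP[w].
rewrite expr1z -(rmorph_nat (@padic_of_int p p_pr)) -(rmorph_nat (@padic_of_int p p_pr) p).
rewrite -rmorphM => /eqP; rewrite tofrac_eq => /eqP /(congr1 (fun z : Zp => residue z 1)).
rewrite residueMn residue_nat expn1 modzMr modz_small; last first.
  by rewrite ltz_nat /= (leq_ltn_trans (leq_subr _ _)).
move=> /eqP; rewrite eqz_nat subn_eq0 => ab; apply/val_inj/eqP.
by rewrite eqn_leq ab.
Qed.

Lemma padic_limit k (u : nat -> Qp) :
  (forall i : nat, pideal (k + i%:Z) (u i.+1 - u i)) ->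
  exists x, forall i : nat, pideal (k + i%:Z) (x - u i).
Proof.
move=> uP.
have /choice[w wE] (i : nat) : exists w : Zp, u i.+1 - u i = p%:R ^ (k + i%:Z) * padic_of_int w.
  exact/pidealP.
have [z zP] := padic_int_limit w.
exists (u 0%N + p%:R ^ k * padic_of_int z) => i.
have uE : u i = u 0%N + p%:R ^ k * padic_of_int (\sum_(j < i) p%:R ^+ j * w j).
  elim: i => [|i IHi]; first by rewrite big_ord0 rmorph0 mulr0 addr0.
  rewrite big_ord_recr rmorphD mulrDr addrA -IHi rmorphM rmorphXn rmorph_nat.
  by rewrite mulrA exprnP -padic_pXD -wE addrC subrK.
have [v vE] := zP i; rewrite uE opprD addrACA subrr add0r -mulrBr -rmorphB vE.
by apply/pidealMpX/pidealP; exists v; rewrite rmorphM rmorphXn rmorph_nat.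
Qed.

(** Density of Z[1/p]; it yields both the p-adic fractional part (with k = 0) and a countable supply
    of coset centres. *)
Lemma padic_approx k x : exists (m N : nat), pideal k (x - m%:R / p%:R ^+ N).
Proof.
have [j xj] := pideal_ex x.
have /pidealP[w ->] : pideal (- `|j|%N%:Z) x by apply: pideal_sub xj; lia.
(* Dividing by p^N loses N places of precision, so the residue is taken N + |k| places deep. *)
set N := `|j|%N; have := padic_residue w (N + `|k|).
have : 0 <= residue w (N + `|k|) by rewrite residueP modz_ge0 // eqz_nat -lt0n expn_gt0 prime_gt0.
case: (residue w _) => [m _ h|//]; exists m, N.
rewrite [m%:R / _]mulrC exprnN -mulrBr; apply: (@pideal_sub _ (- N%:Z + (N + `|k|)%N%:Z)).
  by lia.
exact/pidealMpX.
Qed.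

End PadicArith.

(** * The additive character *)

Section PadicChar.
Variables (p : nat) (p_pr : prime p).
Local Notation Zp := (padic_int p_pr).
Local Notation Qp := (padic p_pr).
Implicit Types (x y z : Qp) (i j k m : int) (r : rat).

Lemma padic_intr_eq0 m : ((m%:~R : Qp) == 0) = (m == 0).
Proof.
case: m => m; first by rewrite -pmulrn padic_natr_eq0.
by rewrite NegzE mulrNz oppr_eq0 -pmulrn padic_natr_eq0.
Qed.

(** In characteristic zero the value of [ratr] does not depend on the fraction chosen; additivity
    needs this because [ratr] is computed from the reduced fraction. *)
Lemma padic_ratrE i j : j != 0 -> ratr (i%:~R / j%:~R) = i%:~R / j%:~R :> Qp.
Proof.
move=> j0; set r := _ / _; have rE : r = (numq r)%:~R / (denq r)%:~R.
  by rewrite divq_num_den.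
have := rE; rewrite {1}/r => /eqP.
rewrite eqr_div ?intr_eq0 ?denq_neq0 // -!intrM eqr_int => /eqP E.
by apply/esym/eqP; rewrite eqr_div ?padic_intr_eq0 ?denq_neq0 // -!intrM E.
Qed.

Lemma padic_ratr0 : ratr 0 = 0 :> Qp.
Proof. by rewrite /ratr (_ : numq 0 = 0) // mul0r. Qed.

Lemma padic_ratrD r t : ratr (r + t) = ratr r + ratr t :> Qp.
Proof.
rewrite -[r]divq_num_den -[t]divq_num_den.
move: (numq r) (denq r) (denq_neq0 r) (numq t) (denq t) (denq_neq0 t).
move=> a b b0 c d d0; rewrite addf_div ?intr_eq0 // -!intrM -intrD.
rewrite !padic_ratrE ?mulf_neq0 // addf_div ?padic_intr_eq0 //.
by rewrite -!intrM -intrD.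
Qed.

Lemma padic_ratrN r : ratr (- r) = - ratr r :> Qp.
Proof.
rewrite -[r]divq_num_den -mulNr -intrN.
by rewrite !padic_ratrE ?denq_neq0 // intrN mulNr.
Qed.

Lemma residue_int m (k : nat) : residue (m%:~R : Zp) k = (m %% (p ^ k)%N%:Z)%Z.
Proof.
case: m => m; first exact: residue_nat.
by rewrite NegzE mulrNz /= residue_nat modzNm.
Qed.

Lemma pideal_int_dvd m (k : nat) :
  pideal k%:Z (m%:~R : Qp) -> ((p ^ k)%N%:Z %| m)%Z.
Proof.
move=> /pidealP[w]; rewrite -exprnP -(rmorph_nat (@padic_of_int p p_pr)).
rewrite -(rmorph_int (@padic_of_int p p_pr)) -rmorphXn -rmorphM => /eqP.
rewrite tofrac_eq => /eqP /(congr1 (fun z : Zp => residue z k)).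
by rewrite residue_int -natrX residueMn mulrC modzMl => /dvdz_mod0P.
Qed.

Definition prat : set rat := [set r | exists m : nat, r * p%:R ^+ m \is a Num.int].

Lemma pratP r : prat r <-> exists (a : int) (m : nat), r = a%:~R / (p ^ m)%N%:Z%:~R.
Proof.
have pX (m : nat) : (p ^ m)%N%:Z%:~R = p%:R ^+ m :> rat by rewrite -natrX.
have p0 (m : nat) : (p%:R ^+ m : rat) != 0.
  by rewrite expf_neq0 // pnatr_eq0 -lt0n prime_gt0.
split=> [[m /intrP[a aE]]|[a [m ->]]].
  by exists a, m; rewrite pX -aE mulfK.
by exists m; rewrite pX mulfVK.
Qed.

Lemma pratD r t : prat r -> prat t -> prat (r + t).
Proof.
move=> [i ri] [j tj]; exists (i + j)%N; rewrite mulrDl exprD.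
have pXint (k : nat) : (p%:R ^+ k : rat) \is a Num.int by exact/rpredX/natr_int.
by apply: rpredD; [rewrite mulrA|rewrite mulrCA]; exact: rpredM.
Qed.

Lemma pratN r : prat r -> prat (- r).
Proof. by move=> [i ri]; exists i; rewrite mulNr rpredN. Qed.

(** Z[1/p] and Z_p meet only in Z, so the fractional part is unique modulo integers and the
    character is well defined. *)
Lemma prat_int r : prat r -> pideal 0 (ratr r : Qp) -> r \is a Num.int.
Proof.
have pm0 (m : nat) : (p ^ m)%N%:Z != 0 by rewrite -absz_gt0 /= expn_gt0 prime_gt0.
move=> /pratP[a [m ->]]; rewrite padic_ratrE // => h.
have /pideal_int_dvd/dvdzP[b ->] : pideal m%:Z (a%:~R : Qp).
  rewrite -(mulfVK (padic_pX_neq0 p_pr m%:Z) a%:~R) -[m%:Z]add0r.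
  apply: pidealM; last by rewrite add0r; exact: pideal_pX.
  by move: h; rewrite -exprnP -natrX.
by rewrite intrM mulfK ?intr_eq0.
Qed.

Lemma padic_fracP x : [/\ 0 <= padic_frac x < 1, prat (padic_frac x)
  & pideal 0 (x - ratr (padic_frac x))].
Proof.
suff [r rP] : exists r : rat, [/\ 0 <= r < 1, prat r & pideal 0 (x - ratr r)].
  by rewrite /padic_frac; case: xgetP => [_ _ []|/(_ r)] //; case.
have [m [N h]] := padic_approx 0 x.
have pN0 : (p ^ N)%N%:Z != 0 by rewrite -absz_gt0 /= expn_gt0 prime_gt0.
have pNgt0 : 0 < (p ^ N)%N%:Z by lia.
(* Reducing the numerator modulo p^N puts the fraction in [0, 1[ and discards a natural number,
   which lies in Z_p. *)
exists ((m %% (p ^ N))%N%:Z%:~R / (p ^ N)%N%:Z%:~R); split.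
- rewrite divr_ge0 // ltr_pdivrMr ?ltr0z // mul1r ltr_int ltz_nat ltn_mod.
  by rewrite expn_gt0 prime_gt0.
- by apply/pratP; do 2!eexists.
rewrite padic_ratrE //.
have {}h : pideal 0 (x - m%:R / (p ^ N)%:R) by rewrite natrX.
have -> : x - (m %% p ^ N)%N%:Z%:~R / (p ^ N)%N%:Z%:~R =
    (x - m%:R / (p ^ N)%:R) + (m %/ p ^ N)%N%:R.
  rewrite {2}(divn_eq m (p ^ N)) natrD natrM mulrDl mulfK; last first.
    by rewrite padic_natr_eq0 -lt0n expn_gt0 prime_gt0.
  by rewrite -!pmulrn; ring.
by apply: pidealD => //; exact: pideal_nat.
Qed.

Variable R : realType.
Local Notation chi := (@padic_char p p_pr R).

Lemma periodicz (U V : zmodType) (f : U -> V) (T : U) :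
  periodic f T -> forall m a, f (a + T *~ m) = f a.
Proof.
move=> fT [m|m] a; first exact: periodicn.
rewrite NegzE mulrNz -(periodicn fT m.+1 (a - _)); congr f.
by rewrite -addrA -pmulrn addNr addr0.
Qed.

Definition expi2pi (r : rat) : R[i] :=
  Complex (cos (2 * pi * ratr r)) (sin (2 * pi * ratr r)).

Lemma expi2piD r t : expi2pi (r + t) = expi2pi r * expi2pi t.
Proof.
rewrite /expi2pi rmorphD mulrDr cosD sinD; simpc; congr (Complex _ _).
by rewrite addrC.
Qed.

Lemma expi2pi_int r : r \is a Num.int -> expi2pi r = 1.
Proof.
move=> /intrP[m ->]; rewrite /expi2pi ratr_int.
have -> : 2 * pi * m%:~R = 0 + pi *+ 2 *~ m :> R.
  by rewrite add0r -[RHS]mulrzr -[in RHS]mulr_natl.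
by rewrite (periodicz (@cosD2pi R)) (periodicz (@sinD2pi R)) cos0 sin0.
Qed.

(** Half-angle argument: cos(2t) = 1 - 2 sin(t)^2 with t = pi r, and sin(t) > 0 as soon as 0 < r <
    1. *)
Lemma expi2pi_eq1 r : 0 <= r < 1 -> expi2pi r = 1 -> r = 0.
Proof.
move=> /andP[r0 r1] [c _]; apply/eqP; rewrite eq_le r0 andbT leNgt; apply/negP => {}r0.
have t0 : 0 < pi * ratr r :> R by rewrite mulr_gt0 ?pi_gt0 ?ltr0q.
have t1 : pi * ratr r < pi :> R by rewrite gtr_pMr ?pi_gt0 // -(rmorph1 (@ratr R)) ltr_rat.
have s0 := sin_gt0_pi (introT andP (conj t0 t1)).
move: c; have -> : 2 * pi * ratr r = pi * ratr r + pi * ratr r :> R by ring.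
rewrite cosD -!expr2; have := cos2Dsin2 (pi * ratr r :> R).
by move: s0; set u := sin _; set v := cos _ => u0 E1 E2; have := exprn_gt0 2 u0; lra.
Qed.

(** Any representative of x in Z[1/p] modulo Z_p may replace [padic_frac x], as two of them differ
    by an integer. Taking the sum of two fractional parts gives additivity. *)
Lemma padic_charE x r : prat r -> pideal 0 (x - ratr r) -> chi x = expi2pi r.
Proof.
move=> Dr xr; have [_ Df xf] := padic_fracP x.
rewrite /padic_char -/(expi2pi _) -[padic_frac x](subrK r) expi2piD.
rewrite expi2pi_int ?mul1r //; apply: prat_int; first exact/pratD/pratN.
rewrite padic_ratrD padic_ratrN.
have -> : ratr (padic_frac x) - ratr r = (x - ratr r) - (x - ratr (padic_frac x)) :> Qp.
  by ring.
exact: pidealB.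
Qed.

Lemma padic_charD x y : chi (x + y) = chi x * chi y.
Proof.
have [_ Dx hx] := padic_fracP x; have [_ Dy hy] := padic_fracP y.
rewrite (padic_charE (pratD Dx Dy)); first exact: expi2piD.
by rewrite padic_ratrD opprD addrACA; exact: pidealD.
Qed.

Lemma prat0 : prat 0. Proof. by exists 0%N; rewrite mul0r. Qed.

Lemma padic_char_eq1 x : chi x = 1 <-> pideal 0 x.
Proof.
split=> [|x0].
  have [r01 Df hf] := padic_fracP x; rewrite /padic_char -/(expi2pi _).
  by move=> /(expi2pi_eq1 r01) r0; move: hf; rewrite r0 padic_ratr0 subr0.
rewrite (padic_charE prat0); first by rewrite expi2pi_int.
by rewrite padic_ratr0 subr0.
Qed.

Lemma padic_char_sqr x :
  (complex.Re (chi x)) ^+ 2 + (complex.Im (chi x)) ^+ 2 = 1.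
Proof. exact: cos2Dsin2. Qed.

(** A geometric sum: chi(x) is a p^m-th root of unity by the first hypothesis and differs from 1 by
    the second. *)
Lemma padic_char_sum x (m : nat) : pideal (- m%:Z) x -> ~ pideal 0 x ->
  \sum_(a < p ^ m) chi (x * a%:R) = 0.
Proof.
move=> xm x0.
have chiX (a : nat) : chi (x * a%:R) = chi x ^+ a.
  elim: a => [|a IHa]; first by rewrite mulr0; apply/padic_char_eq1/pideal0.
  by rewrite -natr1 mulrDr mulr1 padic_charD IHa exprSr.
under eq_bigr do rewrite chiX.
have : chi x ^+ (p ^ m) - 1 = 0.
  apply/eqP; rewrite subr_eq0 -chiX; apply/eqP/padic_char_eq1.
  rewrite -(addNr m%:Z); apply: pidealM => //.
  by rewrite natrX exprnP; exact: pideal_pX.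
rewrite subrX1 => /eqP; rewrite mulf_eq0 => /orP[|/eqP//].
by rewrite subr_eq0 => /eqP/padic_char_eq1.
Qed.

End PadicChar.

(** * Cosets and locally constant functions *)

Section Cosets.
Variables (p : nat) (p_pr : prime p) (n : nat).
Local Notation Qp := (padic p_pr).
Local Notation Qpn := 'rV[Qp]_n.
Local Notation digits := {ffun 'I_n -> 'I_p}.
Implicit Types (x y z h : Qpn) (j k l : int) (a b : digits).

Lemma pcoset_refl x k : pcoset x k x.
Proof. by move=> i; rewrite subrr; exact: pideal0. Qed.

Lemma pcoset_sym x y k : pcoset x k y -> pcoset y k x.
Proof. by move=> xy i; rewrite -opprB; exact/pidealN/xy. Qed.

Lemma pcoset_trans y x z k : pcoset x k y -> pcoset y k z -> pcoset x k z.
Proof. by move=> xy yz i; rewrite -(subrKA (y 0 i)); exact/pidealD. Qed.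

Lemma pcoset_le j k x : j <= k -> pcoset x k `<=` pcoset x j.
Proof. by move=> jk y xy i; exact/(pideal_sub jk)/xy. Qed.

Lemma pcoset_eq x y k : pcoset x k y -> pcoset x k = pcoset y k.
Proof.
move=> xy; apply/seteqP; split=> z; last exact: pcoset_trans.
by apply: pcoset_trans; exact: pcoset_sym.
Qed.

Lemma pcoset0E x y k : pcoset x k y <-> pcoset 0 k (y - x).
Proof. by split=> xy i; have := xy i; rewrite !mxE subr0. Qed.

Lemma pcosetD x y h k : pcoset (x + h) k (y + h) <-> pcoset x k y.
Proof.
have E : y + h - (x + h) = y - x by rewrite opprD addrACA subrr addr0.
by split=> /pcoset0E xy; apply/pcoset0E; move: xy; rewrite E.
Qed.

Lemma pcoset_ex x y : exists k, pcoset x k y.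
Proof.
have /choice[k kP] i := pideal_ex (y 0 i - x 0 i).
exists (- \sum_i `|k i|); move=> i; apply: (pideal_sub _ (kP i)).
rewrite (bigD1 i) //= opprD; set S := \sum_(_ | _) _.
have : 0 <= S by rewrite sumr_ge0.
have : - k i <= `|k i| by rewrite -normrN ler_norm.
lia.
Qed.

Lemma pcoset_sub_le x y j k : (0 < n)%N ->
  pcoset x j `<=` pcoset y k -> k <= j.
Proof.
move=> n0; rewrite leNgt => sub; apply/negP => jk.
have yx : pcoset y k x by exact/sub/pcoset_refl.
(* The test point x + p^j (1, ..., 1) belongs to the first coset but, when j < k, not to the second;
   n > 0 supplies a coordinate that shows it. *)
have : pcoset x k (x + const_mx (p%:R ^ j)).
  rewrite -(pcoset_eq yx); apply: sub => i; rewrite !mxE addrAC subrr add0r.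
  exact: pideal_pX.
move=> /(_ (Ordinal n0)); rewrite !mxE addrAC subrr add0r.
by move=> /(@pideal_sub _ _ (j + 1)) => /(_ _)/pideal_pXN; apply; lia.
Qed.

(** The digits form a finite type here, unlike the plain functions in [adj], so that sums over the
    p^n children are big operators. *)
Definition child x k a : Qpn := x + p%:R ^ k *: \row_i (a i)%:R.

Lemma child_pcoset x k a : pcoset x k (child x k a).
Proof.
move=> i; rewrite !mxE addrAC subrr add0r -[k]addr0.
by apply: pidealM; [rewrite addr0; exact: pideal_pX|exact: pideal_nat].
Qed.

Lemma child_sub x k a : pcoset (child x k a) (k + 1) `<=` pcoset x k.
Proof.
move=> y /(pcoset_le (j := k)) h; apply: (pcoset_trans (child_pcoset x k a)).
by apply: h; lia.
Qed.

Lemma child_ex x k y : pcoset x k y -> exists a, pcoset (child x k a) (k + 1) y.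
Proof.
move=> xy; have /choice[a aP] i := pideal_digit (xy i).
by exists [ffun i => a i] => i; rewrite !mxE ffunE opprD addrA.
Qed.

Lemma child_inj x k y a b : pcoset (child x k a) (k + 1) y ->
  pcoset (child x k b) (k + 1) y -> a = b.
Proof.
move=> ay /pcoset_sym yb; apply/ffunP => i; apply: (@padic_digit_inj _ p_pr k).
have := pcoset_trans ay yb i; rewrite !mxE opprD addrACA subrr add0r => /pidealN.
by rewrite opprB.
Qed.

(** Completeness of Q_p^n: every descending ray of the tree has an end in Q_p^n, where the maximum
    principle can use the boundary values. *)
Lemma pcoset_limit k (u : nat -> Qpn) :
  (forall i : nat, pcoset (u i) (k + i%:Z) (u i.+1)) ->
  exists x, forall i : nat, pcoset (u i) (k + i%:Z) x.
Proof.
move=> uP.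
have /choice[x xP] (i : 'I_n) : exists x : Qp,
    forall j : nat, pideal (k + j%:Z) (x - u j 0 i).
  by apply: padic_limit => j; exact: uP.
by exists (\row_i x i) => j i; rewrite mxE.
Qed.

(** Centres with coordinates in Z[1/p], enumerated through [pickle]. Each level thus consists of
    countably many cosets, over which an integral can be split. *)
Lemma pcoset_dense : exists c : nat -> Qpn, forall x k, exists i, pcoset (c i) k x.
Proof.
pose v (q : {ffun 'I_n -> nat * nat}) : Qpn :=
  \row_i ((q i).1%:R / p%:R ^+ (q i).2).
exists (fun m => oapp v 0 (choice.unpickle m)) => x k.
have /choice[q qP] (i : 'I_n) : exists q : nat * nat,
    pideal k (x 0 i - q.1%:R / p%:R ^+ q.2).
  by have [m [N h]] := padic_approx k (x 0 i); exists (m, N).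
exists (choice.pickle [ffun i => q i]); rewrite choice.pickleK /= => i.
by rewrite mxE ffunE.
Qed.

Lemma pideal_nbhs (x : Qp) k : nbhs x [set y | pideal k (y - x)].
Proof.
exists [set y | pideal k (y - x)]; split=> //=; last by rewrite subrr; exact: pideal0.
move=> y /= yx; exists k => h hk; rewrite addrAC; exact: pidealD.
Qed.

Lemma nbhs_pideal (x : Qp) (U : set Qp) : nbhs x U ->
  exists k, [set y | pideal k (y - x)] `<=` U.
Proof.
move=> [V [oV Vx VU]]; have [k kV] := oV _ Vx; exists k => y /= xy.
by apply: VU; have := kV _ xy; rewrite addrC subrK.
Qed.

Lemma nbhs_pcosetP x (U : set Qpn) : nbhs x U <-> exists k, pcoset x k `<=` U.
Proof.
split=> [[P Px PU]|[k kU]].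
  have /choice[k kP] i := nbhs_pideal (Px 0 i).
  exists (\sum_i `|k i|) => y xy; apply: PU => i j; rewrite (ord1 i).
  apply: kP; apply: (pideal_sub _ (xy j)).
  rewrite (bigD1 j) //=; set S := \sum_(_ | _) _.
  have : 0 <= S by rewrite sumr_ge0.
  have := ler_norm (k j); lia.
exists (fun i i' => [set y | pideal k (y - x i i')]).
  by move=> i i'; exact: pideal_nbhs.
by move=> y xy; apply: kU => i; exact: xy.
Qed.

Lemma pcoset_open x k : open (pcoset x k).
Proof.
rewrite openE => y xy; apply/nbhs_pcosetP; exists k.
by rewrite (pcoset_eq xy).
Qed.

Definition lcst (T : Type) k (u : Qpn -> T) := forall x y, pcoset x k y -> u y = u x.

Lemma lcst_le (T : Type) (u : Qpn -> T) j k : j <= k -> lcst j u -> lcst k u.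
Proof. by move=> jk ju x y xy; apply: ju; exact: pcoset_le xy. Qed.

Lemma lcst_open (T : Type) (u : Qpn -> T) k (A : set T) : lcst k u -> open (u @^-1` A).
Proof.
move=> ku; rewrite openE => x Ax; apply/nbhs_pcosetP; exists k => y xy /=.
by rewrite (ku x).
Qed.

Lemma seq_bound (D : realDomainType) (T : eqType) (s : seq T) (F : T -> D) :
  exists B, forall t, t \in s -> F t <= B.
Proof.
elim: s => [|t0 s [B BP]]; first by exists 0.
exists (Num.max (F t0) B) => t; rewrite inE le_max => /orP[/eqP ->|/BP ->].
  by rewrite lexx.
by rewrite orbT.
Qed.

(** Compactness: finitely many cosets on which f is constant cover the closed support, and l, m and
    M are extremes over this finite family. *)
Lemma schwartz_lcst (R : realType) (f : Qpn -> R[i]) : schwartz f ->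
  exists l m (M : R), [/\ lcst l f, (forall x, ~ pcoset 0 m x -> f x = 0)
    & forall x, modulus (f x) <= M].
Proof.
move=> [fl]; set K := closure _ => cK.
have fK x : ~ K x -> f x = 0.
  by move=> Kx; apply: contra_notP Kx => /eqP fx; exact: subset_closure.
have /choice[k kP] x : exists k, pcoset x k `<=` [set y | f y = f x].
  exact/nbhs_pcosetP/fl.
have [d dP] := choice (pcoset_ex 0).
move: cK; rewrite compact_cover => /(_ _ setT (fun x => pcoset x (k x))).
case=> [x _|x _|D _ DK]; first exact: pcoset_open.
  by exists x => //; exact: pcoset_refl.
have [l lP] := seq_bound (finmap.enum_fset D) k.
(* The minimum is taken because the coset around 0 must contain both the centre z and the whole
   covering coset of z. *)
have [m mP] := seq_bound (finmap.enum_fset D) (fun x => - Num.min (d x) (k x)).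
have [M MP] := seq_bound (finmap.enum_fset D) (fun x => modulus (f x)).
have fE x y : pcoset x (k x) y -> f y = f x by exact: kP.
have lf x y : pcoset x l y -> K x -> f y = f x.
  move=> xy /DK[z /= zD zx]; rewrite (fE z x zx) (fE z y) //.
  by apply: (pcoset_trans zx); apply: pcoset_le xy; exact: lP.
exists l, (- m), (Num.max 0 M); split.
(* The cover controls only points of K: if one of the two points lies in K then [lf] applies to it,
   and otherwise f vanishes at both. *)
- move=> x y xy; have [/(lf _ _ xy)//|Kx] := pselect (K x).
  have [/(lf _ _ (pcoset_sym xy))//|Ky] := pselect (K y).
  by rewrite !fK.
- move=> x x0; apply: fK => /DK[z /= zD zx]; apply: x0.
  have := mP _ zD; rewrite lerNl => h.
  apply: (@pcoset_trans z).
    apply: pcoset_le (dP z); apply: (le_trans h); by rewrite ge_min lexx.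
  by apply: pcoset_le zx; apply: (le_trans h); by rewrite ge_min lexx orbT.
- move=> x; have [/DK[z /= zD /fE ->]|/fK ->] := pselect (K x).
    by rewrite le_max MP ?orbT.
  by rewrite /modulus Normc.normc0 le_max lexx.
Qed.

Lemma dotp_pideal j k x y : pcoset 0 j x -> pcoset 0 k y -> pideal (j + k) (dotp x y).
Proof.
move=> jx ky; rewrite /dotp.
elim/big_ind: _ => [|u v|i _]; [exact: pideal0|exact: pidealD|].
by have := pidealM (jx i) (ky i); rewrite !mxE !subr0.
Qed.

Lemma dotpDl x y z : dotp (x + y) z = dotp x z + dotp y z.
Proof. by rewrite /dotp -big_split; apply: eq_bigr => i _; rewrite mxE mulrDl. Qed.

Lemma vnorm_le (R : realType) x k : vnorm R x <= p%:R ^ (- k) <-> pcoset 0 k x.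
Proof.
split=> [/bigmax_leP[_ h] i|h].
  by rewrite mxE subr0; apply/(pideal_norm R)/h.
apply/bigmax_leP; split=> [|i _]; first by rewrite exprz_ge0.
by apply/pideal_norm; have := h i; rewrite mxE subr0.
Qed.

Lemma vnorm_cases (R : realType) x :
  (vnorm R x = 0 /\ forall k, pcoset 0 k x) \/
  exists k, [/\ pcoset 0 k x, ~ pcoset 0 (k + 1) x & vnorm R x = p%:R ^ (- k)].
Proof.
have : vnorm R x = 0 \/ exists k : int, vnorm R x = p%:R ^ (- k).
  rewrite /vnorm; elim/big_ind: _ => [|u v hu hv|i _]; first by left.
    by rewrite /Num.max; case: ifP.
  rewrite /padic_norm; case: eqP => _; [by left|right].
  by eexists.
move=> [x0|[k xk]]; [left|right].
  by split=> // k; apply/(vnorm_le R); rewrite x0 exprz_ge0.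
have p1 : (1 : R) < p%:R by rewrite ltr1n prime_gt1.
exists k; split=> //; first by apply/(vnorm_le R); rewrite xk.
by move=> /(vnorm_le R); rewrite xk ler_eXz2l //; lia.
Qed.

End Cosets.

(** * The tree and its ends *)

Section ComplexLimits.
Variable R : realType.
Implicit Types z w : R[i].

Lemma modulus_norm z : `|z| = (modulus z)%:C%C.
Proof. by case: z. Qed.

Lemma modulus_ge0 z : 0 <= modulus z.
Proof. by case: z => a b; rewrite sqrtr_ge0. Qed.

Lemma modulus0 : modulus (0 : R[i]) = 0.
Proof. exact: Normc.normc0. Qed.

Lemma modulusN z : modulus (- z) = modulus z.
Proof. by apply: (@complexI R); rewrite -!modulus_norm normrN. Qed.

Lemma modulus_sqr z : modulus z ^+ 2 = complex.Re z ^+ 2 + complex.Im z ^+ 2.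
Proof. by case: z => a b; rewrite sqr_sqrtr // addr_ge0 ?sqr_ge0. Qed.

Lemma modulus_Re z : `|complex.Re z| <= modulus z.
Proof.
rewrite -(ler_pXn2r (n := 2)) ?nnegrE ?modulus_ge0 //.
by rewrite modulus_sqr real_normK ?num_real // lerDl sqr_ge0.
Qed.

Lemma modulus_Im z : `|complex.Im z| <= modulus z.
Proof.
rewrite -(ler_pXn2r (n := 2)) ?nnegrE ?modulus_ge0 //.
by rewrite modulus_sqr real_normK ?num_real // lerDr sqr_ge0.
Qed.

Lemma modulus_le z : modulus z <= `|complex.Re z| + `|complex.Im z|.
Proof.
rewrite -(ler_pXn2r (n := 2)) ?nnegrE ?modulus_ge0 ?addr_ge0 //.
rewrite modulus_sqr sqrrD !real_normK ?num_real //.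
by rewrite addrAC lerDl mulrn_wge0 // mulr_ge0.
Qed.

Lemma modulusZ (c : R) z : 0 <= c -> modulus (c%:C%C * z) = c * modulus z.
Proof.
move=> c0; apply: (@complexI R); rewrite rmorphM -!modulus_norm normrM.
by congr (_ * _); rewrite ger0_norm // lecR.
Qed.

(** In the order of R[i] a positive number is a positive real, so the complex norm and the real
    modulus define the same limits. *)
Lemma cvg_complexP (T : Type) (F : set_system T) (FF : Filter F) (h : T -> R[i]) z :
  ((h : T -> R[i]^o) @ F --> (z : R[i]^o)) <->
  forall e : R, 0 < e -> \forall t \near F, modulus (h t - z) < e.
Proof.
split=> [hz e e0|hz].
  have e0C : 0 < e%:C%C :> R[i] by rewrite ltcR.
  have /cvgrPdist_lt /(_ _ e0C) := hz.
  by apply: filterS => t; rewrite distrC modulus_norm ltcR.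
apply/cvgrPdist_lt => -[e e'] /=; rewrite ltcE /= => /andP[/eqP -> e0].
by apply: filterS (hz _ e0) => t; rewrite distrC modulus_norm ltcR.
Qed.

End ComplexLimits.

(** * Vertices, neighbours and the maximum principle *)

Section Vertices.
Variables (p : nat) (p_pr : prime p) (n : nat).
Local Notation Qp := (padic p_pr).
Local Notation Qpn := 'rV[Qp]_n.
Local Notation digits := {ffun 'I_n -> 'I_p}.
Local Notation vertex := (vertex p_pr n).
Implicit Types (x y z : Qpn) (j k l : int) (a b : digits) (u v : vertex).

Lemma vertex_eq u v : vlevel u = vlevel v -> vcoset u = vcoset v -> u = v.
Proof.
case: u v => [k A PA] [j B PB] /= kj AB; subst j B; congr Vertex.
exact: Prop_irrelevance.
Qed.

Lemma vtx_eqP x y j k : vtx x j = vtx y k <-> j = k /\ pcoset x j y.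
Proof.
split=> [E|[<- xy]]; last by apply: vertex_eq => //=; exact: pcoset_eq.
have jk : j = k by have := congr1 (@vlevel _ _ _) E.
split=> //; have /= -> := congr1 (@vcoset _ _ _) E.
exact: pcoset_refl.
Qed.

Definition vrep v : Qpn := xget 0 [set x | vcoset v = pcoset x (vlevel v)].

Lemma vrepE v : v = vtx (vrep v) (vlevel v).
Proof.
apply: vertex_eq => //=; rewrite /vrep; case: xgetP => [//|].
by case: v => k A [x xP] /= /(_ x).
Qed.

Lemma vrep_vtx x k : pcoset x k (vrep (vtx x k)).
Proof. by have /vtx_eqP[] := vrepE (vtx x k). Qed.

Lemma vtxW (P : vertex -> Prop) : (forall x k, P (vtx x k)) -> forall v, P v.
Proof. by move=> hP v; rewrite (vrepE v). Qed.

Lemma vtx_childP x k u : (exists a, u = vtx (child x k a) (k + 1)) <->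
  exists y, pcoset x k y /\ u = vtx y (k + 1).
Proof.
split=> [[a ->]|[y [/child_ex[a ya] ->]]].
  by exists (child x k a); split=> //; exact: child_pcoset.
by exists a; apply/vtx_eqP; split=> //; exact: pcoset_sym.
Qed.

Lemma adj_vtxP u x k : adj u (vtx x k) <->
  u = vtx x (k - 1) \/ exists a, u = vtx (child x k a) (k + 1).
Proof.
split=> [[y [j [/vtx_eqP[<- xy] [->|[a ->]]]]]|[->|[a ->]]].
- left; apply/vtx_eqP; split=> //; apply: pcoset_le (pcoset_sym xy); lia.
- right; apply/vtx_childP; exists (y + p%:R ^ k *: \row_i (a i)%:R); split=> //.
  have -> : \row_i (a i)%:R = \row_i ([ffun i => a i] i)%:R :> Qpn.
    by apply/rowP => i; rewrite !mxE ffunE.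
  by apply: (pcoset_trans xy); exact: child_pcoset.
- by exists x, k; split=> //; left.
- by exists x, k; split=> //; right; exists a.
Qed.

Lemma vtx_child_inj x k : injective (fun a => vtx (child x k a) (k + 1)).
Proof.
move=> a b /vtx_eqP[_ ab].
by apply: child_inj (pcoset_refl _ _) (pcoset_sym ab).
Qed.

(** Stated for any commutative monoid because it serves both the complex Laplacian and the real edge
    energy. The list of neighbours has no repetition: levels separate the parent from the children,
    digits separate the children. *)
Lemma fsbig_adj (V : Type) (idx : V) (op : Monoid.com_law idx) (F : vertex -> V) x k :
  \big[op/idx]_(u \in [set u | adj u (vtx x k)]) F u =
  op (F (vtx x (k - 1))) (\big[op/idx]_a F (vtx (child x k a) (k + 1))).
Proof.
pose c a := vtx (child x k a) (k + 1).
have -> : [set u | adj u (vtx x k)] = [set` vtx x (k - 1) :: map c (enum digits)].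
  apply/seteqP; split=> u /=.
    move/adj_vtxP => [->|[a ->]]; rewrite inE ?eqxx //; apply/orP; right.
    by apply/mapP; exists a; rewrite ?mem_enum.
  rewrite inE => /orP[/eqP ->|/mapP[a _ ->]]; apply/adj_vtxP; first by left.
  by right; exists a.
rewrite -fsbig_seq; last first.
  rewrite cons_uniq map_inj_uniq ?enum_uniq ?andbT; last exact: vtx_child_inj.
  by apply/mapP => -[a _ /vtx_eqP[]]; lia.
by rewrite big_cons big_map big_enum.
Qed.

Section MaximumPrinciple.
Variables (R : realType) (psi : vertex -> R).

(* Where psi > 0, either some vertex is at least its upper neighbor, and then
   psi is nondecreasing along some ray down to an end of Q_p^n, or psi increases
   along the whole ray up to infinity; both contradict the boundary values. *)
Lemma max_principle (w1 w2 : int -> R) : (0 < p)%N ->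
  (forall k, 0 < w1 k) -> (forall k, 0 < w2 k) ->
  (forall x k, w1 k * (psi (vtx x (k - 1)) - psi (vtx x k)) +
     w2 k * \sum_a (psi (vtx (child x k a) (k + 1)) - psi (vtx x k)) = 0) ->
  (forall x (e : R), 0 < e -> exists N : nat, forall m : nat, (N <= m)%N ->
     psi (vtx x m%:Z) < e) ->
  (forall x (e : R), 0 < e -> exists N : nat, forall m : nat, (N <= m)%N ->
     psi (vtx x (- m%:Z)) < e) ->
  forall v, psi v <= 0.
Proof.
move=> p0 w1_gt0 w2_gt0 harm lim_end lim_infty v.
rewrite leNgt; apply/negP.
elim/vtxW: v => x0 k0 c_gt0.
(* If the value is at least that of the parent and strictly above that of all children, the two
   weighted terms add up to a negative number; the child of digit 0 makes the inequality strict. *)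
have descend x k : psi (vtx x (k - 1)) <= psi (vtx x k) ->
    exists a, psi (vtx x k) <= psi (vtx (child x k a) (k + 1)).
  move=> up; apply: contrapT => /forallNP down.
  have dn a : psi (vtx (child x k a) (k + 1)) - psi (vtx x k) < 0.
    by rewrite subr_lt0 ltNge; exact/negP/down.
  pose a0 : digits := [ffun=> Ordinal p0].
  have := harm x k; apply/eqP; rewrite lt_eqF //.
  have S0 : \sum_a (psi (vtx (child x k a) (k + 1)) - psi (vtx x k)) < 0.
    rewrite (bigD1 a0) //= ltr_wnDr //.
    by rewrite sumr_le0 // => a _; exact/ltW.
  rewrite ltr_wnDl ?pmulr_rlt0 // mulr_ge0_le0 ?subr_le0 //; exact/ltW.
have [[x [k [psi_gt0 up]]]|noup] := pselect (exists x k, 0 < psi (vtx x k) /\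
    psi (vtx x (k - 1)) <= psi (vtx x k)).
  pose step (y : Qpn) j := xget [ffun=> Ordinal p0]
    [set a | psi (vtx y j) <= psi (vtx (child y j a) (j + 1))].
  pose u := fix u (i : nat) : Qpn :=
    if i is i'.+1 then child (u i') (k + i'%:Z) (step (u i') (k + i'%:Z)) else x.
  have uS i : u i.+1 = child (u i) (k + i%:Z) (step (u i) (k + i%:Z)) by [].
  have kS (i : nat) : k + i.+1%:Z = k + i%:Z + 1 by lia.
  have stepP y j : psi (vtx y (j - 1)) <= psi (vtx y j) ->
      psi (vtx y j) <= psi (vtx (child y j (step y j)) (j + 1)).
    by move=> /descend h; exact: (xgetPex _ h).
  have uc (i : nat) : pcoset (u i) (k + i%:Z) (u i.+1).
    by rewrite uS; exact: child_pcoset.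
  have par (i : nat) : vtx (u i.+1) (k + i.+1%:Z - 1) = vtx (u i) (k + i%:Z).
    apply/vtx_eqP; rewrite kS addrK; split=> //; exact: pcoset_sym.
  have uup (i : nat) : psi (vtx (u i) (k + i%:Z - 1)) <= psi (vtx (u i) (k + i%:Z)).
    elim: i => [|i IHi]; first by rewrite addr0.
    by have := stepP _ _ IHi; rewrite -uS -kS par.
  have ule (i : nat) : psi (vtx x k) <= psi (vtx (u i) (k + i%:Z)).
    elim: i => [|i IHi]; first by rewrite addr0.
    by apply: (le_trans IHi); rewrite -par; exact: uup.
  have [y yP] := pcoset_limit uc.
  have [N NP] := lim_end y _ psi_gt0.
  (* The level must be at least k to lie on the ray and at least N for the boundary value at y to
     apply. *)
  pose m := `|Num.max k N%:Z|%N.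
  have mk : m%:Z = k + `|m%:Z - k|%N%:Z by lia.
  have := NP m; rewrite mk; set i := `|_|%N.
  have -> : vtx y (k + i%:Z) = vtx (u i) (k + i%:Z).
    by apply/vtx_eqP; split=> //; exact/pcoset_sym/yP.
  by rewrite ltNge ule => /(_ _)/negP; apply=> //; lia.
have up x k : 0 < psi (vtx x k) -> psi (vtx x k) < psi (vtx x (k - 1)).
  by move=> h; rewrite ltNge; apply/negP => h'; apply: noup; exists x, k.
have ule (i : nat) : psi (vtx x0 k0) <= psi (vtx x0 (k0 - i%:Z)).
  elim: i => [|i IHi]; first by rewrite subr0.
  apply: (le_trans IHi); have -> : k0 - i.+1%:Z = k0 - i%:Z - 1 by lia.
  by apply/ltW/up/(lt_le_trans c_gt0 IHi).
have [N NP] := lim_infty x0 _ c_gt0.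
pose m := `|Num.max (- k0) N%:Z|%N.
have mk : - m%:Z = k0 - `|(k0 + m%:Z)%R|%N%:Z by lia.
have := NP m; rewrite mk ltNge ule => /(_ _)/negP; apply=> //; lia.
Qed.

End MaximumPrinciple.
End Vertices.

(** * Topology of the end compactification *)

Section Compactification.
Variables (R : realType) (p : nat) (p_pr : prime p) (n : nat).
Local Notation Qp := (padic p_pr).
Local Notation Qpn := 'rV[Qp]_n.
Local Notation vertex := (vertex p_pr n).
Local Notation compactified := (compactified p_pr n).
Implicit Types (x y z : Qpn) (k : int).

Lemma compactified_subbase_nbhs (c : compactified) (A : set compactified) :
  compactified_subbase A -> A c -> nbhs c A.
Proof.
move=> subA Ac; exists A; split=> //.
exists [set A]; last by rewrite bigcup_set1.
move=> _ ->; exists [fset A]%fset.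
  by move=> _ /fset1P ->; rewrite inE.
by rewrite set_fset1 bigcap_set1.
Qed.

(** Basic open sets are finite intersections of subbasic ones, so a filter may be tested on the
    subbase alone. *)
Lemma cvg_compactified (T : Type) (F : set_system T) (FF : Filter F)
    (h : T -> compactified) c :
  (forall A, compactified_subbase A -> A c -> \forall t \near F, A (h t)) ->
  h @ F --> c.
Proof.
move=> hA U [B [[D DP <-] [A DA Ac] BU]].
have [E EP AE] : exists2 E : {fset set compactified},
    {subset E <= @compactified_subbase p p_pr n} & \bigcap_(e in [set` E]) e = A by exact: (DP _ DA).
apply: (@filterS _ F _ (\bigcap_(e in [set` E]) [set t | e (h t)])).
  move=> t Et; have At : A (h t) by rewrite -AE => e /Et.
  by apply: BU; exists A.
apply: filter_bigI => e eE; apply: hA.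
  by have := EP _ eE; rewrite inE.
by move: Ac; rewrite -AE; exact.
Qed.

(** Among the subbasic sets only complements of half-trees contain the end at infinity, and the
    growing balls eventually fit in no given ball. *)
Lemma cvg_CInfty x : (0 < n)%N ->
  CVertex (vtx x (- j%:Z)) @[j --> \oo] --> @CInfty p p_pr n.
Proof.
move=> n0; apply: cvg_compactified => A [b [] -> //=] _.
elim/vtxW: b => y k; exists `|k - 1|%N => // j /= kj /(pcoset_sub_le n0); lia.
Qed.

(** Vertices are isolated; the half-tree at (x, k) is a neighbourhood of x with levels j >= k only;
    the complement of the half-tree at (0, k) is a neighbourhood of infinity. The two hypotheses are
    the estimates on these sets. *)
Lemma with_boundary_continuous (f : Qpn -> R[i]) (phi : vertex -> R[i]) :
  (0 < n)%N ->
  (forall x (e : R), 0 < e -> exists k, forall y, pcoset x k y ->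
     modulus (f y - f x) < e /\
     forall j, k <= j -> modulus (phi (vtx y j) - f x) < e) ->
  (forall e : R, 0 < e -> exists k,
     (forall y, ~ pcoset 0 k y -> modulus (f y) < e) /\
     (forall y j, ~ (pcoset y j `<=` pcoset 0 k) -> modulus (phi (vtx y j)) < e)) ->
  continuous (with_boundary f phi : compactified -> R[i]^o).
Proof.
move=> n0 fphi0 fphi_infty c.
apply/(@cvg_complexP R compactified (nbhs c) (nbhs_filter c)) => e e0; case: c => [v|x|].
- apply: filterS (compactified_subbase_nbhs (A := [set CVertex v]) _ _) => //.
    by move=> _ ->; rewrite subrr modulus0.
  by exists v; constructor 1.
- have [k kP] := fphi0 x e e0.
  apply: filterS (compactified_subbase_nbhs (A := lower_half (vtx x k)) _ _).
  + move=> [v| y|//] /=; last by move=> /kP[].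
    elim/vtxW: v => y j /= yx; apply: (kP y _).2; first exact/yx/pcoset_refl.
    exact: pcoset_sub_le yx.
  + by exists (vtx x k); constructor 2.
  + exact: pcoset_refl.
- have [k [kf kphi]] := fphi_infty e e0.
  apply: filterS (compactified_subbase_nbhs (A := ~` lower_half (vtx 0 k)) _ _).
  + move=> [v|y|]; rewrite subr0; [|exact: kf|by rewrite modulus0].
    by elim/vtxW: v => y j; exact: kphi.
  + by exists (vtx 0 k); constructor 3.
  + by [].
Qed.

End Compactification.

(** * Haar integrals *)

Section Haar.
Variables (R : realType) (p : nat) (p_pr : prime p) (n : nat).
Local Notation Qp := (padic p_pr).
Local Notation Qpn := 'rV[Qp]_n.
Local Notation Bn := (borel_Qpn p_pr n).
Local Notation digits := {ffun 'I_n -> 'I_p}.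
Variable mu : {measure set Bn -> \bar R}.
Hypothesis mu_haar : normalized_haar mu.
Implicit Types (x y z h : Qpn) (j k l : int) (a : digits) (u v w t : Qpn -> R).

Lemma open_measurable_Qpn (A : set Qpn) : open A -> measurable (A : set Bn).
Proof. exact: sub_sigma_algebra. Qed.

Lemma measurable_pcoset x k : measurable (pcoset x k : set Bn).
Proof. apply: open_measurable_Qpn; exact: pcoset_open. Qed.

Lemma lcst_measurable d (T : sigmaRingType d) (u : Qpn -> T) k (D : set Bn) :
  lcst k u -> measurable_fun D (u : Bn -> T).
Proof.
move=> ku mD Y mY; apply: measurableI => //.
by apply: open_measurable_Qpn; exact: (lcst_open ku).
Qed.

Lemma measurable_translation h :
  measurable_fun [set: Bn] ((fun x => x + h) : Bn -> Bn).
Proof.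
apply: (@measurability _ _ Bn Bn setT _ (open : set (set Qpn))) => // _ [U oU <-]; rewrite setTI.
apply: open_measurable_Qpn; rewrite openE => x Ux; apply/nbhs_pcosetP.
have /nbhs_pcosetP[k kU] : nbhs (x + h) U by exact: open_nbhs_nbhs.
by exists k => y xy; apply/kU/pcosetD.
Qed.

Lemma haar_translation h (A : set Bn) : measurable A ->
  mu ((fun x : Qpn => x + h) @^-1` A) = mu A.
Proof.
move=> mA; rewrite -[RHS](mu_haar.1 (- h)) //; congr (mu _).
apply/seteqP; split=> [x /= Ax|_ [y /= Ay <-]] /=.
  by exists (x + h) => //; rewrite addrC addrK.
by rewrite addrC addrA subrr add0r.
Qed.

Lemma ge0_integral_translation h (g : Qpn -> \bar R) :
  measurable_fun [set: Bn] (g : Bn -> \bar R) -> (forall x, 0 <= g x)%E ->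
  (\int[mu]_x g ((x : Qpn) + h)%R = \int[mu]_x g x)%E.
Proof.
move=> mg g0.
have := @ge0_integral_pushforward _ _ Bn Bn R _ (measurable_translation h) mu
  setT g measurableT mg (fun x _ => g0 x).
rewrite preimage_setT => <-.
by apply: eq_measure_integral => [|? A mA _]; [exact: measurable_translation|exact: haar_translation].
Qed.

(** Complex functions are integrated through their real and imaginary parts, so the calculus of
    integrals is set up for real functions. *)
Definition L1 u := mu.-integrable [set: Bn] (EFin \o (u : Bn -> R)).
Definition Int u : R := \int[mu]_x u x.

Lemma L1_measurable u : L1 u -> measurable_fun [set: Bn] (u : Bn -> R).
Proof. by move=> /measurable_int/measurable_EFinP. Qed.

Lemma L1D u v : L1 u -> L1 v -> L1 (fun x => u x + v x).
Proof. exact: (@integrableD _ _ _ mu _ measurableT). Qed.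

Lemma L1B u v : L1 u -> L1 v -> L1 (fun x => u x - v x).
Proof. exact: (@integrableB _ _ _ mu _ measurableT). Qed.

Lemma L1Z c u : L1 u -> L1 (fun x => c * u x).
Proof. exact: (@integrableZl _ _ _ mu _ measurableT c). Qed.

Lemma L1_0 : L1 (fun=> 0).
Proof. exact: integrable0. Qed.

Lemma L1_sum (I : Type) (r : seq I) (F : I -> Qpn -> R) :
  (forall i, L1 (F i)) -> L1 (fun x => \sum_(i <- r) F i x).
Proof.
move=> FL; elim: r => [|i r IHr].
  by under [X in L1 X]eq_fun do rewrite big_nil; exact: L1_0.
by under [X in L1 X]eq_fun do rewrite big_cons; exact: L1D.
Qed.

Lemma L1_abs u : L1 u -> L1 (fun x => `|u x|).
Proof. exact: integrable_norm. Qed.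

Definition bdd u := exists M : R, forall x, `|u x| <= M.

Lemma bddP u : bdd u <-> exists M, 0 < M /\ forall x, `|u x| <= M.
Proof.
split=> [[M uM]|[M [_ uM]]]; last by exists M.
exists (`|M| + 1); split=> [|x]; first by rewrite ltr_pwDr.
by rewrite (le_trans (uM x)) // (le_trans (ler_norm M)) // lerDl.
Qed.

Lemma L1M t u : measurable_fun [set: Bn] (t : Bn -> R) -> bdd t -> L1 u ->
  L1 (fun x => t x * u x).
Proof.
move=> mt /bddP[M [M0 tM]] uL.
apply: (@le_integrable _ _ _ mu _ measurableT _ (EFin \o (fun x => M * u x))).
- by apply/measurable_EFinP/measurable_funM => //; exact: L1_measurable.
- move=> x _ /=; rewrite lee_fin !normrM (gtr0_norm M0).
  by rewrite ler_wpM2r.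
- exact: L1Z.
Qed.

Lemma L1_eq u v : u =1 v -> L1 u -> L1 v.
Proof. by move=> /funext ->. Qed.

Lemma Int_eq u v : u =1 v -> Int u = Int v.
Proof. by move=> /funext ->. Qed.

Lemma IntD u v : L1 u -> L1 v -> Int (fun x => u x + v x) = Int u + Int v.
Proof. exact: (@RintegralD _ _ _ mu _ _ _ measurableT). Qed.

Lemma IntB u v : L1 u -> L1 v -> Int (fun x => u x - v x) = Int u - Int v.
Proof. exact: (@RintegralB _ _ _ mu _ _ _ measurableT). Qed.

Lemma IntZ c u : L1 u -> Int (fun x => c * u x) = c * Int u.
Proof. exact: (@RintegralZl _ _ _ mu _ _ c measurableT). Qed.

Lemma Int_sum (I : Type) (r : seq I) (F : I -> Qpn -> R) :
  (forall i, L1 (F i)) ->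
  Int (fun x => \sum_(i <- r) F i x) = \sum_(i <- r) Int (F i).
Proof.
move=> FL; elim: r => [|i r IHr].
  rewrite big_nil (@Int_eq _ (fun=> 0 * 0)); last by move=> x; rewrite big_nil mul0r.
  by rewrite IntZ ?mul0r //; exact: L1_0.
rewrite big_cons -IHr -IntD //; last exact: L1_sum.
by apply: Int_eq => x; rewrite big_cons.
Qed.

Lemma Int_ge0 u : (forall x, 0 <= u x) -> 0 <= Int u.
Proof. by move=> u0; apply: Rintegral_ge0 => x _; exact: u0. Qed.

Lemma Int_le u v : L1 u -> L1 v -> (forall x, u x <= v x) -> Int u <= Int v.
Proof.
by move=> uL vL uv; apply: (@le_Rintegral _ _ _ mu _ _ _ measurableT).
Qed.

Lemma Int_abs u : L1 u -> `|Int u| <= Int (fun x => `|u x|).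
Proof. exact: (@le_normr_Rintegral _ _ _ mu _ _ measurableT). Qed.

Lemma IntE u : L1 u -> (\int[mu]_x (u x)%:E = (Int u)%:E)%E.
Proof. by move=> uL; rewrite /Int /Rintegral fineK //; exact: integrable_fin_num. Qed.

Lemma L1_translation h u : L1 u -> L1 (fun x => u (x + h)).
Proof.
move=> /integrableP[mu_ ufin]; apply/integrableP; split.
  exact: (measurableT_comp mu_ (measurable_translation h)).
rewrite (ge0_integral_translation h (g := fun x => `|(u x)%:E|%E)) //.
exact: measurableT_comp.
Qed.

Lemma Int_translation h u : L1 u -> Int (fun x => u (x + h)) = Int u.
Proof.
move=> uL; rewrite /Int /Rintegral; congr fine.
have muE := measurable_int _ uL.
have := @integral_pushforward _ _ Bn Bn R _ (measurable_translation h) mu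
  setT (EFin \o (u : Bn -> R)) muE.
rewrite preimage_setT => /(_ (L1_translation h uL) measurableT) /= <-.
by apply: eq_measure_integral => [|? A mA _]; [exact: measurable_translation|exact: haar_translation].
Qed.

End Haar.

(** * Volumes of cosets and averages over them *)

Section Averages.
Variables (R : realType) (p : nat) (p_pr : prime p) (n : nat).
Local Notation Qp := (padic p_pr).
Local Notation Qpn := 'rV[Qp]_n.
Local Notation Bn := (borel_Qpn p_pr n).
Local Notation digits := {ffun 'I_n -> 'I_p}.
Variable mu : {measure set Bn -> \bar R}.
Hypothesis mu_haar : normalized_haar mu.
Local Notation L1 := (L1 mu).
Local Notation Int := (Int mu).
Implicit Types (x y z h : Qpn) (j k l : int) (a : digits) (u v w t : Qpn -> R).

Local Notation N := ((p ^ n)%N%:R : R).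

Let N_gt0 : 0 < N.
Proof. by rewrite ltr0n expn_gt0 prime_gt0. Qed.

Let N_neq0 : N != 0. Proof. exact: lt0r_neq0. Qed.

Definition pvol k : R := N ^ (- k).

Lemma pvol_gt0 k : 0 < pvol k. Proof. exact: exprz_gt0. Qed.

Lemma pvol_neq0 k : pvol k != 0. Proof. exact/lt0r_neq0/pvol_gt0. Qed.

Lemma pvolS k : pvol k = N * pvol (k + 1).
Proof. by rewrite /pvol opprD expfzDr // mulrCA exprN1 divff // mulr1. Qed.

Lemma card_digits : #|{: digits}| = (p ^ n)%N.
Proof. by rewrite card_ffun !card_ord. Qed.

Definition ind x k y : R := \1_(pcoset x k) y.

Lemma indT x k y : pcoset x k y -> ind x k y = 1.
Proof. by move=> xy; rewrite /ind indicE mem_set. Qed.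

Lemma indF x k y : ~ pcoset x k y -> ind x k y = 0.
Proof. by move=> xy; rewrite /ind indicE memNset. Qed.

Lemma ind_ge0 x k y : 0 <= ind x k y. Proof. by rewrite /ind indicE. Qed.

Lemma ind_child x k y : ind x k y = \sum_a ind (child x k a) (k + 1) y.
Proof.
have [xy|xy] := pselect (pcoset x k y); last first.
  rewrite indF // big1 // => a _; apply: indF => /child_sub; exact: xy.
have [a ay] := child_ex xy.
rewrite (indT xy) (bigD1 a isT) (indT ay) big1; first by rewrite /= addr0.
by move=> b ba; apply: indF => /child_inj /(_ ay) E; rewrite E eqxx in ba.
Qed.

Lemma ind_lcst x k : lcst k (ind x k).
Proof.
move=> y z yz; have [xy|xy] := pselect (pcoset x k y).
  by rewrite !indT //; exact: pcoset_trans yz.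
by rewrite !indF // => xz; apply: xy; exact: pcoset_trans (pcoset_sym yz).
Qed.

Lemma ind_measurable x k : measurable_fun [set: Bn] (ind x k : Bn -> R).
Proof. by apply: lcst_measurable; exact: ind_lcst. Qed.

Lemma ind_bdd x k : bdd (ind x k).
Proof.
by exists 1 => y; rewrite ger0_norm ?ind_ge0 // /ind indicE; case: (_ \in _).
Qed.

Lemma haar_pcoset0 x k : mu (pcoset x k) = mu (pcoset 0 k).
Proof.
rewrite -(haar_translation mu_haar x (measurable_pcoset x k)); congr (mu _).
apply/seteqP; split=> y /=; rewrite -{1}[x]add0r => /pcosetD //.
Qed.

Lemma haar_child k : mu (pcoset 0 k) = (N%:E * mu (pcoset 0 (k + 1)))%E.
Proof.
have E x j : (\int[mu]_y (ind x j y)%:E = mu (pcoset x j))%E.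
  by rewrite integral_indic ?setIT //; exact: measurable_pcoset.
rewrite -E.
under eq_integral do rewrite ind_child -sumEFin.
rewrite ge0_integral_sum //.
- under eq_bigr do rewrite E haar_pcoset0.
  by rewrite sumr_const card_digits mule_natl.
- move=> a; apply/measurable_EFinP; exact: ind_measurable.
- by move=> a y _; rewrite lee_fin ind_ge0.
Qed.

(** Each coset splits into p^n translates of the next level, starting from volume 1 at level 0.
    Towards finer levels an infinite volume is excluded because p^n times it would be infinite;
    towards coarser ones the volume is computed directly. *)
Lemma haar_pcoset x k : mu (pcoset x k) = (pvol k)%:E.
Proof.
rewrite haar_pcoset0.
have pos (i : nat) : mu (pcoset 0 i%:Z) = (pvol i%:Z)%:E.
  elim: i => [|i IHi]; first by rewrite mu_haar.2 /pvol oppr0 expr0z.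
  have -> : i.+1%:Z = i%:Z + 1 by lia.
  have := haar_child i%:Z; rewrite IHi pvolS.
  case: (mu (pcoset 0 (i%:Z + 1))) => [r| |].
  - by rewrite -EFinM => -[/(mulfI N_neq0) ->].
  - by rewrite gt0_muley ?lte_fin.
  - by rewrite gt0_muleNy ?lte_fin.
case: k => [i|i]; first exact: pos.
rewrite NegzE; elim: {i}i.+1 => [|i IHi]; first by rewrite oppr0; exact: (pos 0%N).
have E : - i.+1%:Z + 1 = - i%:Z by lia.
by rewrite haar_child E IHi -EFinM [in RHS]pvolS E.
Qed.

Lemma ind_L1 x k : L1 (ind x k).
Proof.
apply/integrableP; split.
  apply/measurable_EFinP; exact: ind_measurable.
under eq_integral do rewrite gee0_abs ?lee_fin ?ind_ge0 //.
rewrite integral_indic ?setIT ?haar_pcoset ?ltry //.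
exact: measurable_pcoset.
Qed.

Lemma Int_ind x k : Int (ind x k) = pvol k.
Proof.
rewrite /Int /Rintegral integral_indic ?setIT ?haar_pcoset //.
exact: measurable_pcoset.
Qed.

Lemma L1_ind u x k : L1 u -> L1 (fun y => ind x k y * u y).
Proof.
by apply: L1M; [exact: ind_measurable|exact: ind_bdd].
Qed.

Definition avg k u x := (pvol k)^-1 * Int (fun y => ind x k y * u y).

Lemma avg_child k u x : L1 u ->
  avg k u x = N^-1 * \sum_a avg (k + 1) u (child x k a).
Proof.
move=> uL; rewrite /avg -mulr_sumr -Int_sum; last by move=> a; exact: L1_ind.
rewrite pvolS invfM -mulrA; congr (_ * (_ * _)); apply: Int_eq => y.
by rewrite ind_child mulr_suml.
Qed.

Lemma avg_id k u : lcst k u -> avg k u = u.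
Proof.
move=> ku; apply/funext => x; rewrite /avg.
rewrite (@Int_eq _ _ _ _ _ _ (fun y => u x * ind x k y)); last first.
  move=> y; have [xy|xy] := pselect (pcoset x k y).
    by rewrite (ku x) // mulrC.
  by rewrite indF // mul0r mulr0.
by rewrite IntZ; [rewrite Int_ind mulrC mulfK ?pvol_neq0|exact: ind_L1].
Qed.

Lemma avg_lcst k u : lcst k (avg k u).
Proof. by move=> x y xy; rewrite /avg /ind (pcoset_eq xy). Qed.

Lemma avg_bound k u (M : R) x : L1 u -> (forall y, `|u y| <= M) -> `|avg k u x| <= M.
Proof.
move=> uL uM; rewrite /avg normrM normfV (gtr0_norm (pvol_gt0 k)).
rewrite ler_pdivrMl ?pvol_gt0 //.
apply: (le_trans (Int_abs (L1_ind _ _ uL))).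
rewrite mulrC -(Int_ind x k) -IntZ; last exact: ind_L1.
apply: Int_le; [exact/L1_abs/L1_ind|exact/L1Z/ind_L1|move=> y].
by rewrite normrM (ger0_norm (ind_ge0 _ _ _)) mulrC ler_wpM2r ?ind_ge0.
Qed.

Lemma avg_le_L1 k u x : L1 u -> `|avg k u x| <= (pvol k)^-1 * Int (fun y => `|u y|).
Proof.
move=> uL; rewrite /avg normrM normfV (gtr0_norm (pvol_gt0 k)).
rewrite ler_pM2l ?invr_gt0 ?pvol_gt0 //.
apply: (le_trans (Int_abs (L1_ind _ _ uL))).
apply: Int_le; [exact/L1_abs/L1_ind|exact: L1_abs|move=> y].
rewrite normrM (ger0_norm (ind_ge0 _ _ _)) ler_piMl //.
by rewrite /ind indicE; case: (_ \in _).
Qed.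

Lemma avg_supp k u x : (forall y, pcoset x k y -> u y = 0) -> avg k u x = 0.
Proof.
move=> u0; rewrite /avg (@Int_eq _ _ _ _ _ _ (fun y => 0 * 0)).
  by rewrite IntZ ?mul0r ?mulr0 //; exact: L1_0.
move=> y; have [xy|xy] := pselect (pcoset x k y); first by rewrite u0 // mulr0 mul0r.
by rewrite indF // !mul0r.
Qed.

(** For v of level k + 1 this is the mean over x + p^k Z_p^n. Written as a finite mean of
    translates, it inherits integrability and integrals from translation invariance. *)
Definition cmean k v x := N^-1 * \sum_a v (child x k a).

Lemma L1_cmean k v : L1 v -> L1 (cmean k v).
Proof.
by move=> vL; apply/L1Z/L1_sum => a; exact: (L1_translation mu_haar _ vL).
Qed.

(** A function constant on cosets of level k does not see the shifts by p^k a, so each translate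
    contributes the same integral. *)
Lemma Int_cmean k t v : lcst k t -> bdd t -> L1 v ->
  Int (fun x => t x * cmean k v x) = Int (fun x => t x * v x).
Proof.
move=> kt tb vL.
have tL w : L1 w -> L1 (fun x => t x * w x).
  by apply: L1M => //; exact: lcst_measurable kt.
pose F a x := t x * v (child x k a).
have FE a : F a = fun x => t (child x k a) * v (child x k a).
  by apply/funext => x; rewrite /F (kt x _ (child_pcoset _ _ _)).
have FL a : L1 (F a).
  rewrite FE; apply: (L1_translation mu_haar _ (tL _ vL)).
rewrite (@Int_eq _ _ _ _ _ _ (fun x => N^-1 * \sum_a F a x)); last first.
  by move=> x; rewrite /cmean mulrCA mulr_sumr.
rewrite IntZ; last exact: L1_sum.
rewrite Int_sum //.
have FI a : Int (F a) = Int (fun x => t x * v x).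
  rewrite FE; exact: (Int_translation mu_haar _ (tL _ vL)).
under eq_bigr do rewrite FI.
rewrite sumr_const card_digits.
by rewrite -(mulr_natl (Int _)) mulrA mulVf // mul1r.
Qed.

Section LocallyConstant.
Variables (l : int) (u : Qpn -> R).
Hypotheses (lu : lcst l u) (uL : L1 u).

(** Averages coarser than l are reached from u by finitely many one-step means, so integrability and
    the pairing pass from level to level with no exchange of integrals. *)
Lemma avg_L1_pair k : L1 (avg k u) /\ (forall t, lcst k t -> bdd t ->
  Int (fun x => t x * avg k u x) = Int (fun x => t x * u x)).
Proof.
have [lk|kl] := leP l k; first by rewrite avg_id //; exact: lcst_le lu.
have -> : k = l - `|l - k|%N%:Z by lia.
elim: `|l - k|%N => [|i [IH1 IH2]]; first by rewrite subr0 avg_id.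
have E : l - i.+1%:Z + 1 = l - i%:Z by lia.
have -> : avg (l - i.+1%:Z) u = cmean (l - i.+1%:Z) (avg (l - i%:Z) u).
  by apply/funext => x; rewrite avg_child // /cmean E.
split=> [|t kt tb]; first exact: L1_cmean.
by rewrite Int_cmean // IH2 //; apply: lcst_le kt; lia.
Qed.

Lemma avg_L1 k : L1 (avg k u). Proof. exact: (avg_L1_pair k).1. Qed.

Lemma Int_avg k t : lcst k t -> bdd t ->
  Int (fun x => t x * avg k u x) = Int (fun x => t x * u x).
Proof. exact: (avg_L1_pair k).2. Qed.

(** Duality: the sign of the average is itself constant on cosets of level k, so pairing with it
    sees u instead of the average. *)
Lemma Int_abs_avg k : Int (fun x => `|avg k u x|) <= Int (fun x => `|u x|).
Proof.
pose t x := Num.sg (avg k u x).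
have kt : lcst k t by move=> x y xy; rewrite /t (avg_lcst _ xy).
have tb : forall x, `|t x| <= 1.
  by move=> x; rewrite normr_sg; case: (_ == _).
rewrite (@Int_eq _ _ _ _ _ _ (fun x => t x * avg k u x)); last first.
  by move=> x; rewrite /t normrEsg.
rewrite Int_avg //; last by exists 1.
apply: Int_le; [|exact: L1_abs|].
  by apply: L1M uL; [exact: lcst_measurable kt|exists 1].
move=> x; apply: (le_trans (ler_norm _)); rewrite normrM; exact: ler_piMl.
Qed.

End LocallyConstant.
End Averages.

(** * The solution level by level *)

Section GeometricMean.
Variables (R : realType) (q : R).
Hypotheses (q_gt0 : 0 < q) (q_lt1 : q < 1).
Implicit Types a : nat -> R.

Let q_ge0 : 0 <= q. Proof. exact: ltW. Qed.

Definition geo_partial a (N : nat) := (1 - q) * \sum_(i < N) q ^+ i * a i.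

Definition geo a := limn (geo_partial a).

(** The weights (1 - q) q^i for i < N add up to 1 - q^N, which is at most 1. *)
Lemma geo_partial_bound a (B : R) N : 0 <= B -> (forall i, `|a i| <= B) ->
  `|geo_partial a N| <= B.
Proof.
move=> B0 aB; rewrite /geo_partial normrM gtr0_norm ?subr_gt0 //.
apply: (@le_trans _ _ ((1 - q) * \sum_(i < N) q ^+ i * B)).
  rewrite ler_pM2l ?subr_gt0 //; apply: (le_trans (ler_norm_sum _ _ _)).
  apply: ler_sum => i _; rewrite normrM ger0_norm ?exprn_ge0 //.
  by rewrite ler_wpM2l // exprn_ge0.
rewrite -mulr_suml mulrA -[1 - q]opprB mulNr -subrX1 opprB.
by rewrite ler_piMl // gerBl exprn_ge0.
Qed.

Lemma geo_cvg a (B : R) : (forall i, `|a i| <= B) -> geo_partial a @ \oo --> geo a.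
Proof.
move=> aB; suff : cvgn (series (fun i => q ^+ i * a i)).
  move=> h; rewrite /geo; set u := geo_partial a.
  have uE : u = (fun=> 1 - q) \* series (fun i => q ^+ i * a i).
    by apply/funext => N /=; rewrite /u /geo_partial /series /= big_mkord.
  apply/cvg_ex; eexists; rewrite uE.
  by apply: cvgM; [exact: cvg_cst|exact: h].
apply: normed_cvg.
apply: (@series_le_cvg _ _ (geometric `|B| q)) => [i|i|i|].
- exact: normr_ge0.
- by rewrite /geometric /= mulr_ge0 // exprn_ge0.
- rewrite /geometric /= normrM mulrC (ger0_norm (exprn_ge0 i q_ge0)).
  by rewrite ler_wpM2r ?exprn_ge0 // (le_trans (aB i)) // ler_norm.
- by apply: is_cvg_geometric_series; rewrite gtr0_norm.
Qed.

Lemma geo_bound a (B : R) : 0 <= B -> (forall i, `|a i| <= B) -> `|geo a| <= B.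
Proof.
move=> B0 aB; have h : `|geo_partial a N| @[N --> \oo] --> `|geo a|.
  by apply: cvg_norm; exact: geo_cvg aB.
rewrite -(cvg_lim (@Rhausdorff R) h); apply: limr_le; first by apply/cvg_ex; eexists; exact: h.
by near=> N; exact: geo_partial_bound.
Unshelve. all: by end_near. Qed.

Lemma geo_rec a (B : R) : (forall i, `|a i| <= B) ->
  geo a = (1 - q) * a 0%N + q * geo (fun i => a i.+1).
Proof.
move=> aB; have aB' i : `|a i.+1| <= B by exact: aB.
apply: (cvg_lim (@Rhausdorff R)).
rewrite -cvg_shiftS.
have -> : [sequence geo_partial a N.+1]_N =
    (fun N => (1 - q) * a 0%N + q * geo_partial (fun i => a i.+1) N).
  apply/funext => N /=; rewrite /geo_partial big_ord_recl expr0 mul1r mulrDr.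
  congr (_ + _); rewrite mulrCA; congr (_ * _); rewrite mulr_sumr.
  by apply: eq_bigr => i _; rewrite exprS mulrA.
apply: cvgD; first exact: cvg_cst.
by apply: cvgM; [exact: cvg_cst|exact: (geo_cvg aB')].
Qed.

End GeometricMean.

Lemma limn_einf_le (R : realType) (v : (\bar R)^nat) (C : \bar R) :
  (forall N, (v N <= C)%E) -> (limn_einf v <= C)%E.
Proof.
move=> vC; rewrite limn_einf_lim; apply: lime_le; first exact: is_cvg_einfs.
apply: nearW => N; apply: le_trans (vC N).
by apply: ereal_inf_lbound; exists N => /=.
Qed.

Section Solution.
Variables (R : realType) (p : nat) (p_pr : prime p) (n : nat).
Local Notation Qp := (padic p_pr).
Local Notation Qpn := 'rV[Qp]_n.
Local Notation Bn := (borel_Qpn p_pr n).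
Local Notation digits := {ffun 'I_n -> 'I_p}.
Variable mu : {measure set Bn -> \bar R}.
Hypothesis mu_haar : normalized_haar mu.
Local Notation L1 := (L1 mu).
Local Notation Int := (Int mu).
Local Notation avg := (avg mu).
Local Notation pvol := (@pvol R p n).
Implicit Types (x y z h : Qpn) (j k : int) (a : digits).

Variable (q : R).
Hypotheses (q_gt0 : 0 < q) (q_lt1 : q < 1).
Variables (l m : int) (M : R) (u : Qpn -> R).
Hypotheses (lu : lcst l u) (uL : L1 u) (uM : forall x, `|u x| <= M).
Hypothesis (u0 : forall x, ~ pcoset 0 m x -> u x = 0).

(* phi k is the average over the levels j <= k, with weights (1 - q) q^(k - j), of
   the means of u over cosets of p^j Z_p^n; q stands for p^-s. *)
Definition phi k x := geo q (fun i : nat => avg (k - i%:Z) u x).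

Let M_ge0 : 0 <= M. Proof. exact: le_trans (normr_ge0 _) (uM 0). Qed.

Let avgM k x : `|avg k u x| <= M. Proof. exact: (avg_bound mu_haar). Qed.

Lemma phi_rec k x : phi k x = (1 - q) * avg k u x + q * phi (k - 1) x.
Proof.
have aM (i : nat) : `|avg (k - i%:Z) u x| <= M by exact: avgM.
rewrite /phi (geo_rec q_gt0 q_lt1 aM).
have -> : k - 0%N%:Z = k by lia.
congr (_ + _ * geo q _); apply/funext => i.
by have -> : k - i.+1%:Z = k - 1 - i%:Z by lia.
Qed.

Lemma phi_lcst k : lcst k (phi k).
Proof.
move=> x y xy; rewrite /phi; congr geo; apply/funext => i.
by apply: avg_lcst; apply: pcoset_le xy; lia.
Qed.

Lemma phi_bound k x : `|phi k x| <= M.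
Proof. by apply: geo_bound => // i; exact: avgM. Qed.

(** Take the mean over the children of the recursion at level k + 1: their averages have mean
    [avg k u x], while [phi k] is constant on the coset. *)
Lemma phi_harmonic k x :
  cmean k (phi (k + 1)) x = (1 - q) * avg k u x + q * phi k x.
Proof.
have pcst := phi_lcst (k := k); rewrite (avg_child _ _ uL) /cmean.
under eq_bigr => a _.
  rewrite phi_rec addrK (pcst x _ (child_pcoset _ _ _)); over.
rewrite big_split /= -mulr_sumr mulrDr mulrCA; congr (_ + _).
rewrite sumr_const card_digits -(mulr_natl (q * _)) mulKf //.
by rewrite pnatr_eq0 -lt0n expn_gt0 prime_gt0.
Qed.

Local Opaque phi.

Lemma phi_above k x : l <= k -> u x - phi k x = q * (u x - phi (k - 1) x).
Proof.
move=> lk; rewrite phi_rec (avg_id mu_haar (lcst_le lk lu)); ring.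
Qed.

Lemma phi_aboveX (i : nat) x :
  u x - phi (l + i%:Z) x = q ^+ i * (u x - phi l x).
Proof.
elim: i => [|i IHi]; first by rewrite addr0 mul1r.
have li : l <= l + i.+1%:Z by lia.
have E : l + i.+1%:Z - 1 = l + i%:Z by lia.
apply: (etrans (phi_above x li)); rewrite E.
by apply: (etrans (congr1 _ IHi)); rewrite exprS mulrA.
Qed.

Local Transparent phi.

(** Each coset in the series either misses the support, and its average is 0, or meets it without
    lying in p^k Z_p^n; then its level is smaller than k and its average is small because its volume
    is large. *)
Lemma phi_infty k j y : k <= m -> ~ (pcoset y j `<=` pcoset 0 k) ->
  `|phi j y| <= (pvol k)^-1 * Int (fun x => `|u x|).
Proof.
move=> km yk.
have I0 : 0 <= Int (fun x => `|u x|) by exact: Int_ge0.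
have vk : 0 <= (pvol k)^-1 by rewrite invr_ge0 ltW // pvol_gt0.
apply: geo_bound => // [|i]; first exact: mulr_ge0.
set j' := j - i%:Z.
have [[z [yz z0]]|nz] := pselect (exists z, pcoset y j' z /\ pcoset 0 m z); last first.
  rewrite avg_supp ?normr0 ?mulr_ge0 // => z yz; apply: u0 => z0.
  by apply: nz; exists z.
have jk : j' < k.
  rewrite ltNge; apply/negP => kj; apply: yk => w yw.
  have : pcoset y j' w by apply: pcoset_le yw; lia.
  rewrite (pcoset_eq yz) => /(pcoset_le kj).
  by rewrite -(pcoset_eq (pcoset_le km z0)).
apply: (le_trans (avg_le_L1 _ _ uL)); rewrite ler_wpM2r //.
rewrite lef_pV2 ?posrE ?pvol_gt0 // /pvol.
by apply: ler_weXz2l; [rewrite ler1n expn_gt0 prime_gt0|lia].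
Qed.

(** Averages contract the L^1 norm and the weights total at most 1, so all partial sums satisfy the
    bound; Fatou passes it to the pointwise limit. *)
Lemma phi_L1_le k : L1 (phi k) /\ Int (fun x => `|phi k x|) <= Int (fun x => `|u x|).
Proof.
pose S N x := geo_partial q (fun i : nat => avg (k - i%:Z) u x) N.
have SL N : L1 (S N).
  apply/L1Z/L1_sum => i; apply: L1Z; exact: (avg_L1 mu_haar lu).
have SI N : Int (fun x => `|S N x|) <= Int (fun x => `|u x|).
  pose B N := Int (fun x => `|geo_partial q (fun i : nat => avg (k - i%:Z) u x) N|).
  pose T x := (1 - q) * \sum_(i < N) q ^+ i * `|avg (k - i%:Z) u x|.
  have TL : L1 T.
    by apply/L1Z/L1_sum => i; apply/L1Z/L1_abs; exact: (avg_L1 mu_haar lu).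
  apply: (@le_trans _ _ (Int T)).
    apply: Int_le => [|//|x]; first exact: L1_abs.
    rewrite /S /T /geo_partial normrM gtr0_norm ?subr_gt0 //.
    rewrite ler_pM2l ?subr_gt0 //; apply: (le_trans (ler_norm_sum _ _ _)).
    apply: ler_sum => i _; rewrite normrM ler_wpM2r //.
    by rewrite ger0_norm // exprn_ge0 // ltW.
  have FL i : L1 (fun x => q ^+ i * `|avg (k - i%:Z) u x|).
    by apply/L1Z/L1_abs; exact: (avg_L1 mu_haar lu).
  rewrite /T IntZ; last exact: L1_sum.
  rewrite Int_sum //.
  (* The bound on geometric means is reused for the sequence of L^1 norms of the averages. *)
  have := @geo_partial_bound _ q q_gt0 q_lt1
    (fun i => Int (fun x => `|avg (k - i%:Z) u x|)) _ N (@Int_ge0 _ _ _ _ mu (fun x => `|u x|) (fun x => normr_ge0 _)) _.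
  rewrite /geo_partial => h.
  under eq_bigr do rewrite IntZ ?(L1_abs (avg_L1 mu_haar lu _ _)) //.
  apply: (le_trans (ler_norm _)); apply: h => i.
  rewrite ger0_norm; first exact: (Int_abs_avg mu_haar lu).
  exact: Int_ge0.
have Sphi x : S N x @[N --> \oo] --> phi k x.
  by apply: (@geo_cvg _ _ _ _ _ M) => // i; exact: avgM.
have Sm N : measurable_fun [set: Bn] ((fun x => `|S N x|%:E) : Bn -> \bar R).
  exact: (measurable_int _ (L1_abs (SL N))).
have phim : measurable_fun [set: Bn] (phi k : Bn -> R).
  by apply: lcst_measurable; exact: phi_lcst.
have F : (\int[mu]_x `|phi k x|%:E <= (Int (fun x => `|u x|))%:E)%E.
  have -> : (\int[mu]_x `|phi k x|%:E =
      \int[mu]_x limn_einf (fun N => `|S N x|%:E))%E.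
    apply: eq_integral => x _; apply/esym.
    apply: (cvg_limn_einf_sup _).1; apply: cvg_EFin; first exact: nearW.
    exact: (cvg_norm (Sphi x)).
  apply: (le_trans (fatou mu measurableT Sm _)) => [N x _|]; first by rewrite lee_fin.
  apply: limn_einf_le => N; rewrite (IntE (L1_abs (SL N))) lee_fin; exact: SI.
have phiL : L1 (phi k).
  apply/integrableP; split; first exact/measurable_EFinP.
  by apply: (le_lt_trans F); rewrite ltry.
by split=> //; rewrite -lee_fin -(IntE (L1_abs phiL)).
Qed.

Lemma phi_L1 k : L1 (phi k). Proof. exact: (phi_L1_le k).1. Qed.

Lemma Int_abs_phi k : Int (fun x => `|phi k x|) <= Int (fun x => `|u x|).
Proof. exact: (phi_L1_le k).2. Qed.

End Solution.

(** * Energy flux through a level *)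

Section EsumTelescope.
Variable R : realType.

Lemma nneseries_telescope (e T : nat -> R) (L : R) :
  (forall i, 0 <= e i) -> (forall i, e i = T i.+1 - T i) ->
  T i @[i --> \oo] --> L ->
  (\esum_(i in [set: nat]) (e i)%:E = (L - T 0%N)%:E)%E.
Proof.
move=> e0 eT TL; rewrite -nneseries_esumT; last by move=> i; rewrite lee_fin.
apply: cvg_lim => //.
have -> : (fun N => \sum_(0 <= i < N) (e i)%:E)%E = (fun N => (T N - T 0%N)%:E).
  apply/funext => N; rewrite sumEFin; congr EFin.
  by under eq_bigr do rewrite eT; rewrite telescope_sumr.
apply: cvg_EFin; first exact: nearW.
by apply: cvgB => //; exact: cvg_cst.
Qed.

(** The levels k >= 0 contribute L - T(-1) and the negative ones T(-1) - 0. *)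
Lemma esum_int_telescope (e T : int -> R) (L : R) :
  (forall k, 0 <= e k) -> (forall k, e k = T k - T (k - 1)) ->
  T i%:Z @[i --> \oo] --> L -> T (- i%:Z) @[i --> \oo] --> (0 : R) ->
  (\esum_(k in [set: int]) (e k)%:E = L%:E)%E.
Proof.
move=> e0 eT TL T0.
rewrite (esumID [set k | 0 <= k]) ?setTI; last by move=> k _; rewrite lee_fin.
rewrite (reindex_esum setT _ Posz); last first.
  split=> [i _ //|i j _ _ [] //|k /= k0]; exists `|k|%N => //; lia.
rewrite (reindex_esum setT (~` [set k | 0 <= k]) Negz); last first.
  split=> [i _ //=|i j _ _ [] //|k /= /negP k0]; exists `|(k + 1)%R|%N => //; lia.
rewrite (@nneseries_telescope (fun i => e i%:Z) (fun i => T (i%:Z - 1)) L) //.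
- rewrite (@nneseries_telescope (fun i => e (Negz i)) (fun i => - T (- i%:Z - 1)) 0) //.
  + by rewrite -EFinD; congr EFin; rewrite !opprK oppr0; ring.
  + move=> i; rewrite eT opprK [RHS]addrC; congr (T _ - T _); lia.
  + rewrite -oppr0; apply: cvgN.
    rewrite -(cvg_shiftS (fun i : nat => T (- i%:Z))) in T0.
    apply: cvg_trans T0; apply: near_eq_cvg; apply: nearW => i /=; congr T; lia.
- move=> i; rewrite eT; congr (T _ - T _); lia.
- rewrite -cvg_shiftS; apply: cvg_trans TL; apply: near_eq_cvg; apply: nearW => i /=.
  congr T; lia.
Qed.

End EsumTelescope.

Lemma int_shift_const (T : Type) (W : int -> T) :
  (forall k, W k = W (k - 1)) -> forall k, W k = W 0.
Proof.
move=> step; case=> i.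
  elim: i => [|i <-]; first by [].
  by rewrite step; congr W; lia.
rewrite NegzE; elim: i => [|i <-]; rewrite [in RHS]step; congr W; lia.
Qed.

Section Energy.
Local Opaque Int avg cmean phi pcoset.
Variables (R : realType) (p : nat) (p_pr : prime p) (n : nat).
Local Notation Qp := (padic p_pr).
Local Notation Qpn := 'rV[Qp]_n.
Local Notation Bn := (borel_Qpn p_pr n).
Variable mu : {measure set Bn -> \bar R}.
Hypothesis mu_haar : normalized_haar mu.
Local Notation L1 := (L1 mu).
Local Notation Int := (Int mu).
Local Notation avg := (avg mu).
Implicit Types (x y z h : Qpn) (j k r : int).

Variable (q : R).
Hypotheses (q_gt0 : 0 < q) (q_lt1 : q < 1).
Variables (l : int) (M : R).
Local Notation phi := (phi mu q).

Let q_neq0 : q != 0. Proof. exact: lt0r_neq0. Qed.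

(* Above the level l of u the error u - phi u k is multiplied by exactly q at each
   level, so that the normal derivative is already reached at level l. *)
Definition vlad (u : Qpn -> R) x := q ^ (- (l + 1)) * (u x - phi u l x).

Definition dphi (u : Qpn -> R) k x := phi u k x - phi u (k - 1) x.

Definition test_fun (u : Qpn -> R) := [/\ lcst l u, L1 u & forall x, `|u x| <= M].

(** The boundary term of Green's formula: by [flux_step] and [flux_cvg0] it is the mixed energy of u
    and v over all levels up to k. The bilinear form serves the symmetry of D^s as well as the
    energy. *)
Definition flux (u v : Qpn -> R) k := q ^ (- k) * Int (fun x => phi u k x * dphi v k x).

Section OneFunction.
Variable u : Qpn -> R.
Hypothesis ug : test_fun u.

Let lu : lcst l u. Proof. by case: ug. Qed.
Let uL : L1 u. Proof. by case: ug. Qed.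
Let uM : forall x, `|u x| <= M. Proof. by case: ug. Qed.

Lemma phi_test_fun k : [/\ lcst k (phi u k), L1 (phi u k) & forall x, `|phi u k x| <= M].
Proof.
split; first exact: phi_lcst.
  exact: (phi_L1 mu_haar q_gt0 q_lt1 lu uL uM).
exact: (phi_bound mu_haar q_gt0 q_lt1 uL uM).
Qed.

Lemma phi_measurable k : measurable_fun [set: Bn] (phi u k : Bn -> R).
Proof. by have [/lcst_measurable] := phi_test_fun k. Qed.

Lemma vlad_lcst : lcst l (vlad u).
Proof.
have [h _ _] := phi_test_fun l.
by move=> x y xy; rewrite /vlad (lu xy) (h x y xy).
Qed.

Lemma vlad_L1 : L1 (vlad u).
Proof. by have [_ h _] := phi_test_fun l; apply/L1Z/L1B. Qed.

Lemma vlad_bdd : bdd (vlad u).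
Proof.
have [_ _ h] := phi_test_fun l; exists (`|q ^ (- (l + 1))| * (M + M)) => x.
rewrite normrM ler_wpM2l // (le_trans (ler_normB _ _)) // lerD //; exact: h.
Qed.

Lemma vladE k x : l <= k -> q ^ (- (k + 1)) * (u x - phi u k x) = vlad u x.
Proof.
move=> lk; have -> : k = l + `|(k - l)%R|%N%:Z by lia.
set i := `|_|%N; rewrite /vlad.
apply: (etrans (congr1 _ (phi_aboveX mu_haar q_gt0 q_lt1 lu uL uM i x))).
rewrite mulrA; congr (_ * _); rewrite exprnP -expfzDr //; congr (_ ^ _); lia.
Qed.

Lemma phi_vlad k x : l <= k -> phi u k x = u x - q ^ (k + 1) * vlad u x.
Proof.
move=> lk; rewrite -(vladE x lk) mulrA -expfzDr // subrr expr0z mul1r.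
by rewrite subKr.
Qed.

Lemma dphi_lcst k : lcst k (dphi u k).
Proof.
have [h _ _] := phi_test_fun k; have [h' _ _] := phi_test_fun (k - 1).
move=> x y xy; rewrite /dphi (h x y xy) (h' x y) //.
by apply: pcoset_le xy; lia.
Qed.

Lemma dphi_L1 k : L1 (dphi u k).
Proof. by have [_ h _] := phi_test_fun k; have [_ h' _] := phi_test_fun (k - 1); apply: L1B. Qed.

Lemma dphi_bdd k : bdd (dphi u k).
Proof.
have [_ _ h] := phi_test_fun k; have [_ _ h'] := phi_test_fun (k - 1).
exists (M + M) => x; rewrite /dphi (le_trans (ler_normB _ _)) // lerD //.
Qed.

Lemma dphi_L1_le k : Int (fun x => `|dphi u k x|) <= 2 * Int (fun x => `|u x|).
Proof.
have [_ hL _] := phi_test_fun k; have [_ hL' _] := phi_test_fun (k - 1).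
apply: (@le_trans _ _ (Int (fun x => `|phi u k x| + `|phi u (k - 1) x|))).
  apply: Int_le => [||x]; [exact/L1_abs/dphi_L1|apply: L1D; exact: L1_abs|].
  exact: ler_normB.
rewrite IntD; [|exact: L1_abs|exact: L1_abs].
rewrite mulr_natl mulr2n lerD //; exact: (Int_abs_phi mu_haar q_gt0 q_lt1 lu uL uM).
Qed.

(** Harmonicity in weak form. Against t, [phi u (k + 1)] may be replaced by its mean over the
    children, and then the identity holds pointwise. *)
Lemma Int_dphiS k t : lcst k t -> bdd t ->
  Int (fun x => t x * dphi u (k + 1) x) = q * Int (fun x => t x * dphi u k x).
Proof.
move=> kt tb.
have tL w : L1 w -> L1 (fun x => t x * w x).
  by apply: L1M => //; exact: lcst_measurable kt.
have [hk hL _] := phi_test_fun k.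
have [_ hL1 _] := phi_test_fun (k + 1).
rewrite -IntZ; last exact/tL/dphi_L1.
pose I1 := Int (fun x => t x * phi u (k + 1) x).
pose I2 := Int (fun x => t x * cmean k (phi u (k + 1)) x).
pose I0 := Int (fun x => t x * phi u k x).
transitivity (I1 - I0).
  by rewrite /I1 /I0 -IntB; [|exact: tL|exact: tL]; apply: Int_eq => x; rewrite /dphi addrK mulrBr.
have E : I2 = I1 by exact: (Int_cmean mu_haar kt tb hL1).
rewrite -E /I2 /I0 -IntB; [|exact/tL/L1_cmean|exact: tL].
apply: Int_eq => x.
have := phi_harmonic mu_haar q_gt0 q_lt1 uL uM k x.
have := phi_rec mu_haar q_gt0 q_lt1 uL uM k x; rewrite /dphi.
move: (cmean k (phi u (k + 1)) x) (phi u k x) (phi u (k - 1) x) (avg k u x) (t x).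
by move=> m a b c d Er ->; rewrite Er; ring.
Qed.

End OneFunction.

Section Bilinear.
Variables u v : Qpn -> R.
Hypotheses (ug : test_fun u) (vg : test_fun v).

Let phidL k j : L1 (fun x => phi u k x * dphi v j x).
Proof.
have [_ _ h] := phi_test_fun ug k.
apply: L1M; [exact: phi_measurable|by exists M|exact: dphi_L1].
Qed.

Let q_pred k : q ^ (- (k - 1)) = q ^ (- k) * q.
Proof. by rewrite opprB addrC expfzDr // expr1z. Qed.

(** Discrete integration by parts: [phi u (k - 1)] is a legitimate test function of level k - 1, and
    the factor q gained in pairing it with [dphi v k] is absorbed by the weight q^-k. *)
Lemma flux_step k :
  q ^ (- k) * Int (fun x => dphi u k x * dphi v k x) = flux u v k - flux u v (k - 1).
Proof.
have [hk _ hb] := phi_test_fun ug (k - 1).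
have E := Int_dphiS vg hk (ex_intro _ M hb); rewrite subrK in E.
have -> : flux u v (k - 1) = q ^ (- k) * Int (fun x => phi u (k - 1) x * dphi v k x).
  by rewrite /flux [in RHS]E mulrA q_pred.
rewrite /flux -mulrBr -(IntB (phidL _ _) (phidL _ _)).
by congr (_ * _); apply: Int_eq => x; rewrite -mulrBl.
Qed.

(** At level -i the weight is q^i, while the integral stays bounded: one factor is bounded by M, the
    other in L^1. *)
Lemma flux_cvg0 : flux u v (- i%:Z) @[i --> \oo] --> (0 : R).
Proof.
have [_ uL uM] := ug; have [_ vL vM] := vg.
have M0 : 0 <= M by apply: le_trans (uM 0).
pose C := M * (2 * Int (fun x => `|v x|)).
have C0 : 0 <= C by rewrite !mulr_ge0 //; exact: Int_ge0.
have fC (i : nat) : `|flux u v (- i%:Z)| <= C * q ^+ i.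
  rewrite /flux opprK -exprnP normrM (ger0_norm (exprn_ge0 i (ltW q_gt0))) mulrC.
  rewrite ler_wpM2r ?exprn_ge0 ?(ltW q_gt0) //.
  apply: (le_trans (Int_abs (phidL _ _))).
  have [_ _ hb] := phi_test_fun ug (- i%:Z).
  apply: (@le_trans _ _ (Int (fun x => M * `|dphi v (- i%:Z) x|))).
    apply: Int_le => [||x]; [exact: L1_abs|exact/L1Z/L1_abs/dphi_L1|].
    by rewrite normrM ler_wpM2r.
  rewrite IntZ; last exact/L1_abs/dphi_L1.
  by rewrite ler_wpM2l //; exact: dphi_L1_le.
have CL : (fun i : nat => C * q ^+ i) @ \oo --> (0 : R).
  by have := @cvg_geometric R C q; apply; rewrite gtr0_norm.
have NCL : (fun i : nat => - (C * q ^+ i)) @ \oo --> (0 : R).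
  by rewrite -oppr0; apply: cvgN.
apply: (squeeze_cvgr _ NCL CL); apply: nearW => i.
by rewrite -ler_norml fC.
Qed.

Lemma dphi_vlad k x : l < k -> dphi v k x = q ^ k * ((1 - q) * vlad v x).
Proof.
move=> lk; rewrite /dphi.
(* The closed form is used at k - 1 too, hence the strict inequality in the hypothesis. *)
have lk1 : l <= k - 1 by lia.
rewrite (phi_vlad vg x (ltW lk)) (phi_vlad vg x lk1) subrK.
by rewrite expfzDr // expr1z; ring.
Qed.

Lemma flux_above k : l < k ->
  flux u v k = (1 - q) * (Int (fun x => u x * vlad v x) -
    q ^ (k + 1) * Int (fun x => vlad u x * vlad v x)).
Proof.
move=> lk; have [lu uL uM] := ug.
have wL : L1 (vlad v) by exact: vlad_L1.
have uvL : L1 (fun x => u x * vlad v x).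
  by apply: L1M wL; [exact: lcst_measurable lu|exists M].
have vvL : L1 (fun x => vlad u x * vlad v x).
  apply: L1M wL; [|exact: vlad_bdd].
  by apply: lcst_measurable; exact: vlad_lcst.
pose w x := u x * vlad v x - q ^ (k + 1) * (vlad u x * vlad v x).
have wwL : L1 w by apply: L1B; [exact: uvL|exact: L1Z].
have -> : flux u v k = q ^ (- k) * Int (fun x => (q ^ k * (1 - q)) * w x).
  rewrite /flux; congr (_ * _); apply: Int_eq => x.
  have := dphi_vlad x lk; have := phi_vlad ug x (ltW lk); rewrite /w.
  move: (phi u k x) (dphi v k x) (vlad v x) (vlad u x) (u x) => a b c d e -> ->.
  by move: (q ^ (k + 1)) (q ^ k) => f g; ring.
rewrite (IntZ _ wwL) !mulrA -expfzDr // addNr expr0z mul1r; congr (_ * _).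
by rewrite (IntB uvL (L1Z _ vvL)) (IntZ _ vvL).
Qed.

Lemma flux_cvg : flux u v i%:Z @[i --> \oo] --> (1 - q) * Int (fun x => u x * vlad v x).
Proof.
pose c := Int (fun x => vlad u x * vlad v x).
have CL : (fun i : nat => (q * c) * q ^+ i) @ \oo --> (0 : R).
  by have := @cvg_geometric R (q * c) q; apply; rewrite gtr0_norm.
have : (1 - q) * (Int (fun x => u x * vlad v x) - (q * c) * q ^+ i) @[i --> \oo]
    --> (1 - q) * (Int (fun x => u x * vlad v x) - 0).
  apply: cvgM; first exact: cvg_cst.
  by apply: cvgB => //; exact: cvg_cst.
rewrite subr0; apply: cvg_trans; apply: near_eq_cvg.
exists `|l|.+1 => // i /= li.
rewrite flux_above; last by lia.
rewrite expfzDr // expr1z -exprnP; congr (_ * (_ - _)); rewrite -/c; ring.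
Qed.

End Bilinear.

(* The antisymmetric part of the flux does not depend on the level. *)
Lemma vlad_sym u v : test_fun u -> test_fun v ->
  Int (fun x => u x * vlad v x) = Int (fun x => v x * vlad u x).
Proof.
move=> ug vg.
have alg (a b c d : R) : a - c = b - d -> a - b = c - d.
  by move=> h; have -> : a - b = (a - c) + (c - b); [ring|rewrite h; ring].
pose W k := flux u v k - flux v u k.
have step k : W k = W (k - 1).
  have E : Int (fun x => dphi u k x * dphi v k x) = Int (fun x => dphi v k x * dphi u k x).
    by apply: Int_eq => x; exact: mulrC.
  apply: alg; apply: (etrans (esym (flux_step ug vg k))).
  by apply: (etrans _ (flux_step vg ug k)); rewrite E.
have Wcst := int_shift_const step.
(* The constant value is computed at both ends: it is 0 as the level tends to -oo, and 1 - q times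
   the difference of the two integrals as it tends to +oo. *)
have W0 : W 0 = 0.
  apply: (@cvg_unique _ (@Rhausdorff R) (W (- i%:Z) @[i --> \oo])).
    have -> : (fun i : nat => W (- i%:Z)) = fun=> W 0 by apply/funext => i; exact: Wcst.
    exact: cvg_cst.
  have := cvgB (flux_cvg0 ug vg) (flux_cvg0 vg ug); rewrite subr0; exact.
pose A := Int (fun x => u x * vlad v x).
pose B := Int (fun x => v x * vlad u x).
have L : (1 - q) * A - (1 - q) * B = 0.
  apply: (@cvg_unique _ (@Rhausdorff R) (W i%:Z @[i --> \oo])).
    exact: (cvgB (flux_cvg ug vg) (flux_cvg vg ug)).
  have -> : (fun i : nat => W i%:Z) = fun=> 0 by apply/funext => i; rewrite Wcst W0.
  exact: cvg_cst.
suff: A = B by [].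
move: A B L => A B L; clear - L q_lt1.
have q1 : 1 - q != 0 by rewrite subr_eq0 gt_eqF.
by apply: (mulfI q1); apply/eqP; rewrite -subr_eq0 L.
Qed.

End Energy.

(** * Pairing the recursion with a character *)

Section FourierMultiplier.
Local Opaque Int avg cmean phi pcoset.
Variables (R : realType) (p : nat) (p_pr : prime p) (n : nat).
Local Notation Qp := (padic p_pr).
Local Notation Qpn := 'rV[Qp]_n.
Local Notation Bn := (borel_Qpn p_pr n).
Variable mu : {measure set Bn -> \bar R}.
Hypothesis mu_haar : normalized_haar mu.
Local Notation L1 := (L1 mu).
Local Notation Int := (Int mu).
Local Notation avg := (avg mu).
Implicit Types (x y z h : Qpn) (j k r : int).

Variable (q : R).
Hypotheses (q_gt0 : 0 < q) (q_lt1 : q < 1).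
Variables (l : int) (M : R).
Local Notation phi := (phi mu q).
Local Notation vlad := (vlad mu q l).

Let q_neq0 : q != 0. Proof. exact: lt0r_neq0. Qed.

Variables (u : Qpn -> R) (ug : test_fun mu l M u).

Let lu : lcst l u. Proof. by case: ug. Qed.
Let uL : L1 u. Proof. by case: ug. Qed.
Let uM : forall x, `|u x| <= M. Proof. by case: ug. Qed.

Variables (t : Qpn -> R) (tm : measurable_fun [set: Bn] (t : Bn -> R)).
Hypothesis (t1 : forall x, `|t x| <= 1).

Let tb : bdd t. Proof. by exists 1. Qed.

Lemma L1_mult w : L1 w -> L1 (fun x => t x * w x).
Proof. exact: L1M. Qed.

Let phiL k : L1 (phi u k).
Proof. exact: (phi_L1 mu_haar q_gt0 q_lt1 lu uL uM). Qed.

(** As t is constant on cosets of level k, averaging u at this level leaves its pairing with t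
    unchanged. *)
Lemma Int_mult_phi k : lcst k t -> Int (fun x => t x * phi u k x) =
  (1 - q) * Int (fun x => t x * u x) + q * Int (fun x => t x * phi u (k - 1) x).
Proof.
move=> kt.
have aL : L1 (avg k u) by exact: (avg_L1 mu_haar lu).
have E : Int (fun x => t x * avg k u x) = Int (fun x => t x * u x).
  exact: (Int_avg mu_haar lu).
rewrite -E -(IntZ (1 - q) (L1_mult aL)) -(IntZ q (L1_mult (phiL (k - 1)))).
rewrite -(IntD (L1Z _ (L1_mult aL)) (L1Z _ (L1_mult (phiL (k - 1))))).
apply: Int_eq => x; have := phi_rec mu_haar q_gt0 q_lt1 uL uM k x.
by move: (phi u k x) => a ->; ring.
Qed.

Let D k := Int (fun x => t x * (u x - phi u k x)).

Let DE k : D k = Int (fun x => t x * u x) - Int (fun x => t x * phi u k x).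
Proof.
rewrite -(IntB (L1_mult uL) (L1_mult (phiL k))).
by apply: Int_eq => x; rewrite mulrBr.
Qed.

Let D_rec k : lcst k t -> D k = q * D (k - 1).
Proof.
move=> kt.
have alg (a b X P P' : R) : a = X - P -> b = X - P' -> P = (1 - q) * X + q * P' ->
  a = q * b by move=> -> -> ->; ring.
exact: alg (DE k) (DE (k - 1)) (Int_mult_phi kt).
Qed.

Let vladD : Int (fun x => t x * vlad u x) = q ^ (- (l + 1)) * D l.
Proof.
rewrite -(IntZ _ (L1_mult (L1B uL (phiL l)))).
by apply: Int_eq => x; rewrite /vlad mulrCA.
Qed.

(* t stands for a character of conductor p^r, which is orthogonal to all functions
   of lower level; then q^-r is the value of ||xi||^s. *)
Lemma Int_mult_vlad r : lcst r t ->
  (forall w, lcst (r - 1) w -> L1 w -> Int (fun x => t x * w x) = 0) ->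
  Int (fun x => t x * vlad u x) = q ^ (- r) * Int (fun x => t x * u x).
Proof.
move=> rt kill.
have phi_r k : k <= r - 1 -> Int (fun x => t x * phi u k x) = 0.
  move=> kr; have h : lcst k (phi u k) by exact: phi_lcst.
  exact: (kill _ (lcst_le kr h) (phiL k)).
(* If l < r, then u and [phi u l] are both too coarse for t to detect, and both sides vanish. *)
rewrite vladD; have [lr|rl] := leP l (r - 1).
  have -> : Int (fun x => t x * u x) = 0 by apply: kill => //; exact: lcst_le lu.
  rewrite DE phi_r // subr0 mulr0.
  by rewrite (kill u) ?mulr0 //; exact: lcst_le lu.
(* At level r - 1 the pairing with phi is 0, so D is the whole integral; the l - r + 1 levels up to
   l each bring a factor q, and the normalization q^-(l+1) leaves q^-r. *)
have DX (i : nat) : D (r - 1 + i%:Z) = q ^+ i * Int (fun x => t x * u x).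
  elim: i => [|i IHi]; first by rewrite addr0 DE phi_r // subr0 mul1r.
  rewrite D_rec; last by apply: (lcst_le _ rt); lia.
  have -> : r - 1 + i.+1%:Z - 1 = r - 1 + i%:Z by lia.
  by rewrite IHi exprS mulrA.
have -> : l = r - 1 + `|(l - (r - 1))%R|%N%:Z by lia.
set i := `|_|%N; rewrite DX mulrA exprnP -expfzDr //; congr (_ ^ _ * _); lia.
Qed.

(** Frequency zero: the recursion holds at every level, so D l is q^i times the bounded quantity D
    (l - i) for all i. *)
Lemma Int_mult_vlad0 : (forall k, lcst k t) -> Int (fun x => t x * vlad u x) = 0.
Proof.
move=> kt; rewrite vladD.
pose C := 2 * Int (fun x => `|u x|).
have DC k : `|D k| <= C.
  apply: (le_trans (Int_abs (L1_mult (L1B uL (phiL k))))).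
  apply: (@le_trans _ _ (Int (fun x => `|u x| + `|phi u k x|))).
    apply: Int_le => [||x]; [exact/L1_abs/L1_mult/L1B|apply: L1D; exact: L1_abs|].
    rewrite normrM; apply: (le_trans _ (ler_normB _ _)); exact: ler_piMl.
  rewrite (IntD (L1_abs uL) (L1_abs (phiL k))) /C mulr_natl mulr2n lerD //.
  exact: (Int_abs_phi mu_haar q_gt0 q_lt1 lu uL uM).
have DX (i : nat) : D l = q ^+ i * D (l - i%:Z).
  elim: i => [|i IHi]; first by rewrite subr0 mul1r.
  have E : l - i.+1%:Z = l - i%:Z - 1 by lia.
  by rewrite E exprSr -mulrA; apply: (etrans IHi); congr (_ * _); exact: D_rec.
suff -> : D l = 0 by rewrite mulr0.
apply: (@cvg_unique _ (@Rhausdorff R) ((fun i : nat => D l) @ \oo)).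
  exact: cvg_cst.
have CL : (fun i : nat => C * q ^+ i) @ \oo --> (0 : R).
  by have := @cvg_geometric R C q; apply; rewrite gtr0_norm.
have NCL : (fun i : nat => - (C * q ^+ i)) @ \oo --> (0 : R).
  by rewrite -oppr0; apply: cvgN.
apply: (squeeze_cvgr _ NCL CL); apply: nearW => i.
rewrite -ler_norml (DX i) normrM mulrC (ger0_norm (exprn_ge0 i (ltW q_gt0))).
by rewrite ler_wpM2r // exprn_ge0 // ltW.
Qed.

End FourierMultiplier.

(** * The Fourier transform *)

Section ComplexIntegral.
Local Opaque Int pcoset.
Variables (R : realType) (p : nat) (p_pr : prime p) (n : nat).
Local Notation Qp := (padic p_pr).
Local Notation Qpn := 'rV[Qp]_n.
Local Notation Bn := (borel_Qpn p_pr n).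
Variable mu : {measure set Bn -> \bar R}.
Hypothesis mu_haar : normalized_haar mu.
Local Notation L1 := (L1 mu).
Local Notation Int := (Int mu).
Local Notation Re := complex.Re.
Local Notation Im := complex.Im.
Implicit Types (x y z h xi : Qpn) (j k r : int) (f g : Qpn -> R[i]) (c : R[i]).

Definition cL1 f := L1 (fun x => Re (f x)) /\ L1 (fun x => Im (f x)).

Lemma cintegralE f :
  cintegral mu f = Complex (Int (fun x => Re (f x))) (Int (fun x => Im (f x))).
Proof. by []. Qed.

Lemma ReM c d : Re (c * d) = Re c * Re d - Im c * Im d.
Proof. by case: c d => [a b] [a' b']. Qed.

Lemma ImM c d : Im (c * d) = Re c * Im d + Im c * Re d.
Proof. by case: c d => [a b] [a' b']. Qed.

Lemma ReD c d : Re (c + d) = Re c + Re d. Proof. by case: c d => [a b] []. Qed.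
Lemma ImD c d : Im (c + d) = Im c + Im d. Proof. by case: c d => [a b] []. Qed.
Lemma ReN c : Re (- c) = - Re c. Proof. by case: c. Qed.
Lemma ImN c : Im (- c) = - Im c. Proof. by case: c. Qed.

Lemma complex_eq c d : Re c = Re d -> Im c = Im d -> c = d.
Proof. by case: c d => [a b] [a' b'] /= -> ->. Qed.

Lemma cL1M f (t : Qpn -> R[i]) :
  measurable_fun [set: Bn] ((fun x => Re (t x)) : Bn -> R) ->
  measurable_fun [set: Bn] ((fun x => Im (t x)) : Bn -> R) ->
  (forall x, modulus (t x) <= 1) -> cL1 f -> cL1 (fun x => f x * t x).
Proof.
move=> mr mi t1 [fr fi].
have br : bdd (fun x => Re (t x)) by exists 1 => x; exact: le_trans (modulus_Re _) (t1 x).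
have bi : bdd (fun x => Im (t x)) by exists 1 => x; exact: le_trans (modulus_Im _) (t1 x).
split.
  apply: L1_eq (L1B (L1M mr br fr) (L1M mi bi fi)) => x.
  by rewrite ReM mulrC [X in _ - X]mulrC.
apply: L1_eq (L1D (L1M mi bi fr) (L1M mr br fi)) => x.
by rewrite ImM mulrC [X in _ + X]mulrC.
Qed.

Lemma cL1Zr f c : cL1 f -> cL1 (fun x => f x * c).
Proof.
move=> [fr fi]; split.
  by apply: L1_eq (L1B (L1Z (Re c) fr) (L1Z (Im c) fi)) => x; rewrite ReM; ring.
by apply: L1_eq (L1D (L1Z (Im c) fr) (L1Z (Re c) fi)) => x; rewrite ImM; ring.
Qed.

Lemma cL1D f g : cL1 f -> cL1 g -> cL1 (fun x => f x + g x).
Proof.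
move=> [fr fi] [gr gi]; split.
  by apply: L1_eq (L1D fr gr) => x; rewrite ReD.
by apply: L1_eq (L1D fi gi) => x; rewrite ImD.
Qed.

Lemma cL1B f g : cL1 f -> cL1 g -> cL1 (fun x => f x - g x).
Proof.
move=> [fr fi] [gr gi]; split.
  by apply: L1_eq (L1B fr gr) => x; rewrite ReD ReN.
by apply: L1_eq (L1B fi gi) => x; rewrite ImD ImN.
Qed.

Lemma cintegralZr f c : cL1 f -> cintegral mu (fun x => f x * c) = cintegral mu f * c.
Proof.
move=> [fr fi]; apply: complex_eq; rewrite !cintegralE ?ReM ?ImM /=.
  transitivity (Int (fun x => Re c * Re (f x) - Im c * Im (f x))).
    by apply: Int_eq => x; rewrite ReM; ring.
  rewrite (IntB (L1Z _ fr) (L1Z _ fi)) (IntZ _ fr) (IntZ _ fi).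
  by rewrite mulrC [X in _ - X]mulrC.
transitivity (Int (fun x => Im c * Re (f x) + Re c * Im (f x))).
  by apply: Int_eq => x; rewrite ImM; ring.
rewrite (IntD (L1Z _ fr) (L1Z _ fi)) (IntZ _ fr) (IntZ _ fi).
by rewrite mulrC [X in _ + X]mulrC.
Qed.

Lemma cintegralD f g : cL1 f -> cL1 g ->
  cintegral mu (fun x => f x + g x) = cintegral mu f + cintegral mu g.
Proof.
move=> [fr fi] [gr gi]; apply: complex_eq; rewrite !cintegralE ?ReD ?ImD /=.
  by rewrite -(IntD fr gr); apply: Int_eq => x; rewrite ReD.
by rewrite -(IntD fi gi); apply: Int_eq => x; rewrite ImD.
Qed.

Lemma cintegralB f g : cL1 f -> cL1 g ->
  cintegral mu (fun x => f x - g x) = cintegral mu f - cintegral mu g.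
Proof.
move=> [fr fi] [gr gi]; apply: complex_eq; rewrite !cintegralE ?ReD ?ImD ?ReN ?ImN /=.
  by rewrite -(IntB fr gr); apply: Int_eq => x; rewrite ReD ReN.
by rewrite -(IntB fi gi); apply: Int_eq => x; rewrite ImD ImN.
Qed.

Lemma cL1_0 : cL1 (fun=> 0). Proof. by split; exact: L1_0. Qed.

Lemma cL1_cintegral_sum (I : Type) (s : seq I) (F : I -> Qpn -> R[i]) :
  (forall i, cL1 (F i)) -> cL1 (fun x => \sum_(i <- s) F i x) /\
  cintegral mu (fun x => \sum_(i <- s) F i x) = \sum_(i <- s) cintegral mu (F i).
Proof.
move=> FL; elim: s => [|i s [IH1 IH2]].
  rewrite big_nil; have -> : (fun x => \sum_(i <- [::]) F i x) = fun=> 0.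
    by apply/funext => x; rewrite big_nil.
  split; first exact: cL1_0.
  have E := cintegralZr 0 cL1_0; rewrite [RHS]mulr0 in E; rewrite -[RHS]E.
  by congr cintegral; apply/funext => x; rewrite mulr0.
have -> : (fun x => \sum_(j <- i :: s) F j x) = (fun x => F i x + \sum_(j <- s) F j x).
  by apply/funext => x; rewrite big_cons.
split; first exact: cL1D.
by rewrite big_cons cintegralD // IH2.
Qed.

Section Character.
Variable xi : Qpn.

Definition chr x : R[i] := padic_char R (dotp x xi).

Lemma chrD x y : chr (x + y) = chr x * chr y.
Proof. by rewrite /chr dotpDl padic_charD. Qed.

Lemma chr_modulus x : modulus (chr x) = 1.
Proof.
apply/eqP; rewrite -(@eqrXn2 _ 2) ?modulus_ge0 // modulus_sqr expr1n.
exact/eqP/padic_char_sqr.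
Qed.

Lemma chr_eq1 k h : pcoset 0 (- k) xi -> pcoset 0 k h -> chr h = 1.
Proof.
move=> kxi kh; apply/padic_char_eq1; rewrite -(subrr k); exact: dotp_pideal.
Qed.

Lemma chr_lcst k : pcoset 0 (- k) xi -> lcst k chr.
Proof.
move=> kxi x y /pcoset0E xy; rewrite -(subrK x y) chrD.
by rewrite (chr_eq1 kxi xy) mul1r.
Qed.

Lemma chr_level : exists k, lcst k chr.
Proof.
have [k kxi] := pcoset_ex 0 xi; exists (- k); apply: chr_lcst.
by rewrite opprK.
Qed.

Lemma chr_measurableRe : measurable_fun [set: Bn] ((fun x => Re (chr x)) : Bn -> R).
Proof.
have [k ck] := chr_level.
have h : lcst k (fun x => Re (chr x)) by move=> x y xy; rewrite (ck x y xy).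
exact: lcst_measurable h.
Qed.

Lemma chr_measurableIm : measurable_fun [set: Bn] ((fun x => Im (chr x)) : Bn -> R).
Proof.
have [k ck] := chr_level.
have h : lcst k (fun x => Im (chr x)) by move=> x y xy; rewrite (ck x y xy).
exact: lcst_measurable h.
Qed.

Lemma cL1_chr f : cL1 f -> cL1 (fun x => f x * chr x).
Proof.
apply: cL1M; [exact: chr_measurableRe|exact: chr_measurableIm|].
by move=> x; rewrite chr_modulus.
Qed.

(** Some h in p^k Z_p^n has chr h distinct from 1; translating by h preserves w and multiplies the
    complex integral A + iB by chr h, so it vanishes. *)
Lemma Int_chr_kill k w : ~ pcoset 0 (- k) xi -> lcst k w -> L1 w ->
  Int (fun x => Re (chr x) * w x) = 0 /\ Int (fun x => Im (chr x) * w x) = 0.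
Proof.
move=> kxi kw wL.
have [h kh chrh] : exists2 h, pcoset 0 k h & chr h <> 1.
  apply: contrapT => /forall2NP H; apply: kxi => i.
  have [hF|/contrapT] := H (p%:R ^ k *: delta_mx 0 i).
    case: hF => j; rewrite !mxE subr0 -[k in pideal k]addr0.
    by apply: pidealM; [exact: pideal_pX|case: eqP => _; exact: pideal_nat].
  rewrite /chr padic_char_eq1.
  have -> : dotp (p%:R ^ k *: delta_mx 0 i) xi = p%:R ^ k * xi 0 i.
    rewrite /dotp (bigD1 i) //= !mxE !eqxx mulr1 big1 ?addr0 // => j ji.
    by rewrite !mxE (negbTE ji) mulr0 mul0r.
  by rewrite -(subrr k) mxE subr0 => /pidealMpX.
set c := Re (chr h); set d := Im (chr h).
pose A := Int (fun x => Re (chr x) * w x); pose B := Int (fun x => Im (chr x) * w x).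
have AL : L1 (fun x => Re (chr x) * w x).
  apply: L1M wL; first exact: chr_measurableRe.
  by exists 1 => x; rewrite -(chr_modulus x) modulus_Re.
have BL : L1 (fun x => Im (chr x) * w x).
  apply: L1M wL; first exact: chr_measurableIm.
  by exists 1 => x; rewrite -(chr_modulus x) modulus_Im.
have wh x : w (x + h) = w x by apply: kw; apply/pcoset0E; rewrite addrAC subrr add0r.
have EA : A = c * A - d * B.
  rewrite /A -{1}(Int_translation mu_haar h AL).
  rewrite -(IntZ c AL) -(IntZ d BL) -(IntB (L1Z c AL) (L1Z d BL)).
  by apply: Int_eq => x; rewrite wh chrD ReM -/c -/d; ring.
have EB : B = d * A + c * B.
  rewrite /B -{1}(Int_translation mu_haar h BL).
  rewrite -(IntZ d AL) -(IntZ c BL) -(IntD (L1Z d AL) (L1Z c BL)).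
  by apply: Int_eq => x; rewrite wh chrD ImM -/c -/d; ring.
suff : A = 0 /\ B = 0 by [].
(* The determinant of the linear system satisfied by A and B, that is, the squared modulus of chr h
   - 1. *)
have cd : (c - 1) ^+ 2 + d ^+ 2 != 0.
  apply/eqP => E; apply: chrh.
  have c1 := sqr_ge0 (c - 1); have d1 := sqr_ge0 d.
  have c0 : (c - 1) ^+ 2 = 0 by lra.
  have d0 : d ^+ 2 = 0 by lra.
  move/eqP: c0; rewrite sqrf_eq0 subr_eq0 => /eqP c0.
  by move/eqP: d0; rewrite sqrf_eq0 => /eqP d0; exact: complex_eq.
move: A B c d EA EB cd {AL BL kh chrh wh kxi kw} => A B c d EA EB cd.
have A0 : ((c - 1) ^+ 2 + d ^+ 2) * A = 0.
  transitivity ((c - 1) * (c * A - d * B - A) + d * (d * A + c * B - B)); first by ring.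
  by rewrite -EA -EB !subrr !mulr0 addr0.
have B0 : ((c - 1) ^+ 2 + d ^+ 2) * B = 0.
  transitivity ((c - 1) * (d * A + c * B - B) - d * (c * A - d * B - A)); first by ring.
  by rewrite -EA -EB !subrr !mulr0 subr0.
by split; [move/eqP: A0|move/eqP: B0]; rewrite mulf_eq0 (negbTE cd) => /eqP.
Qed.

Lemma fourierE f : cL1 f -> fourier mu f xi =
  Complex (Int (fun x => Re (chr x) * Re (f x)) - Int (fun x => Im (chr x) * Im (f x)))
          (Int (fun x => Im (chr x) * Re (f x)) + Int (fun x => Re (chr x) * Im (f x))).
Proof.
move=> [fr fi].
have tL t w : (forall x, `|t x| <= 1) -> measurable_fun [set: Bn] (t : Bn -> R) ->
    L1 w -> L1 (fun x => t x * w x).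
  by move=> t1 mt; apply: L1M => //; exists 1.
have r1 x : `|Re (chr x)| <= 1 by rewrite -(chr_modulus x) modulus_Re.
have i1 x : `|Im (chr x)| <= 1 by rewrite -(chr_modulus x) modulus_Im.
rewrite /fourier cintegralE.
rewrite -(IntB (tL _ _ r1 chr_measurableRe fr) (tL _ _ i1 chr_measurableIm fi)).
rewrite -(IntD (tL _ _ i1 chr_measurableIm fr) (tL _ _ r1 chr_measurableRe fi)).
congr Complex; apply: Int_eq => x; rewrite -/(chr x) ?ReM ?ImM; ring.
Qed.

End Character.

End ComplexIntegral.

(** * Injectivity of the Fourier transform *)

Section FourierInjectivity.
Local Opaque Int pcoset.
Variables (R : realType) (p : nat) (p_pr : prime p) (n : nat).
Local Notation Qp := (padic p_pr).
Local Notation Qpn := 'rV[Qp]_n.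
Local Notation Bn := (borel_Qpn p_pr n).
Variable mu : {measure set Bn -> \bar R}.
Hypothesis mu_haar : normalized_haar mu.
Local Notation L1 := (L1 mu).
Local Notation Int := (Int mu).
Local Notation cL1 := (cL1 mu).
Local Notation ind := (@ind R p p_pr n).
Local Notation Re := complex.Re.
Local Notation Im := complex.Im.
Local Notation freqs M := {ffun 'I_n -> 'I_(p ^ M)}.
Implicit Types (x y z h xi : Qpn) (k : int) (M N : nat) (f g : Qpn -> R[i]).

Lemma Int_dominated0 (F : nat -> Qpn -> R) (G D : Qpn -> R) :
  (forall N, L1 (F N)) -> L1 D -> L1 G ->
  (forall N x, `|F N x| <= D x) ->
  (forall x, \forall N \near \oo, F N x = G x) ->
  (forall N, Int (F N) = 0) -> Int G = 0.
Proof.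
move=> FL DL GL FD FG F0.
have [||_ _] := @dominated_convergence _ Bn R mu setT measurableT
  (fun N x => (F N x)%:E) (EFin \o (G : Bn -> R)) (EFin \o (D : Bn -> R))
  (fun N => measurable_int _ (FL N)) (measurable_int _ GL) _ DL.
- by apply: aeW => x _; apply: cvg_near_cst; apply: filterS (FG x) => N ->.
- by apply: aeW => x N _; rewrite lee_fin FD.
have -> : [sequence (\int[mu]_x (F N x)%:E)%E]_N = fun=> 0%E.
  by apply/funext => N /=; rewrite (IntE (FL N)) F0.
move=> h; suff : (\int[mu]_x (G x)%:E = 0)%E by rewrite (IntE GL) => -[].
exact: (cvg_unique (@ereal_hausdorff R) h (cvg_cst _)).
Qed.

(** A mean of character values that equals 1 on Z_p and, at a point outside Z_p, vanishes for all
    large M. *)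
Definition dirichlet_kernel M (t : Qp) : R[i] :=
  ((p ^ M)%N%:R)^-1 * \sum_(a < p ^ M) padic_char R (t * a%:R).

Let pM_neq0 M : (p ^ M)%N%:R != 0 :> R[i].
Proof. by rewrite pnatr_eq0 -lt0n expn_gt0 prime_gt0. Qed.

Lemma padic_char_norm (t : Qp) : `|padic_char R t| = 1.
Proof.
rewrite modulus_norm; congr (_%:C)%C; apply/eqP.
by rewrite -(@eqrXn2 _ 2) ?modulus_ge0 // modulus_sqr padic_char_sqr expr1n.
Qed.

Lemma dirichlet_kernel_le1 M t : `|dirichlet_kernel M t| <= 1.
Proof.
rewrite /dirichlet_kernel normrM normfV normr_nat.
rewrite ler_pdivrMl ?mulr1; last by rewrite lt_neqAle ler0n eq_sym pM_neq0.
apply: (le_trans (ler_norm_sum _ _ _)).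
under eq_bigr do rewrite padic_char_norm.
by rewrite sumr_const card_ord.
Qed.

Lemma dirichlet_kernel_in M t : pideal 0 t -> dirichlet_kernel M t = 1.
Proof.
move=> t0; rewrite /dirichlet_kernel.
under eq_bigr => a _.
  rewrite (_ : padic_char R _ = 1); last first.
    by apply/padic_char_eq1; rewrite -[0]addr0; apply: pidealM => //; exact: pideal_nat.
  over.
by rewrite sumr_const card_ord mulVf.
Qed.

Lemma dirichlet_kernel_out t : ~ pideal 0 t ->
  \forall M \near \oo, dirichlet_kernel M t = 0.
Proof.
move=> t0; have [k kt] := pideal_ex t.
exists `|k|%N => // M /= kM; rewrite /dirichlet_kernel padic_char_sum ?mulr0 //.
by apply: pideal_sub kt; lia.
Qed.

(* These combinations of characters tend to the indicator function of a coset and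
   are bounded by 1, so by dominated convergence a function whose Fourier transform
   vanishes has zero integral over every coset. *)
Definition coset_kernel x k M y : R[i] :=
  \prod_i dirichlet_kernel M (p%:R ^ (- k) * (y 0 i - x 0 i)).

Lemma coset_kernel_le1 x k M y : `|coset_kernel x k M y| <= 1.
Proof.
rewrite /coset_kernel; elim/big_ind: _ => [|u v u1 v1|i _].
- by rewrite normr1.
- by rewrite normrM mulr_ile1.
- exact: dirichlet_kernel_le1.
Qed.

Lemma coset_kernel_near x k y :
  \forall M \near \oo, coset_kernel x k M y = (ind x k y)%:C%C.
Proof.
have E i : pideal 0 (p%:R ^ (- k) * (y 0 i - x 0 i)) <-> pideal k (y 0 i - x 0 i).
  by rewrite -(addNr k); exact: pidealMpX.
have [xy|xy] := pselect (pcoset x k y).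
  apply: nearW => M; rewrite (indT R xy) /coset_kernel big1 // => i _.
  by apply: dirichlet_kernel_in; apply/E/xy.
have [i iP] : exists i, ~ pideal k (y 0 i - x 0 i) by exact/existsNP.
have /dirichlet_kernel_out : ~ pideal 0 (p%:R ^ (- k) * (y 0 i - x 0 i)).
  by move/E.
apply: filterS => M M0; rewrite (indF R xy) /coset_kernel.
by rewrite (bigD1 i) //= M0 mul0r.
Qed.

Definition freq k M (c : freqs M) : Qpn := p%:R ^ (- k) *: \row_i (c i)%:R.

(** Expanding the product of sums gives a finite combination of characters in y, whose integral
    against f involves only values of the Fourier transform of f. *)
Lemma coset_kernelE x k M y : coset_kernel x k M y =
  \sum_(c : freqs M) chr R (freq k c) y *
     (chr R (freq k c) (- x) * ((p ^ M)%N%:R)^-1 ^+ n).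
Proof.
rewrite /coset_kernel /dirichlet_kernel.
under eq_bigr do rewrite mulr_sumr.
rewrite bigA_distr_bigA; apply: eq_bigr => c _.
rewrite big_split /= prodr_const card_ord mulrC mulrA; congr (_ * _).
rewrite -chrD /chr.
have -> : dotp (y - x) (freq k c) =
    \sum_i (p%:R ^ (- k) * (y 0 i - x 0 i) * (c i)%:R).
  by apply: eq_bigr => i _; rewrite !mxE mulrCA mulrA.
apply/esym/big_morph; first exact: padic_charD.
exact/padic_char_eq1/pideal0.
Qed.

Lemma fourier0_coset f x k : cL1 f -> (forall xi, fourier mu f xi = 0) ->
  Int (fun y => ind x k y * Re (f y)) = 0 /\ Int (fun y => ind x k y * Im (f y)) = 0.
Proof.
move=> fL f0.
pose F M y := f y * coset_kernel x k M y.
have FE M : F M = fun y => \sum_(c : freqs M)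
    (f y * chr R (freq k c) y) * (chr R (freq k c) (- x) * ((p ^ M)%N%:R)^-1 ^+ n).
  apply/funext => y; rewrite /F coset_kernelE mulr_sumr.
  by apply: eq_bigr => c _; rewrite mulrA.
have [FL FI] : (forall M, cL1 (F M)) /\ (forall M, cintegral mu (F M) = 0).
  suff H M : cL1 (F M) /\ cintegral mu (F M) = 0 by split=> M; have [] := H M.
  have TL (c : freqs M) : cL1 (fun y => (f y * chr R (freq k c) y) *
      (chr R (freq k c) (- x) * ((p ^ M)%N%:R)^-1 ^+ n)).
    exact/cL1Zr/cL1_chr.
  rewrite FE; have [h1 h2] := cL1_cintegral_sum (index_enum (freqs M)) TL.
  split; first exact: h1.
  apply: (etrans h2); rewrite big1 // => c _.
  rewrite cintegralZr; last exact: cL1_chr.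
  by have := f0 (freq k c); rewrite /fourier -/(chr _ _ _) => ->; rewrite mul0r.
have DL : L1 (fun y => `|Re (f y)| + `|Im (f y)|).
  by case: fL => fr fi; apply: L1D; exact: L1_abs.
have FD M y : modulus (F M y) <= `|Re (f y)| + `|Im (f y)|.
  apply: le_trans (modulus_le _).
  rewrite /modulus /F Normc.normcM ler_piMr ?modulus_ge0 //.
  by have := coset_kernel_le1 x k M y; rewrite modulus_norm (lecR _ 1).
have FG y : \forall M \near \oo, F M y = f y * (ind x k y)%:C%C.
  by apply: filterS (coset_kernel_near x k y) => M; rewrite /F => ->.
split.
  apply: (@Int_dominated0 (fun M y => Re (F M y)) _ _ _ DL).
  - by move=> M; have [] := FL M.
  - by apply: L1_ind => //; case: fL.
  - by move=> M y; apply: le_trans (modulus_Re _) (FD _ _).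
  - move=> y; apply: filterS (FG y) => M ->.
    by rewrite ReM /= mulr0 subr0 mulrC.
  - by move=> M; have := FI M; rewrite cintegralE => -[].
apply: (@Int_dominated0 (fun M y => Im (F M y)) _ _ _ DL).
- by move=> M; have [] := FL M.
- by apply: L1_ind => //; case: fL.
- by move=> M y; apply: le_trans (modulus_Im _) (FD _ _).
- move=> y; apply: filterS (FG y) => M ->.
  by rewrite ImM /= mulr0 add0r mulrC.
- by move=> M; have := FI M; rewrite cintegralE => -[].
Qed.

Lemma avg_near k x (u : Qpn -> R) (e : R) : L1 u ->
  (forall y, pcoset x k y -> `|u y - u x| <= e) -> `|avg mu k u x - u x| <= e.
Proof.
move=> uL ue.
pose w y := ind x k y * (u y - u x).
have e0 : 0 <= e by have := ue x (pcoset_refl x k); rewrite subrr normr0.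
have wE y : w y = ind x k y * u y - u x * ind x k y by rewrite /w; ring.
have wL : L1 w.
  apply: (L1_eq (fun y => esym (wE y))).
  by apply: L1B; [exact: L1_ind|exact/L1Z/ind_L1].
have wI : Int w = pvol R p n k * (avg mu k u x - u x).
  rewrite (Int_eq mu wE) (IntB (L1_ind x k uL) (L1Z _ (ind_L1 mu_haar x k))).
  rewrite (IntZ _ (ind_L1 mu_haar x k)) (Int_ind mu_haar) /avg mulrBr.
  by rewrite mulVKf ?pvol_neq0 // [u x * _]mulrC.
have we : `|Int w| <= e * pvol R p n k.
  apply: (le_trans (Int_abs wL)).
  rewrite -(Int_ind mu_haar x k) -(IntZ e (ind_L1 mu_haar x k)).
  apply: Int_le => [||y]; [exact: L1_abs|exact/L1Z/ind_L1|].
  rewrite /w normrM (ger0_norm (ind_ge0 _ _ _ _)) mulrC.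
  have [xy|xy] := pselect (pcoset x k y).
    by rewrite (indT R xy) !mulr1 ue.
  by rewrite (indF R xy) !mulr0.
have pk : 0 < pvol R p n k by exact: pvol_gt0.
by move: we; rewrite wI normrM (gtr0_norm pk) [e * _]mulrC (ler_pM2l pk).
Qed.

(** The difference has zero average over every coset, and by continuity its averages over small
    cosets around x approximate its value at x. *)
Lemma fourier_inj f g :
  continuous (f : Qpn -> R[i]^o) -> continuous (g : Qpn -> R[i]^o) ->
  cL1 f -> cL1 g -> (forall xi, fourier mu f xi = fourier mu g xi) -> f = g.
Proof.
move=> fc gc fL gL fg; apply/funext => x; apply/eqP; rewrite -subr_eq0; apply/eqP.
pose h y := f y - g y; rewrite -/(h x).
have hL : cL1 h by exact: cL1B.
have h0 xi : fourier mu h xi = 0.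
  rewrite -(subrr (fourier mu f xi)) [in X in _ - X]fg /fourier.
  rewrite -(cintegralB (cL1_chr xi fL) (cL1_chr xi gL)); congr cintegral.
  by apply/funext => y; rewrite /h mulrBl.
have near_h (e : R) : 0 < e -> exists k, forall y, pcoset x k y -> modulus (h y - h x) <= e.
  move=> e0; have e2 : 0 < e / 2 by rewrite divr_gt0.
  have Hf := (cvg_complexP (nbhs_filter x) _ _).1 (fc x) _ e2.
  have Hg := (cvg_complexP (nbhs_filter x) _ _).1 (gc x) _ e2.
  have /nbhs_pcosetP[k kP] := @filterI _ (nbhs x) (nbhs_filter x) _ _ Hf Hg.
  exists k => y /kP[/= h1 h2].
  have -> : h y - h x = (f y - f x) + - (g y - g x) by rewrite /h; ring.
  have e2E : e = e / 2 + e / 2 by rewrite -splitr.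
  rewrite -lecR -modulus_norm e2E rmorphD /=.
  apply: (le_trans (ler_normD _ _)); rewrite normrN !modulus_norm.
  by apply: lerD; rewrite lecR ltW.
have small (e : R) : 0 < e -> `|Re (h x)| <= e /\ `|Im (h x)| <= e.
  move=> e0; have [k kP] := near_h e e0.
  have [hr hi] := fourier0_coset x k hL h0.
  have [hrL hiL] := hL.
  have ar : avg mu k (fun y => Re (h y)) x = 0 by rewrite /avg hr mulr0.
  have ai : avg mu k (fun y => Im (h y)) x = 0 by rewrite /avg hi mulr0.
  have Er := @avg_near k x _ e hrL; have Ei := @avg_near k x _ e hiL.
  rewrite ar sub0r normrN in Er; rewrite ai sub0r normrN in Ei.
  split; [apply: Er|apply: Ei] => y /kP; apply: le_trans.
    by rewrite -ReN -ReD modulus_Re.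
  by rewrite -ImN -ImD modulus_Im.
have zero (r : R) : (forall e, 0 < e -> `|r| <= e) -> r = 0.
  move=> H; apply/eqP; rewrite -normr_eq0 eq_le normr_ge0 andbT.
  by apply/ler_addgt0Pl => e e0; rewrite addr0 H.
by apply: complex_eq; apply: zero => e /small[].
Qed.

End FourierInjectivity.

(** * Identification of the normal derivative with D^s *)

Section Vladimirov.
Local Opaque Int pcoset avg phi.
Variables (R : realType) (p : nat) (p_pr : prime p) (n : nat).
Local Notation Qp := (padic p_pr).
Local Notation Qpn := 'rV[Qp]_n.
Local Notation Bn := (borel_Qpn p_pr n).
Variable mu : {measure set Bn -> \bar R}.
Hypothesis mu_haar : normalized_haar mu.
Variables (s : R) (s_gt0 : 0 < s).
Local Notation q := (p%:R `^ (- s) : R).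
Local Notation Re := complex.Re.
Local Notation Im := complex.Im.

Lemma q_gt0 : 0 < q. Proof. by rewrite powR_gt0 // ltr0n prime_gt0. Qed.

Lemma q_lt1 : q < 1.
Proof.
have p1 : (1 : R) < p%:R by rewrite ltr1n prime_gt1.
rewrite /powR gt_eqF ?ltr0n ?prime_gt0 //.
by rewrite expR_lt1 mulNr oppr_lt0 mulr_gt0 // ln_gt0.
Qed.

Lemma q_exp (k : int) : q ^ k = p%:R `^ (- (k%:~R * s)).
Proof.
by rewrite -powR_intmul ?powR_ge0 // -powRrM mulNr mulrC.
Qed.

Lemma lcst_continuous (f : Qpn -> R[i]) k : lcst k f -> continuous (f : Qpn -> R[i]^o).
Proof.
move=> kf x; have h : nbhs x [set y | f y = f x].
  by apply/nbhs_pcosetP; exists k => y xy; exact: kf.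
move=> U /nbhs_singleton Ufx.
apply: (@filterS _ (nbhs x) (nbhs_filter x) _ _ _ h) => y yx.
by move: Ufx; rewrite -[f x](yx : f y = f x).
Qed.

Variables (l : int) (M : R) (a b : Qpn -> R).
Hypotheses (ag : test_fun mu l M a) (bg : test_fun mu l M b).
Local Notation vlad := (vlad mu q l).

Lemma vlad_is_vladimirov : is_vladimirov mu s
  (fun x => Complex (a x) (b x)) (fun x => Complex (vlad a x) (vlad b x)).
Proof.
have q0 := q_gt0; have q1 := q_lt1.
have aL : L1 mu a by case: ag.
have bL : L1 mu b by case: bg.
have vaL : L1 mu (vlad a) by exact: (vlad_L1 mu_haar q0 q1 ag).
have vbL : L1 mu (vlad b) by exact: (vlad_L1 mu_haar q0 q1 bg).
have va : lcst l (vlad a) by exact: (vlad_lcst mu_haar q0 q1 ag).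
have vb : lcst l (vlad b) by exact: (vlad_lcst mu_haar q0 q1 bg).
split.
- by apply: (@lcst_continuous _ l) => x y xy; rewrite (va x y xy) (vb x y xy).
- exact: (conj vaL vbL).
move=> xi.
have fL : cL1 mu (fun x => Complex (a x) (b x)) := conj aL bL.
have gL : cL1 mu (fun x => Complex (vlad a x) (vlad b x)) := conj vaL vbL.
rewrite (fourierE xi fL) (fourierE xi gL).
set cR := fun x => Re (chr R xi x); set cI := fun x => Im (chr R xi x).
have r1 x : `|cR x| <= 1 by rewrite -(chr_modulus R xi x) modulus_Re.
have i1 x : `|cI x| <= 1 by rewrite -(chr_modulus R xi x) modulus_Im.
have mr := @chr_measurableRe R p p_pr n xi.
have mi := @chr_measurableIm R p p_pr n xi.
have alg (c A B C D A' B' C' D' : R) : A' = c * A -> B' = c * B -> C' = c * C ->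
    D' = c * D -> Complex (A' - D') (B' + C') = c%:C%C * Complex (A - D) (B + C).
  by move=> -> -> -> ->; apply: complex_eq; rewrite ?ReM ?ImM /=; ring.
suff [c [-> ra ia rb ib]] : exists c : R, [/\ vnorm R xi `^ s = c,
    Int mu (fun x => cR x * vlad a x) = c * Int mu (fun x => cR x * a x),
    Int mu (fun x => cI x * vlad a x) = c * Int mu (fun x => cI x * a x),
    Int mu (fun x => cR x * vlad b x) = c * Int mu (fun x => cR x * b x) &
    Int mu (fun x => cI x * vlad b x) = c * Int mu (fun x => cI x * b x)].
  exact: (alg _ _ _ _ _ _ _ _ _ ra ia rb ib).
have lc k : pcoset 0 (- k) xi -> lcst k cR /\ lcst k cI.
  by move=> /(chr_lcst R) h; split=> x y xy; rewrite /cR /cI (h x y xy).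
have [[v0 xi0]|[k [xik xik1 vk]]] := vnorm_cases R xi.
  (* At frequency zero the multiplier is 0^s = 0, as s > 0, and the character is constant. *)
  exists 0; rewrite v0 powR0 ?gt_eqF //.
  have lr k : lcst k cR by have [] := lc k (xi0 _).
  have li k : lcst k cI by have [] := lc k (xi0 _).
  split; rewrite ?mul0r //.
  - exact: (Int_mult_vlad0 mu_haar q0 q1 ag mr r1 lr).
  - exact: (Int_mult_vlad0 mu_haar q0 q1 ag mi i1 li).
  - exact: (Int_mult_vlad0 mu_haar q0 q1 bg mr r1 lr).
  - exact: (Int_mult_vlad0 mu_haar q0 q1 bg mi i1 li).
(* Here the norm of xi is p^-k: the character has level r = -k and kills all functions of level r -
   1, so the multiplier is q^-r = q^k = p^(-ks). *)
have [lr li] : lcst (- k) cR /\ lcst (- k) cI by apply: lc; rewrite opprK.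
have kill w : lcst (- k - 1) w -> L1 mu w ->
    Int mu (fun x => cR x * w x) = 0 /\ Int mu (fun x => cI x * w x) = 0.
  by apply: Int_chr_kill => //; rewrite opprB opprK addrC.
have killr w wk wL := (kill w wk wL).1.
have killi w wk wL := (kill w wk wL).2.
exists (q ^ k); rewrite vk -[X in q ^ X]opprK; split.
- rewrite opprK q_exp -powR_intmul // -powRrM; congr (_ `^ _).
  by rewrite mulrNz mulNr.
- exact: (Int_mult_vlad mu_haar q0 q1 ag mr r1 lr killr).
- exact: (Int_mult_vlad mu_haar q0 q1 ag mi i1 li killi).
- exact: (Int_mult_vlad mu_haar q0 q1 bg mr r1 lr killr).
- exact: (Int_mult_vlad mu_haar q0 q1 bg mi i1 li killi).
Qed.

(** The function chosen by [xget] and the explicit one are both continuous and integrable with the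
    same Fourier transform, so they coincide. *)
Lemma vladimirovE : vladimirov mu s (fun x => Complex (a x) (b x)) =
  fun x => Complex (vlad a x) (vlad b x).
Proof.
rewrite /vladimirov; case: xgetP => [g _ [gc gL gF]|/(_ _ vlad_is_vladimirov)//].
have [hc hL hF] := vlad_is_vladimirov.
by apply: (fourier_inj mu_haar gc hc gL hL) => xi; rewrite gF hF.
Qed.

End Vladimirov.

(** * Energy of the edges *)

Section LevelIntegral.
Local Opaque pcoset.
Variables (R : realType) (p : nat) (p_pr : prime p) (n : nat).
Local Notation Qp := (padic p_pr).
Local Notation Qpn := 'rV[Qp]_n.
Local Notation Bn := (borel_Qpn p_pr n).
Local Notation vertex := (vertex p_pr n).
Local Notation digits := {ffun 'I_n -> 'I_p}.
Variable mu : {measure set Bn -> \bar R}.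
Hypothesis mu_haar : normalized_haar mu.
Implicit Types (x y z : Qpn) (k : int) (u v : vertex).

Lemma integral_levels k (g : Qpn -> R) : lcst k g -> (forall x, 0 <= g x) ->
  (\int[mu]_x (g x)%:E =
   \esum_(v in [set v : vertex | vlevel v = k]) (pvol R p n k * g (vrep v))%:E)%E.
Proof.
move=> kg g0; have [c cP] := pcoset_dense p_pr n.
(* Several centres may name the same coset; P keeps the first index of each, which turns the cover
   into a countable partition. *)
pose P : set nat := [set i | forall j, (j < i)%N -> ~ pcoset (c j) k (c i)].
pose F (i : nat) : set Bn := if i \in P then pcoset (c i) k else set0.
have FT : \bigcup_i F i = setT.
  apply/seteqP; split=> // x _.
  have exi : exists i, `[< pcoset (c i) k x >].
    by have [i ix] := cP x k; exists i; apply/asboolP.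
  exists (ex_minn exi) => //; case: ex_minnP => i /asboolP ix imin.
  rewrite /F mem_set // => j ji jci.
  have := imin j; rewrite leqNgt ji => /(_ _)/negP; apply=> //.
  by apply/asboolP; exact: pcoset_trans ix.
have Ftriv : trivIset [set: nat] F.
  move=> i j _ _ [x []]; rewrite /F.
  case: ifP => // /set_mem Pi ix; case: ifP => // /set_mem Pj jx.
  have [ij|ji|//] := ltngtP i j.
    by case: (Pj i ij); exact: pcoset_trans (pcoset_sym jx).
  by case: (Pi j ji); exact: pcoset_trans (pcoset_sym ix).
have Fm i : measurable (F i).
  by rewrite /F; case: ifP => _ //; exact: measurable_pcoset.
have mg : measurable_fun [set: Bn] ((fun x => (g x)%:E) : Bn -> \bar R).
  by apply/measurable_EFinP; exact: lcst_measurable kg.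
have -> : [set v : vertex | vlevel v = k] = [set vtx (c i) k | i in P].
  apply/seteqP; split=> [v /= vk|_ [i _ <-] //].
  have exi : exists i, `[< pcoset (c i) k (vrep v) >].
    by have [i ix] := cP (vrep v) k; exists i; apply/asboolP.
  exists (ex_minn exi); case: ex_minnP => i /asboolP ix imin; last first.
    by rewrite [RHS]vrepE vk; apply/vtx_eqP.
  move=> j ji jci; have := imin j; rewrite leqNgt ji => /(_ _)/negP; apply=> //.
  by apply/asboolP; exact: pcoset_trans ix.
rewrite esum_set_image; last 2 first.
- by move=> i _; rewrite lee_fin mulr_ge0 // ltW // pvol_gt0.
- move=> i j /set_mem Pi /set_mem Pj /vtx_eqP[_ ij].
  have [lij|lji|//] := ltngtP i j; first by case: (Pj i lij).
  by case: (Pi j lji); exact: pcoset_sym.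
rewrite -FT ge0_integral_bigcup //=; last 2 first.
- by rewrite FT.
- by move=> x _; rewrite lee_fin.
rewrite [RHS]eseries_mkcond; apply: eq_eseriesr => i _.
rewrite /F; case: ifP => // _; last by rewrite integral_set0.
rewrite (eq_integral (cst (g (c i))%:E)); last first.
  by move=> x /set_mem ix /=; rewrite (kg _ _ ix).
rewrite integral_cst; last exact: measurable_pcoset.
rewrite [LHS]muleC haar_pcoset // -EFinM; congr ((_ * _)%:E).
by apply/esym/kg; exact: vrep_vtx.
Qed.

Variables (s : R) (phi : vertex -> R[i]).

Definition vparent v := vtx (vrep v) (vlevel v - 1).
Definition vchild v (a : digits) := vtx (child (vrep v) (vlevel v) a) (vlevel v + 1).
(** Every edge is attributed to its lower vertex, whose level is the larger one and determines the
    weight. *)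
Definition edge_energy v : R :=
  p%:R `^ ((vlevel v)%:~R * (s - n%:R)) * modulus (phi v - phi (vparent v)) ^+ 2.

Lemma edge_energy_ge0 v : 0 <= edge_energy v.
Proof. by rewrite mulr_ge0 ?powR_ge0 ?sqr_ge0. Qed.

Lemma vparent_vtx x k : vparent (vtx x k) = vtx x (k - 1).
Proof.
apply/vtx_eqP; split=> //; apply: pcoset_le (pcoset_sym (vrep_vtx x k)) => /=; lia.
Qed.

Lemma vparent_vchild v a : vparent (vchild v a) = v.
Proof.
rewrite /vchild vparent_vtx [RHS]vrepE; apply/vtx_eqP; rewrite addrK; split=> //.
exact/pcoset_sym/child_pcoset.
Qed.

Lemma vchild_ex v : exists a, vchild (vparent v) a = v.
Proof.
elim/vtxW: v => x k; rewrite vparent_vtx.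
set w := vtx x (k - 1); have wx : pcoset (vrep w) (k - 1) x.
  exact: (pcoset_sym (vrep_vtx x (k - 1))).
have [a ax] := child_ex wx; exists a; apply/vtx_eqP => /=.
by move: ax; rewrite !subrK.
Qed.

Lemma weight_vparent v :
  weight s v (vparent v) = p%:R `^ ((vlevel v)%:~R * (s - n%:R)).
Proof.
rewrite /weight; have -> // : Num.max (vlevel v) (vlevel (vparent v)) = vlevel v.
by rewrite /=; lia.
Qed.

Lemma weight_vchild v a :
  weight s v (vchild v a) = p%:R `^ ((vlevel (vchild v a))%:~R * (s - n%:R)).
Proof.
rewrite /weight.
have -> // : Num.max (vlevel v) (vlevel (vchild v a)) = vlevel (vchild v a).
by rewrite /=; lia.
Qed.

Lemma edge_sum v :
  (\sum_(u \in [set u | adj u v]) weight s v u * (modulus (phi v - phi u)) ^+ 2)%R =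
  edge_energy v + \sum_a edge_energy (vchild v a).
Proof.
rewrite {1}(vrepE v) fsbig_adj -/(vparent v) weight_vparent -/(edge_energy v).
congr (_ + _); apply: eq_bigr => a _.
rewrite -/(vchild v a) /edge_energy vparent_vchild weight_vchild.
by rewrite -[modulus (phi v - _)]modulusN opprB.
Qed.

(** Pairs (vertex, digit) correspond bijectively to vertices through [vchild], since each vertex is
    the child of exactly one parent. *)
Lemma esum_children :
  (\esum_(v in [set: vertex]) (\sum_a edge_energy (vchild v a))%:E =
   \esum_(v in [set: vertex]) (edge_energy v)%:E)%E.
Proof.
have e0 v : (0 <= (edge_energy v)%:E)%E by rewrite lee_fin edge_energy_ge0.
transitivity (\esum_(v in [set: vertex]) \esum_(a in [set: digits])
    (edge_energy (vchild v a))%:E)%E.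
  apply: eq_esum => v _; rewrite esum_fset //; last exact: finite_finset.
  rewrite -sumEFin; have -> : [set: digits] = [set` enum {: digits}].
    by apply/seteqP; split=> a //= _; rewrite mem_enum.
  by rewrite -fsbig_seq ?enum_uniq // big_enum.
rewrite esum_esum //.
apply/esym; apply: (reindex_esum ([set: vertex] `*`` (fun=> [set: digits])) setT
  (fun va => vchild va.1 va.2)).
split=> [//|[v a] [w b] _ _ /= E|v _].
  have vw : v = w by rewrite -(vparent_vchild v a) E vparent_vchild.
  subst w; congr (_, _); exact: (vtx_child_inj E).
by have [a <-] := vchild_ex v; exists (vparent v, a).
Qed.

(** Each edge is seen once from either end, which the factor 1/2 compensates. *)
Lemma energy_edgesE : energy_edges s phi = (\esum_(v in [set: vertex]) (edge_energy v)%:E)%E.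
Proof.
have e0 v : (0 <= (edge_energy v)%:E)%E by rewrite lee_fin edge_energy_ge0.
rewrite /energy_edges.
under eq_esum do rewrite edge_sum EFinD.
rewrite esumD //; last first.
  by move=> v _; rewrite lee_fin sumr_ge0 // => a _; exact: edge_energy_ge0.
rewrite esum_children; set E := esum _ _.
have E0 : (0 <= E)%E by exact: esum_ge0.
rewrite ge0_muleDr // -ge0_muleDl ?lee_fin ?invr_ge0 // -EFinD.
by rewrite (_ : 2^-1 + 2^-1 = 1) ?mul1e //; lra.
Qed.

Lemma energy_levelsE : energy_levels mu s phi = energy_edges s phi.
Proof.
have e0 v : (0 <= (edge_energy v)%:E)%E by rewrite lee_fin edge_energy_ge0.
rewrite energy_edgesE.
have -> : (\esum_(v in [set: vertex]) (edge_energy v)%:E =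
    \esum_(k in [set: int]) \esum_(v in [set v : vertex | vlevel v = k])
      (edge_energy v)%:E)%E.
  rewrite esum_esum //.
  rewrite [RHS](reindex_esum setT ([set: int] `*`` (fun k => [set v | vlevel v = k]))
    (fun v : vertex => (vlevel v, v))) //.
  split=> [v _ //|v w _ _ [] //|[k v] [_ /= <-]]; by exists v.
apply: eq_esum => k _.
pose g x := modulus (phi (vtx x k) - phi (vtx x (k - 1))) ^+ 2.
have kg : lcst k g.
  move=> x y xy; rewrite /g.
  have -> : vtx y k = vtx x k by apply/vtx_eqP; split=> //; exact: pcoset_sym.
  have -> // : vtx y (k - 1) = vtx x (k - 1).
  by apply/vtx_eqP; split=> //; apply: pcoset_le (pcoset_sym xy); lia.
have g0 x : 0 <= g x by exact: sqr_ge0.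
have -> : sqnorm2 mu (fun x => phi (vtx x k) - phi (vtx x (k - 1))) =
  (\int[mu]_x (g x)%:E)%E by [].
have gm : measurable_fun [set: Bn] ((fun x => (g x)%:E) : Bn -> \bar R).
  by apply/measurable_EFinP; exact: lcst_measurable kg.
rewrite -ge0_integralZl_EFin ?powR_ge0 //; last by move=> x _; rewrite lee_fin.
pose c : R := p%:R `^ (k%:~R * s).
have ckg : lcst k (fun x => c * g x) by move=> x y xy; rewrite (kg x y xy).
have cg0 x : 0 <= c * g x by rewrite mulr_ge0 ?powR_ge0.
have := integral_levels ckg cg0.
under eq_integral do rewrite EFinM.
move=> ->; apply: eq_esum => v /= vk; congr EFin.
(* The edge weight is p^(ks) times the volume p^(-kn) of a coset: this is how a sum over edges
   becomes an integral over a level. *)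
have pk : p%:R `^ (k%:~R * (s - n%:R)) = c * pvol R p n k.
  have p0 : (p%:R : R) != 0 by rewrite pnatr_eq0 -lt0n prime_gt0.
  rewrite mulrBr powRB; last by rewrite p0 implybT.
  congr (_ * _); rewrite -powRN /pvol -powR_intmul ?ler0n // natrX.
  rewrite -powR_mulrn ?ler0n // -powRrM; congr (_ `^ _).
  by rewrite mulrNz mulrN mulrC.
rewrite /edge_energy vk pk -mulrA mulrCA; congr (_ * (_ * _)).
by rewrite /g /vparent -vk -vrepE.
Qed.

End LevelIntegral.

(** * Uniqueness *)

Section Uniqueness.
Variables (R : realType) (p : nat) (p_pr : prime p) (n : nat).
Local Notation Qp := (padic p_pr).
Local Notation Qpn := 'rV[Qp]_n.
Local Notation vertex := (vertex p_pr n).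
Variable s : R.
Implicit Types (x y : Qpn) (k : int) (v : vertex).

Definition wt k : R := p%:R `^ (k%:~R * (s - n%:R)).

Lemma wt_gt0 k : 0 < wt k.
Proof. by rewrite powR_gt0 // ltr0n prime_gt0. Qed.

Lemma laplacianE (phi : vertex -> R[i]) x k : laplacian s phi (vtx x k) =
  (wt k)%:C%C * (phi (vtx x (k - 1)) - phi (vtx x k)) +
  (wt (k + 1))%:C%C * \sum_a (phi (vtx (child x k a) (k + 1)) - phi (vtx x k)).
Proof.
rewrite /laplacian fsbig_adj mulr_sumr /wt; congr (_ + _).
  rewrite /weight; have -> // : Num.max (vlevel (vtx x (k - 1))) (vlevel (vtx x k)) = k.
  by rewrite /=; lia.
apply: eq_bigr => a _; rewrite /weight.
have -> // : Num.max (vlevel (vtx (child x k a) (k + 1))) (vlevel (vtx x k)) = k + 1.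
by rewrite /=; lia.
Qed.

Hypothesis n_gt0 : (0 < n)%N.
(* L is the real or the imaginary part. *)
Variable L : R[i] -> R.
Hypothesis LD : forall z w, L (z + w) = L z + L w.
Hypothesis LZ : forall (c : R) z, L (c%:C%C * z) = c * L z.
Hypothesis L_le : forall z, L z <= modulus z.

Let L0 : L 0 = 0. Proof. by have := LZ 0 0; rewrite !mul0r. Qed.

Let LB z w : L (z - w) = L z - L w.
Proof. by have := LZ (-1) w; rewrite LD rmorphN1 !mulN1r => ->. Qed.

Let Lsum (I : Type) (r : seq I) (F : I -> R[i]) :
  L (\sum_(i <- r) F i) = \sum_(i <- r) L (F i).
Proof. exact: (big_morph L LD L0). Qed.

(** The maximum principle gives a one-sided bound; exchanging the solutions gives the other. The
    condition at infinity is used along the upward rays (x, -m), which converge to that end. *)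
Lemma dirichlet_le f (phi1 phi2 : vertex -> R[i]) :
  dirichlet_solution s f phi1 -> dirichlet_solution s f phi2 ->
  forall v, L (phi1 v - phi2 v) <= 0.
Proof.
move=> [h1 e1 i1] [h2 e2 i2].
apply: (max_principle (w1 := wt) (w2 := fun k => wt (k + 1))).
- exact: prime_gt0.
- exact: wt_gt0.
- by move=> k; exact: wt_gt0.
- move=> x k; have := h1 (vtx x k); have := h2 (vtx x k); rewrite !laplacianE.
  move=> /(congr1 L) H2 /(congr1 L) H1.
  have alg (X A B : R) : A = 0 -> B = 0 -> X = A - B -> X = 0.
    by move=> -> -> ->; exact: subrr.
  rewrite !LD !LZ !LB !Lsum L0 in H1 H2; apply: (alg _ _ _ H1 H2).
  rewrite !LB; have alg' (w w' a b c d S S1 S2 : R) : S = S1 - S2 ->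
    w * ((a - c) - (b - d)) + w' * S =
    (w * (a - b) + w' * S1) - (w * (c - d) + w' * S2) by move=> ->; ring.
  apply: alg'; rewrite -sumrB; apply: eq_bigr => a _; rewrite !LB; ring.
- move=> x e e0; have e2' : 0 < e / 2 by rewrite divr_gt0.
  have [N1 _ H1] := (cvg_complexP _ _ _).1 (e1 x) _ e2'.
  have [N2 _ H2] := (cvg_complexP _ _ _).1 (e2 x) _ e2'.
  exists (maxn N1 N2) => m; rewrite geq_max => /andP[/H1 /= a1 /H2 /= a2].
  have -> : phi1 (vtx x m) - phi2 (vtx x m) =
    (phi1 (vtx x m) - f x) - (phi2 (vtx x m) - f x) by ring.
  rewrite LB [e]splitr; apply: ltrD; first exact: le_lt_trans (L_le _) a1.
  rewrite -mulN1r -LZ; apply: le_lt_trans (L_le _) _.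
  by rewrite rmorphN1 mulN1r modulusN.
- move=> x e e0; have e2' : 0 < e / 2 by rewrite divr_gt0.
  have [N1 _ H1] := (cvg_complexP _ _ _).1 (i1 _ (cvg_CInfty x n_gt0)) _ e2'.
  have [N2 _ H2] := (cvg_complexP _ _ _).1 (i2 _ (cvg_CInfty x n_gt0)) _ e2'.
  exists (maxn N1 N2) => m; rewrite geq_max => /andP[/H1 /= a1 /H2 /= a2].
  move: a1 a2; rewrite !subr0 => a1 a2.
  rewrite LB [e]splitr; apply: ltrD; first exact: le_lt_trans (L_le _) a1.
  rewrite -mulN1r -LZ; apply: le_lt_trans (L_le _) _.
  by rewrite rmorphN1 mulN1r modulusN.
Qed.

End Uniqueness.

Lemma dirichlet_solution_unique (R : realType) (p : nat) (p_pr : prime p) (n : nat)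
    (s : R) (f : 'rV[padic p_pr]_n -> R[i]) (phi1 phi2 : vertex p_pr n -> R[i]) :
  (0 < n)%N -> dirichlet_solution s f phi1 -> dirichlet_solution s f phi2 ->
  phi1 = phi2.
Proof.
move=> n0 s1 s2; apply/funext => v.
have ReZ (c : R) z : complex.Re (c%:C%C * z) = c * complex.Re z.
  by rewrite ReM /= mul0r subr0.
have ImZ (c : R) z : complex.Im (c%:C%C * z) = c * complex.Im z.
  by rewrite ImM /= mul0r addr0.
have Re_le (z : R[i]) : complex.Re z <= modulus z.
  exact: le_trans (ler_norm _) (modulus_Re _).
have Im_le (z : R[i]) : complex.Im z <= modulus z.
  exact: le_trans (ler_norm _) (modulus_Im _).
have r12 := dirichlet_le n0 (@ReD R) ReZ Re_le s1 s2 v.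
have r21 := dirichlet_le n0 (@ReD R) ReZ Re_le s2 s1 v.
have i12 := dirichlet_le n0 (@ImD R) ImZ Im_le s1 s2 v.
have i21 := dirichlet_le n0 (@ImD R) ImZ Im_le s2 s1 v.
move: r12 r21 i12 i21; rewrite !ReD !ReN !ImD !ImN !subr_le0 => r12 r21 i12 i21.
by apply: complex_eq; apply/eqP; rewrite eq_le ?r12 ?r21 ?i12 ?i21.
Qed.

(** * Boundary behaviour and energy *)

Lemma sum_children (R : realType) (p : nat) (p_pr : prime p) (n : nat)
    (k : int) (v : 'rV[padic p_pr]_n -> R) x (c : R) :
  \sum_a (v (child x k a) - c) = (p ^ n)%N%:R * (cmean k v x - c).
Proof.
have N0 : (p ^ n)%N%:R != 0 :> R by rewrite pnatr_eq0 -lt0n expn_gt0 prime_gt0.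
rewrite sumrB sumr_const cardT -cardE card_digits mulrBr /cmean mulVKf //.
by rewrite mulr_natl.
Qed.

Section DirichletSolution.
Local Opaque Int avg cmean phi pcoset.
Variables (R : realType) (p : nat) (p_pr : prime p) (n : nat).
Local Notation Qp := (padic p_pr).
Local Notation Qpn := 'rV[Qp]_n.
Local Notation Bn := (borel_Qpn p_pr n).
Local Notation vertex := (vertex p_pr n).
Variable mu : {measure set Bn -> \bar R}.
Hypothesis mu_haar : normalized_haar mu.
Variables (s : R) (s_gt0 : 0 < s).
Local Notation q := (p%:R `^ (- s) : R).
Local Notation Re := complex.Re.
Local Notation Im := complex.Im.
Local Notation Int := (Int mu).
Local Notation phi := (phi mu q).
Implicit Types (x y z : Qpn) (k : int) (v : vertex) (u : Qpn -> R).

Let q0 : 0 < q. Proof. exact: q_gt0. Qed.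
Let q1 : q < 1. Proof. exact: q_lt1. Qed.

(** The exponents (k + 1)(s - n) + n - s and k(s - n) agree: the choice of edge weights matches the
    ratio q = p^-s, which makes [phi] harmonic. *)
Lemma wt_step k : wt p n s (k + 1) * (p ^ n)%N%:R * q = wt p n s k.
Proof.
have p0 : (p%:R : R) != 0 by rewrite pnatr_eq0 -lt0n prime_gt0.
rewrite /wt natrX -powR_mulrn ?ler0n // -!powRD ?p0 ?implybT //.
by congr (_ `^ _); rewrite intrD; ring.
Qed.

Variables (l m : int) (M : R).
Local Notation vlad := (vlad mu q l).

Lemma phi_balance u k x : test_fun mu l M u ->
  wt p n s k * (phi u (k - 1) x - phi u k x) +
  wt p n s (k + 1) * \sum_a (phi u (k + 1) (child x k a) - phi u k x) = 0.
Proof.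
move=> [lu uL uM].
have H := phi_harmonic mu_haar q0 q1 uL uM k x.
have E := phi_rec mu_haar q0 q1 uL uM k x.
have alg (A f0 f1 c N w : R) : f1 = (1 - q) * A + q * f0 ->
    c = (1 - q) * A + q * f1 ->
    w * N * q * (f0 - f1) + w * (N * (c - f1)) = 0.
  by move=> -> ->; ring.
by rewrite sum_children -(wt_step k); exact: alg E H.
Qed.

Variables a b : Qpn -> R.
Hypotheses (ag : test_fun mu l M a) (bg : test_fun mu l M b).
Hypotheses (a0 : forall x, ~ pcoset 0 m x -> a x = 0).
Hypotheses (b0 : forall x, ~ pcoset 0 m x -> b x = 0).

Definition sol v : R[i] :=
  Complex (phi a (vlevel v) (vrep v)) (phi b (vlevel v) (vrep v)).
Local Notation f x := (Complex (a x) (b x)).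
Local Notation g x := (Complex (vlad a x) (vlad b x)).

Lemma sol_vtx x k : sol (vtx x k) = Complex (phi a k x) (phi b k x).
Proof.
have [la _ _] := phi_test_fun mu_haar q0 q1 ag k.
have [lb _ _] := phi_test_fun mu_haar q0 q1 bg k.
by rewrite /sol /= (la _ _ (vrep_vtx x k)) (lb _ _ (vrep_vtx x k)).
Qed.

Lemma sol_harmonic v : laplacian s sol v = 0.
Proof.
move: v; apply: vtxW => x k; rewrite laplacianE !sol_vtx.
have Ha := phi_balance k x ag; have Hb := phi_balance k x bg.
apply: complex_eq.
- rewrite ReD !ReM /= !mul0r !subr0; apply: etrans Ha.
  rewrite (big_morph (@complex.Re R) (@ReD R) (erefl : complex.Re (0 : R[i]) = 0)).
  by congr (_ + _ * _); apply: eq_bigr => c _; rewrite sol_vtx ReD ReN; exact: erefl.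
- rewrite ImD !ImM /= !mul0r !addr0; apply: etrans Hb.
  rewrite (big_morph (@complex.Im R) (@ImD R) (erefl : complex.Im (0 : R[i]) = 0)).
  by congr (_ + _ * _); apply: eq_bigr => c _; rewrite sol_vtx ImD ImN; exact: erefl.
Qed.

Lemma sol_bound v : modulus (sol v) <= M + M.
Proof.
move: v; apply: vtxW => x k; rewrite sol_vtx.
have [_ _ Ma] := phi_test_fun mu_haar q0 q1 ag k.
have [_ _ Mb] := phi_test_fun mu_haar q0 q1 bg k.
apply: le_trans (modulus_le _) _; apply: lerD; [exact: Ma|exact: Mb].
Qed.

Lemma sol_error x k : l <= k -> sol (vtx x k) - f x = - ((q ^ (k + 1))%:C%C * g x).
Proof.
move=> lk; rewrite sol_vtx.
rewrite (phi_vlad mu_haar q0 q1 ag _ lk) (phi_vlad mu_haar q0 q1 bg _ lk).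
move: (vlad a x) (vlad b x) (a x) (b x) => va vb ax bx.
by apply: complex_eq; rewrite ?(ReD, ImD) ?(ReN, ImN) ?(ReM, ImM) /=; ring.
Qed.

Lemma vlad_bounded : exists2 C : R, 0 < C & forall x, modulus (g x) <= C.
Proof.
have /bddP[A [A0 Aa]] := vlad_bdd mu_haar q0 q1 ag.
have /bddP[B [B0 Bb]] := vlad_bdd mu_haar q0 q1 bg.
exists (A + B); first exact: addr_gt0.
move=> x; apply: le_trans (modulus_le _) _; apply: lerD; [exact: Aa|exact: Bb].
Qed.

(** From level l on the error is q^(j+1) times a single bounded function. Requiring in addition j >=
    N makes j a natural number. *)
Lemma sol_uniform (e : R) : 0 < e -> exists k : int, l <= k /\
  forall (j : int) x, k <= j -> modulus (sol (vtx x j) - f x) < e.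
Proof.
move=> e0; have [C C0 gC] := vlad_bounded.
have eC : 0 < e / C by rewrite divr_gt0.
have /cvgrPdist_lt /(_ _ eC)[N _ qN] : q ^+ i @[i --> \oo] --> (0 : R).
  by apply: cvg_expr; rewrite ger0_norm // ltW.
exists (Num.max l N%:Z); split; first by rewrite le_max lexx.
move=> j x; rewrite ge_max => /andP[lj Nj].
rewrite sol_error // modulusN modulusZ; last exact/exprz_ge0/ltW.
apply: le_lt_trans (_ : q ^ (j + 1) * C < e).
  by apply: ler_wpM2l (gC x); exact/exprz_ge0/ltW.
rewrite -ltr_pdivlMr //; case: j lj Nj => // j _ Nj.
have := qN j.+1; rewrite /= sub0r normrN ger0_norm ?exprn_ge0 ?(ltW q0) //.
by rewrite (_ : Posz j + 1 = j.+1) ?addn1; [apply; lia|lia].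
Qed.

Lemma pvolV_cvg0 (C e : R) : (0 < n)%N -> 0 < e -> exists2 k : int, k <= m & (pvol R p n k)^-1 * C < e.
Proof.
move=> n_gt0 e0; have D0 : 0 < `|C| + 1 by rewrite ltr_pwDr.
have eC : 0 < e / (`|C| + 1) by rewrite divr_gt0.
have N1 : 1 < (p ^ n)%N%:R :> R.
  by rewrite ltr1n -(exp1n n) ltn_exp2r // prime_gt1.
have N0 : 0 < (p ^ n)%N%:R :> R by exact: lt_trans N1.
have /cvgrPdist_lt /(_ _ eC)[i _ iN] :
    ((p ^ n)%N%:R^-1 : R) ^+ i @[i --> \oo] --> (0 : R).
  by apply: cvg_expr; rewrite ger0_norm ?invr_ge0 ?invf_lt1 // ltW.
(* Subtracting |m| keeps the level at most m while the inverse volume p^(nk) is already small. *)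
exists (- (i + `|m|)%N%:Z); first by lia.
have {iN} := iN (i + `|m|)%N (leq_addr _ _).
rewrite /= sub0r normrN ger0_norm ?exprn_ge0 ?invr_ge0 ?(ltW N0) // => iN.
rewrite /pvol opprK -exprnP -exprVn; move: iN; rewrite ltr_pdivlMr //.
apply: le_lt_trans; apply: ler_wpM2l; first by rewrite exprn_ge0 // invr_ge0 ltW.
by rewrite (le_trans (ler_norm C)) // lerDl.
Qed.

Lemma sol_continuous : (0 < n)%N ->
  continuous (with_boundary (fun x => f x) sol : compactified p_pr n -> R[i]^o).
Proof.
move=> n_gt0.
have [[la aL aM] [lb bL bM]] := (ag, bg).
apply: with_boundary_continuous => // [x e e0|e e0].
  have [k [lk kP]] := sol_uniform e0.
  exists k => y xy; have xy' := pcoset_le lk xy.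
  have ya := la _ _ xy'; have yb := lb _ _ xy'; rewrite ya yb.
  split=> [|j kj]; first by rewrite subrr modulus0.
  by have := kP j y kj; rewrite ya yb.
have [k km kC] := pvolV_cvg0 (Int (fun x => `|a x|) + Int (fun x => `|b x|)) n_gt0 e0.
exists k; split=> [y yk|y j yj].
  have ym : ~ pcoset 0 m y by move=> /(pcoset_le km).
  have -> : f y = 0 by apply: complex_eq; [exact: a0|exact: b0].
  by rewrite modulus0.
rewrite sol_vtx; apply: le_lt_trans kC.
apply: le_trans (modulus_le _) _; rewrite mulrDr; apply: lerD.
- exact: (phi_infty q0 q1 aL aM a0 km yj).
- exact: (phi_infty q0 q1 bL bM b0 km yj).
Qed.

Lemma sol_uniform_nat (e : R) : 0 < e ->
  \forall k \near \oo, forall x, modulus (sol (vtx x k%:Z) - f x) < e.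
Proof.
move=> e0; have [k [_ kP]] := sol_uniform e0.
by exists `|k|%N => // i /= ki x; apply: kP; lia.
Qed.

Lemma sol_solution : (0 < n)%N -> bounded_continuous_solution s (fun x => f x) sol.
Proof.
move=> n_gt0; split; [split|by exists (M + M) => v; exact: sol_bound|exact: sol_continuous].
- exact: sol_harmonic.
- move=> x; apply/cvg_complexP => e /sol_uniform_nat.
  by apply: filterS => i /(_ x).
(* The limit along sequences of vertices is the continuity of the extended function at the end at
   infinity. *)
- by move=> u uoo; have := cvg_comp _ _ uoo (sol_continuous n_gt0 (x := @CInfty p p_pr n)).
Qed.

Lemma sol_unique : (0 < n)%N -> unique (bounded_continuous_solution s (fun x => f x)) sol.
Proof.
move=> n_gt0; split=> [|phi' [phi'P _ _]]; first exact: sol_solution.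
by case: (sol_solution n_gt0) => solP _ _; exact: dirichlet_solution_unique solP phi'P.
Qed.

Local Notation L1 := (L1 mu).

Lemma level_L1M k (u v : Qpn -> R) : lcst k u -> bdd u -> L1 v -> L1 (fun x => u x * v x).
Proof. by move=> uk ub vL; apply: L1M => //; exact: lcst_measurable uk. Qed.

Lemma sqnorm2E (u v : Qpn -> R) :
  L1 (fun x => u x * u x) -> L1 (fun x => v x * v x) ->
  sqnorm2 mu (fun x => Complex (u x) (v x)) =
  (Int (fun x => u x * u x) + Int (fun x => v x * v x))%:E.
Proof.
move=> uL vL; rewrite -(IntD uL vL) -IntE; last exact: L1D.
by apply: eq_integral => x _; rewrite modulus_sqr /= !expr2.
Qed.

Lemma level_inL2 k (u v : Qpn -> R) : lcst k u -> bdd u -> L1 u ->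
  lcst k v -> bdd v -> L1 v -> inL2 mu (fun x => Complex (u x) (v x)).
Proof.
move=> uk ub uL vk vb vL; split; first split.
- exact: lcst_measurable uk.
- exact: lcst_measurable vk.
- by rewrite sqnorm2E ?ltry //; [exact: level_L1M uk ub uL|exact: level_L1M vk vb vL].
Qed.

Lemma sol_inL2 k : inL2 mu (fun x => sol (vtx x k)).
Proof.
have [ka aL aM] := phi_test_fun mu_haar q0 q1 ag k.
have [kb bL bM] := phi_test_fun mu_haar q0 q1 bg k.
under eq_fun do rewrite sol_vtx.
by apply: level_inL2 ka _ aL kb _ bL; exists M.
Qed.

Lemma boundary_inL2 : inL2 mu (fun x => f x).
Proof.
have [[la aL aM] [lb bL bM]] := (ag, bg).
by apply: level_inL2 la _ aL lb _ bL; exists M.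
Qed.

Lemma vlad_inL2 : inL2 mu (fun x => g x).
Proof.
have la := vlad_lcst mu_haar q0 q1 ag; have lb := vlad_lcst mu_haar q0 q1 bg.
exact: (level_inL2 la (vlad_bdd mu_haar q0 q1 ag) (vlad_L1 mu_haar q0 q1 ag)
                   lb (vlad_bdd mu_haar q0 q1 bg) (vlad_L1 mu_haar q0 q1 bg)).
Qed.

(** By [sol_error] the squared norm at level k >= l is q^(2(k+1)) times that of the normal
    derivative. *)
Lemma sol_cvgL2 : cvgL2 mu (fun (k : nat) x => sol (vtx x k%:Z)) (fun x => f x).
Proof.
split=> [k||]; [exact: sol_inL2|exact: boundary_inL2|].
pose G := Int (fun x => vlad a x * vlad a x) + Int (fun x => vlad b x * vlad b x).
have LL u : test_fun mu l M u -> L1 (fun x => vlad u x * vlad u x).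
  move=> ug; have lu := vlad_lcst mu_haar q0 q1 ug.
  exact: level_L1M lu (vlad_bdd mu_haar q0 q1 ug) (vlad_L1 mu_haar q0 q1 ug).
have E (k : int) : l <= k -> sqnorm2 mu (fun x => sol (vtx x k) - f x) =
    ((q ^ (k + 1)) ^+ 2 * G)%:E.
  move=> lk; have -> : (fun x => sol (vtx x k) - f x) =
      (fun x => Complex (- q ^ (k + 1) * vlad a x) (- q ^ (k + 1) * vlad b x)).
    apply/funext => x; rewrite (sol_error x lk).
    move: (vlad a x) (vlad b x) => c d.
    by apply: complex_eq; rewrite ?ReN ?ImN ?ReM ?ImM /=; ring.
  have sq (u : Qpn -> R) : (fun x => - q ^ (k + 1) * u x * (- q ^ (k + 1) * u x)) =
      (fun x => (q ^ (k + 1)) ^+ 2 * (u x * u x)).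
    by apply/funext => x; move: (u x) => c; ring.
  rewrite sqnorm2E ?sq; [|exact/L1Z/LL|exact/L1Z/LL].
  by rewrite !IntZ -?mulrDr //; exact: LL.
have qG : (q ^+ 2) ^+ i * (q ^+ 2 * G) @[i --> \oo] --> (0 : R).
  rewrite -[X in _ --> X](mul0r (q ^+ 2 * G)); apply: cvgMl; apply: cvg_expr.
  by rewrite ger0_norm ?exprn_ge0 ?(ltW q0) // exprn_ilt1 ?(ltW q0).
have qGE : ((q ^+ 2) ^+ i * (q ^+ 2 * G))%:E @[i --> \oo] --> (0%:E : \bar R).
  by apply: cvg_EFin => //; exact: nearW.
apply: cvg_trans qGE; apply: near_eq_cvg.
exists `|l|%N => // i /= li; rewrite E; last by lia.
congr (_%:E); rewrite (_ : i%:Z + 1 = i.+1%:Z); last by lia.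
by rewrite -exprnP -!exprM mulrA -exprD; congr (_ ^+ _ * _); lia.
Qed.

Lemma powR_q (k : nat) : p%:R `^ (k.+1%:R * s) = (q ^ (k%:Z + 1))^-1.
Proof. by rewrite q_exp powRN invrK (_ : k%:Z + 1 = k.+1%:Z) //; lia. Qed.

Lemma normal_derivativeE (k : nat) x : l <= k%:Z ->
  (p%:R `^ (k.+1%:R * s))%:C%C * (f x - sol (vtx x k%:Z)) = g x.
Proof.
move=> lk; rewrite -opprB (sol_error x lk) opprK mulrA -rmorphM.
by rewrite powR_q mulVf ?rmorph1 ?mul1r // expfz_neq0 // lt0r_neq0.
Qed.

Lemma normal_derivative_cvg x :
  ((p%:R `^ (k.+1%:R * s))%:C%C * (f x - sol (vtx x k%:Z)) : R[i]^o)
    @[k --> \oo] --> (g x : R[i]^o).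
Proof.
apply: cvg_near_cst; exists `|l|%N => // k /= lk.
by apply: normal_derivativeE; lia.
Qed.

(** The sequence equals its limit from level l on. Membership in L^2 must still be checked at every
    k; there the function is constant on cosets of level max(l, k). *)
Lemma normal_derivative_cvgL2 : cvgL2 mu
  (fun (k : nat) x => (p%:R `^ (k.+1%:R * s))%:C%C * (f x - sol (vtx x k%:Z)))
  (fun x => g x).
Proof.
split=> [k||]; [|exact: vlad_inL2|].
  have [ka paL paM] := phi_test_fun mu_haar q0 q1 ag k.
  have [kb pbL pbM] := phi_test_fun mu_haar q0 q1 bg k.
  have [[la aL aM] [lb bL bM]] := (ag, bg).
  pose c : R := p%:R `^ (k.+1%:R * s).
  under eq_fun do rewrite sol_vtx.
  have -> : (fun x => c%:C%C * (f x - Complex (phi a k x) (phi b k x))) =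
      fun x => Complex (c * (a x - phi a k x)) (c * (b x - phi b k x)).
    apply/funext => x; move: (a x) (b x) (phi a k x) (phi b k x) => ? ? ? ?.
    by apply: complex_eq; rewrite ?ReM ?ImM ?ReD ?ImD ?ReN ?ImN /=; ring.
  have H u (w : Qpn -> R) : lcst l u -> lcst k w -> lcst (Num.max l k) (fun x => c * (u x - w x)).
    move=> lu kw x y xy; rewrite (lu x y) ?(kw x y) //.
      by apply: pcoset_le xy; rewrite le_max lexx orbT.
    by apply: pcoset_le xy; rewrite le_max lexx.
  have B u (w : Qpn -> R) : (forall x, `|u x| <= M) -> (forall x, `|w x| <= M) ->
      bdd (fun x => c * (u x - w x)).
    move=> uM wM; exists (`|c| * (M + M)) => x; rewrite normrM ler_wpM2l //.
    by rewrite (le_trans (ler_normB _ _)) // lerD.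
  apply: (@level_inL2 (Num.max l k)); do ?[exact: H|exact: B].
  - exact/L1Z/L1B.
  - exact/L1Z/L1B.
apply: cvg_near_cst; exists `|l|%N => // k /= lk.
have -> : (fun x => (p%:R `^ (k.+1%:R * s))%:C%C * (f x - sol (vtx x k%:Z)) - g x) =
    fun=> 0.
  by apply/funext => x; rewrite normal_derivativeE ?subrr //; lia.
by rewrite /sqnorm2 modulus0 expr0n /= integral0.
Qed.

Local Notation dphi := (dphi mu q).

Definition energy : R :=
  (1 - q) * (Int (fun x => a x * vlad a x) + Int (fun x => b x * vlad b x)).

Lemma sol_level_energy k :
  ((p%:R `^ (k%:~R * s))%:E *
     sqnorm2 mu (fun x => sol (vtx x k) - sol (vtx x (k - 1))%R)%R)%E =
  (q ^ (- k) * Int (fun x => dphi a k x * dphi a k x) +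
   q ^ (- k) * Int (fun x => dphi b k x * dphi b k x))%:E.
Proof.
have -> : (fun x => sol (vtx x k) - sol (vtx x (k - 1))) =
    fun x => Complex (dphi a k x) (dphi b k x).
  by apply/funext => x; rewrite !sol_vtx.
have LL u : test_fun mu l M u -> L1 (fun x => dphi u k x * dphi u k x).
  move=> ug; have lu := @dphi_lcst _ _ _ _ _ mu_haar _ q0 q1 _ _ _ ug k.
  exact: level_L1M lu (dphi_bdd mu_haar q0 q1 ug k) (dphi_L1 mu_haar q0 q1 ug k).
rewrite (sqnorm2E (LL a ag) (LL b bg)) -EFinM -mulrDr q_exp.
by rewrite intrN mulNr opprK.
Qed.

Lemma energy_levels_sol : energy_levels mu s sol = energy%:E.
Proof.
have [fa fb] := (flux_step mu_haar q0 q1 ag ag, flux_step mu_haar q0 q1 bg bg).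
have sq_ge0 u k : 0 <= q ^ (- k) * Int (fun x => dphi u k x * dphi u k x).
  by apply: mulr_ge0; [exact/exprz_ge0/ltW|apply: Int_ge0 => x; rewrite -expr2 sqr_ge0].
rewrite /energy_levels (eq_esum (fun k _ => sol_level_energy k)).
apply: (@esum_int_telescope _ _ (fun k => flux mu q a a k + flux mu q b b k)).
- by move=> k; apply: addr_ge0; exact: sq_ge0.
- have alg (A B A0 B0 x y : R) : x = A - A0 -> y = B - B0 -> x + y = A + B - (A0 + B0).
    by move=> -> ->; ring.
  by move=> k; exact: alg (fa k) (fb k).
- rewrite /energy mulrDr; apply: cvgD.
    exact: (@flux_cvg _ _ _ _ _ mu_haar _ q0 q1 _ _ _ _ ag ag).
  exact: (@flux_cvg _ _ _ _ _ mu_haar _ q0 q1 _ _ _ _ bg bg).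
- rewrite -[X in _ --> X](addr0 (0 : R)); apply: cvgD.
    exact: (@flux_cvg0 _ _ _ _ _ mu_haar _ q0 q1 _ _ _ _ ag ag).
  exact: (@flux_cvg0 _ _ _ _ _ mu_haar _ q0 q1 _ _ _ _ bg bg).
Qed.

(** The imaginary part of the integrand is a vlad(b) - b vlad(a), whose integral is 0 by [vlad_sym];
    the real part is the sum of the two real energies. *)
Lemma energy_cintegral :
  energy%:C%C = (1 - q)%:C%C * cintegral mu (fun x => (f x)^*%C * g x).
Proof.
have LL (u v : Qpn -> R) : test_fun mu l M u -> test_fun mu l M v -> L1 (fun x => u x * vlad v x).
  move=> [lu uL uM] vg.
  by apply: level_L1M lu _ (vlad_L1 mu_haar q0 q1 vg); exists M.
have sym := vlad_sym mu_haar q0 q1 ag bg.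
rewrite cintegralE; have -> : Int (fun x => Im ((f x)^*%C * g x)) = 0.
  rewrite -[RHS](subrr (Int (fun x => a x * vlad b x))) [in X in _ - X]sym.
  rewrite -IntB; [|exact: LL ag bg|exact: LL bg ag].
  by apply: Int_eq => x; rewrite ImM /= mulNr.
have -> : Int (fun x => Re ((f x)^*%C * g x)) =
    Int (fun x => a x * vlad a x) + Int (fun x => b x * vlad b x).
  rewrite -IntD; [|exact: LL ag ag|exact: LL bg bg].
  by apply: Int_eq => x; rewrite ReM /= mulNr opprK.
by rewrite /energy rmorphM.
Qed.

End DirichletSolution.

Lemma schwartz_test_fun (R : realType) (p : nat) (p_pr : prime p) (n : nat)
    (mu : {measure set (borel_Qpn p_pr n) -> \bar R}) (mu_haar : normalized_haar mu)
    (f : 'rV[padic p_pr]_n -> R[i]) : schwartz f ->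
  exists l m (M : R), [/\ test_fun mu l M (fun x => complex.Re (f x)),
    test_fun mu l M (fun x => complex.Im (f x)) & forall x, ~ pcoset 0 m x -> f x = 0].
Proof.
move=> /schwartz_lcst[l [m [M [lf f0 fM]]]]; exists l, m, M.
have L (r : R[i] -> R) : r 0 = 0 -> (forall z, `|r z| <= modulus z) ->
    test_fun mu l M (fun x => r (f x)).
  move=> r0 rle; have lr : lcst l (fun x => r (f x)).
    by move=> x y /lf xy; rewrite xy.
  have rM x : `|r (f x)| <= M by exact: le_trans (rle _) (fM x).
  (* A bounded function equal to its product with the indicator of a coset, which has finite volume,
     is integrable. *)
  split=> //; apply: (L1_eq (u := fun x => r (f x) * ind R 0 m x)) => [x|].
    have [xm|xm] := pselect (pcoset 0 m x); first by rewrite indT ?mulr1.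
    by rewrite f0 // r0 mul0r.
  by apply: (level_L1M lr); [exists M|exact: ind_L1].
by split=> //; apply: L => // z; [exact: modulus_Re|exact: modulus_Im].
Qed.

Theorem theorem1p2 (R : realType) (p : nat) (p_pr : prime p)
    (n : nat) (n_ge1 : (1 <= n)%N) (s : R) (s_gt0 : 0 < s)
    (mu : {measure set (borel_Qpn p_pr n) -> \bar R})
    (mu_haar : normalized_haar mu)
    (f : 'rV[padic p_pr]_n -> R[i]) (f_schwartz : schwartz f) :
  exists phi : vertex p_pr n -> R[i],
    [/\ unique (bounded_continuous_solution s f) phi,
        (forall e : R, 0 < e -> \forall k \near \oo,
           forall x, modulus (phi (vtx x k%:Z) - f x) < e)
        /\ cvgL2 mu (fun k x => phi (vtx x k%:Z)) f,
        (forall x,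
           ((p%:R `^ (k.+1%:R * s))%:C%C * (f x - phi (vtx x k%:Z)) : R[i]^o)
             @[k --> \oo] --> (vladimirov mu s f x : R[i]^o))
        /\ cvgL2 mu
             (fun k x =>
                (p%:R `^ (k.+1%:R * s))%:C%C * (f x - phi (vtx x k%:Z)))
             (vladimirov mu s f)
      & exists E : R,
          [/\ energy_levels mu s phi = E%:E,
              energy_edges s phi = E%:E
            & E%:C%C = (1 - p%:R `^ (- s))%:C%C *
                cintegral mu (fun x => (f x)^*%C * vladimirov mu s f x)]].
Proof.
have [l [m [M [ag bg f0]]]] := schwartz_test_fun mu_haar f_schwartz.
set a := fun x => complex.Re (f x) in ag; set b := fun x => complex.Im (f x) in bg.
have fE : f = fun x => Complex (a x) (b x) by apply/funext => x; exact: complex_eq.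
have a0 x : ~ pcoset 0 m x -> a x = 0 by move=> /f0; rewrite /a => ->.
have b0 x : ~ pcoset 0 m x -> b x = 0 by move=> /f0; rewrite /b => ->.
clearbody a b; rewrite fE in f_schwartz f0 *.
exists (sol mu s a b); rewrite (vladimirovE mu_haar s_gt0 ag bg); split.
- exact (sol_unique mu_haar s_gt0 ag bg a0 b0 n_ge1).
- split; last exact (sol_cvgL2 mu_haar s_gt0 ag bg).
  by move=> e e0; exact: (sol_uniform_nat mu_haar s_gt0 ag bg e0).
- split; last exact (normal_derivative_cvgL2 mu_haar s_gt0 ag bg).
  by move=> x; exact: (normal_derivative_cvg mu_haar s_gt0 ag bg).
- exists (energy mu s l a b); split.
  + exact (energy_levels_sol mu_haar s_gt0 ag bg).
  + by rewrite -(energy_levelsE mu_haar); exact (energy_levels_sol mu_haar s_gt0 ag bg).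
  + exact (energy_cintegral mu_haar s_gt0 ag bg).
Qed.
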